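(* Let $(\phi_{1,n})_{n=1}^{\infty}$ and $(\phi_{2,n})_{n=1}^{\infty}$ be sequences of holomorphic self-maps of $\mathbb{D}$ and assume that $\phi_{1,n}(0)\to a$ and $\phi_{2,n}(0)\to b$, where $a,b\in\mathbb{T}$. The following assertions are equivalent. (1) The sequences $(C_{\phi_{1,n}})_n$, $(C_{\phi_{2,n}})_n$ admit a disjointly $\mathcal{S}$-universal singular inner function. (2) There is a subsequence $(n_k)$ such that $$\lim_{k\to\infty}\frac{|\phi_{1,n_k}'(0)|}{1-|\phi_{1,n_k}(0)|^2}=\lim_{k\to\infty}\frac{|\phi_{2,n_k}'(0)|}{1-|\phi_{2,n_k}(0)|^2}=1$$ and $$\rho(\phi_{1,n_k}(0),\phi_{2,n_k}(0))\to 1\quad\text{as }k\to\infty.$$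
   Context: $\mathbb{D}=\{z\in\mathbb{C}:|z|<1\}$ and $\mathbb{T}=\{z\in\mathbb{C}:|z|=1\}$. $\mathcal{S}=\{f\in H(\mathbb{D}):0<|f(z)|\le 1\ \ \forall z\in\mathbb{D}\}\cup\{0\}$, endowed with the topology of uniform convergence on compact subsets of $\mathbb{D}$. For $\phi:\mathbb{D}\to\mathbb{D}$ holomorphic, $C_\phi(f)=f\circ\phi$ is the composition operator, which maps $\mathcal{S}$ into itself. A function $f\in\mathcal{S}$ is disjointly $\mathcal{S}$-universal for $(C_{\phi_{1,n}})_n,(C_{\phi_{2,n}})_n$ if $\{(f\circ\phi_{1,n},f\circ\phi_{2,n}):n\in\mathbb{N}\}$ is dense in $\mathcal{S}\times\mathcal{S}$ with the product topology. For $z,w\in\mathbb{D}$ the pseudo-hyperbolic distance is $\rho(z,w)=\left|\frac{z-w}{1-\overline{z}w}\right|$. *)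

(* Defs.v *)
From HB Require Import structures.
From mathcomp Require Import all_boot all_order all_algebra.
From mathcomp Require Import complex.
From mathcomp Require Import all_classical all_reals all_analysis.

Set Implicit Arguments.
Unset Strict Implicit.
Unset Printing Implicit Defensive.

Import Order.TTheory GRing.Theory Num.Theory.
Import numFieldNormedType.Exports.

Local Open Scope classical_set_scope.
Local Open Scope ring_scope.

(* MathComp-Analysis provides the norm topology on K^o for every numFieldType K
   but does not declare it on R[i]; with these instances [derivable], [derive1],
   [cvg_to], [compact], ... on R[i] are the usual complex notions. *)
HB.instance Definition _ (R : realType) :=
  PseudoPointedMetric.copy R[i] R[i]^o.
HB.instance Definition _ (R : realType) := NormedModule.copy R[i] R[i]^o.

Section disjoint_universality.
Variable R : realType.
Local Notation C := R[i].

Definition disc : set C := [set z | `|z| < 1].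

Definition circle : set C := [set z | `|z| = 1].

(* Functions on the disc are represented by total functions C -> C whose values
   off the disc are irrelevant. *)
Definition holomorphic_on_disc (f : C -> C) :=
  forall z, disc z -> derivable f z 1.

Definition holomorphic_self_map (phi : C -> C) :=
  holomorphic_on_disc phi /\ (forall z, disc z -> disc (phi z)).

(* C -> C with the topology of uniform convergence on compact subsets of the
   disc. *)
Definition disc_compact (K : set C) : Prop := compact K /\ K `<=` disc.

Local Notation CD := {family disc_compact, C -> C}.

Definition classS : set CD :=
  [set f | holomorphic_on_disc f /\
    ((forall z, disc z -> 0 < `|f z| <= 1) \/ (forall z, disc z -> f z = 0))].

Definition comp_op (phi f : C -> C) : C -> C := f \o phi.

(* The closure is taken in the ambient space CD * CD; since the orbit lies in
   classS `*` classS, the inclusion is density in that subspace. *)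
Definition disjointly_universal (phi1 phi2 : nat -> C -> C) (f : CD) : Prop :=
  classS f /\
  classS `*` classS `<=`
    closure [set g : CD * CD |
      exists n, g = (comp_op (phi1 n) f, comp_op (phi2 n) f)].

Definition cexp (z : C) : C :=
  (expR (complex.Re z))%:C%C *
  (cos (complex.Im z) +i* sin (complex.Im z))%C.

Definition cis (t : R) : C := (cos t +i* sin t)%C.

Definition herglotz_kernel (z : C) (t : R) : C := (cis t + z) / (cis t - z).

Definition mutually_singular (mu nu : set (measurableTypeR R) -> \bar R) :=
  exists N, [/\ measurable N, mu N = 0%E & nu (~` N) = 0%E].

(* Finite positive Borel measures on the circle are parametrized by the angle in
   [0, 2 pi[: only the restriction of mu to that interval matters. *)
Definition herglotz_integral
    (mu : {finite_measure set (measurableTypeR R) -> \bar R}) (z : C) : C :=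
  (Rintegral mu `[0, 2 * pi[ (fun t => complex.Re (herglotz_kernel z t)) +i*
   Rintegral mu `[0, 2 * pi[ (fun t => complex.Im (herglotz_kernel z t)))%C.

(* f(z) = exp (- \int (zeta + z) / (zeta - z) dmu(zeta)) on the disc, with mu a
   finite positive measure singular with respect to the Lebesgue measure. *)
Definition singular_inner (f : C -> C) : Prop :=
  exists mu : {finite_measure set (measurableTypeR R) -> \bar R},
    mutually_singular mu (@lebesgue_measure R) /\
    forall z, disc z -> f z = cexp (- herglotz_integral mu z).

Definition pseudo_hyperbolic (z w : C) : C :=
  `|(z - w) / (1 - (z^*)%C * w)|.

End disjoint_universality.

(* Main.v *)
Require Import Defs.
From HB Require Import structures.
From mathcomp Require Import all_boot all_order all_algebra.
From mathcomp Require Import complex.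
From mathcomp Require Import all_classical all_reals all_analysis.
From mathcomp Require Import measurable_realfun.
From mathcomp Require Import ring lra.

(** Why the equivalence holds.  A singular inner function is [f = exp (- H)], with [H]
    the Herglotz integral of a singular measure; [Re H >= 0], and all estimates
    come from Harnack's inequality and the Schwarz-Pick lemma.

    Necessity ([universal_necessary]).  If [f o phi] is close to the extremal
    function [exp (- c (1 + z) / (1 - z))] on a circle and at its centre, then
    [Re (H (phi 0))] is close to [c], and the derivatives at the origin are close as
    well.  Since [|H'(z)| (1 - |z|^2) <= 2 Re (H z)], the derivative of [f o phi] has
    modulus at most [2 u exp (- u)] times the Schwarz-Pick ratio of [phi], with
    [u = Re (H (phi 0))], whereas the extremal function has [2 c exp (- c)]: the ratio
    must be close to 1.  Applying this with a large [c] for the first map and a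
    small one for the second makes [Re H] take very different values at the two
    centres, and Harnack's inequality then forces their pseudo-hyperbolic distance
    to be close to 1.

    Sufficiency ([universal_measure]).  By Schwarz's integral formula, the functions
    [exp (- (hsum L z + i t))], with [L] a finite atomic measure on the circle, are
    dense in the class, and countably many suffice ([code_dense]).  The measure is
    built in stages, each of which adds finitely many atoms of small total mass so
    that [f o phi1 n] and [f o phi2 n] approximate two prescribed such functions for
    one index [n].  When the Schwarz-Pick ratio of [phi] is close to 1, [phi] is a
    rotation, up to a small error, in the coordinates centred at [phi 0], and the
    Herglotz kernel is covariant under disc automorphisms up to an imaginary
    constant ([hkernel_moebius]); hence the target is produced by transporting its
    atoms, whose masses become small as [phi 0] tends to the circle
    ([mass_push]).  One further atom corrects the imaginary constant
    ([phase_large]).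

    Three sources of interference have to be controlled.  The atoms of earlier
    stages avoid the limits [a] and [b] of the two centres, so that their real part
    is negligible for large [n], and an atomic sum with negligible real part at
    [phi 0] is almost an imaginary constant along [phi] ([hsum_selfmap_im]), which
    the phase atom absorbs.  The two families of one stage live near hyperbolically
    distant points: the point closer to the circle is served last and takes into
    account the phase created by the first family, while its own atoms are
    invisible from the other point, phase included ([hsum_push_far]).  Later stages
    are given so little mass that they do not disturb what has been achieved
    ([small_mass_perturb]). *)

Set Implicit Arguments.
Unset Strict Implicit.
Unset Printing Implicit Defensive.

Import Order.TTheory GRing.Theory Num.Theory.
Import numFieldNormedType.Exports.

Local Open Scope classical_set_scope.
Local Open Scope ring_scope.

(** * Real modulus, limits and derivatives in the complex plane *)

Section Modulus.
Variable R : realType.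
Local Notation C := R[i].
Implicit Types (x y : R) (z w : C).

(** The norm of [R[i]] takes its values in [R[i]], partially ordered; estimates
    are carried out with its real part. *)
Definition cabs (z : C) : R := complex.Re `|z|.

Lemma normCE z : `|z| = (cabs z)%:C%C.
Proof. by case: z. Qed.

Lemma cabs_ge0 z : 0 <= cabs z.
Proof. by rewrite -ler0c -normCE normr_ge0. Qed.

Lemma cabsM z w : cabs (z * w) = cabs z * cabs w.
Proof. by apply: (@complexI R); rewrite rmorphM/= -!normCE normrM. Qed.

Lemma cabsV z : cabs z^-1 = (cabs z)^-1.
Proof. by apply: (@complexI R); rewrite fmorphV/= -!normCE normfV. Qed.

Lemma cabsD z w : cabs (z + w) <= cabs z + cabs w.
Proof. by rewrite -lecR rmorphD/= -!normCE ler_normD. Qed.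

Lemma cabsN z : cabs (- z) = cabs z.
Proof. by rewrite /cabs normrN. Qed.

Lemma cabsC z w : cabs (z - w) = cabs (w - z).
Proof. by rewrite -cabsN opprB. Qed.

Lemma cabs0 : cabs 0 = 0.
Proof. by rewrite /cabs normr0. Qed.

Lemma cabs1 : cabs 1 = 1.
Proof. by rewrite /cabs normr1. Qed.

Lemma cabs0P z : cabs z = 0 -> z = 0.
Proof. by move=> h; apply/eqP; rewrite -normr_eq0 normCE h. Qed.

Lemma cabs_gt0 z : (0 < cabs z) = (z != 0).
Proof. by rewrite -ltcR -normCE normr_gt0. Qed.

Lemma cabs_eq0 z : (cabs z == 0) = (z == 0).
Proof.
by apply/eqP/eqP => [/cabs0P//|->]; rewrite cabs0.
Qed.

Lemma cabs_real x : cabs x%:C%C = `|x|.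
Proof. by rewrite /cabs normc_def /= expr0n/= addr0 sqrtr_sqr. Qed.

Lemma cabs_pos x : 0 <= x -> cabs x%:C%C = x.
Proof. by move=> x0; rewrite cabs_real ger0_norm. Qed.

Lemma cabs_conj z : cabs (z^*)%C = cabs z.
Proof. by rewrite /cabs normcJ. Qed.

Lemma cabs_sqr z : cabs z ^+ 2 = complex.Re z ^+ 2 + complex.Im z ^+ 2.
Proof.
by rewrite /cabs normc_def /= sqr_sqrtr// addr_ge0// sqr_ge0.
Qed.

Lemma cabs_i : cabs ('i)%C = 1.
Proof.
apply/eqP; rewrite -(@eqrXn2 _ 2)// ?cabs_ge0// cabs_sqr /=.
by rewrite expr0n /= add0r.
Qed.

Lemma Re_le_cabs z : `|complex.Re z| <= cabs z.
Proof.
by rewrite -lecR -normCE normc_ge_Re.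
Qed.

Lemma cabs_Re z : complex.Re z <= cabs z.
Proof. exact: le_trans (ler_norm _) (Re_le_cabs z). Qed.

Lemma Im_le_cabs z : `|complex.Im z| <= cabs z.
Proof.
rewrite -(@ler_pXn2r _ 2)// ?nnegrE ?cabs_ge0// cabs_sqr real_normK ?num_real//.
by rewrite lerDr sqr_ge0.
Qed.

Lemma cabs_le_ReIm z : cabs z <= `|complex.Re z| + `|complex.Im z|.
Proof.
rewrite -(@ler_pXn2r _ 2)// ?nnegrE ?cabs_ge0 ?addr_ge0// cabs_sqr.
rewrite sqrrD !real_normK ?num_real// lerD2r lerDl.
by rewrite mulrn_wge0// mulr_ge0.
Qed.

Lemma cabs_triB z w : cabs z - cabs w <= cabs (z - w).
Proof. by rewrite lerBlDr; apply: le_trans (cabsD _ _); rewrite subrK. Qed.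

Lemma cabs_tri z w u : cabs (z - u) <= cabs (z - w) + cabs (w - u).
Proof.
have -> : z - u = (z - w) + (w - u) by rewrite addrA subrK.
exact: cabsD.
Qed.

Lemma cabs_sum (I : Type) (s : seq I) (P : pred I) (F : I -> C) :
  cabs (\sum_(i <- s | P i) F i) <= \sum_(i <- s | P i) cabs (F i).
Proof.
elim/big_ind2 : _ => [||//]; first by rewrite cabs0.
by move=> a b c d h k; apply: le_trans (cabsD _ _) (lerD h k).
Qed.

Lemma mulcJ z : z * (z^*)%C = (cabs z ^+ 2)%:C%C.
Proof. by rewrite -sqr_normc normCE rmorphXn. Qed.

Lemma ReD z w : complex.Re (z + w) = complex.Re z + complex.Re w.
Proof. by case: z; case: w. Qed.
Lemma ImD z w : complex.Im (z + w) = complex.Im z + complex.Im w.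
Proof. by case: z; case: w. Qed.
Lemma ReN z : complex.Re (- z) = - complex.Re z.
Proof. by case: z. Qed.
Lemma ImN z : complex.Im (- z) = - complex.Im z.
Proof. by case: z. Qed.
Lemma ReM z w : complex.Re (z * w) =
  complex.Re z * complex.Re w - complex.Im z * complex.Im w.
Proof. by case: z; case: w. Qed.
Lemma ImM z w : complex.Im (z * w) =
  complex.Re z * complex.Im w + complex.Im z * complex.Re w.
Proof. by case: z; case: w. Qed.
Lemma ReZ x z : complex.Re (x%:C%C * z) = x * complex.Re z.
Proof. by rewrite ReM /= mul0r subr0. Qed.
Lemma ImZ x z : complex.Im (x%:C%C * z) = x * complex.Im z.
Proof. by rewrite ImM /= mul0r addr0. Qed.
Lemma Re_conj z : complex.Re (z^*)%C = complex.Re z.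
Proof. by case: z. Qed.
Lemma Im_conj z : complex.Im (z^*)%C = - complex.Im z.
Proof. by case: z. Qed.

Lemma complexReIm z :
  z = (complex.Re z)%:C%C + ('i)%C * (complex.Im z)%:C%C.
Proof. exact: complexE. Qed.

Lemma complex_ext z w :
  complex.Re z = complex.Re w -> complex.Im z = complex.Im w -> z = w.
Proof. by case: z => ? ?; case: w => ? ? /= -> ->. Qed.

Lemma discE z : disc z <-> cabs z < 1.
Proof. by rewrite /disc /= normCE -[X in _ < X]/((1 : R)%:C%C) ltcR. Qed.

Lemma circleE z : circle z <-> cabs z = 1.
Proof.
rewrite /circle /= normCE; split => [|->//].
by rewrite -[X in _ = X]/((1 : R)%:C%C) => /complexI.
Qed.

Lemma disc0 : disc (0 : C).
Proof. by apply/discE; rewrite cabs0. Qed.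

End Modulus.

Section Topology.
Variable R : realType.
Local Notation C := R[i].

Lemma nbhsCP (z : C) (P : set C) :
  nbhs z P <-> exists2 e : R, 0 < e & forall w, cabs (w - z) < e -> P w.
Proof.
split.
  move=> /nbhs_ballP[e /= e0 h]; exists (complex.Re e).
    by move: e0; rewrite ltcE /= => /andP[].
  move=> w wz; apply: h; rewrite /ball /= distrC normCE.
  have -> : e = (complex.Re e)%:C%C.
    by rewrite RRe_real// realE ltW.
  by rewrite ltcR.
move=> [e e0 h]; apply/nbhs_ballP; exists e%:C%C; first by rewrite /= ltcR.
by move=> w; rewrite /ball /= distrC normCE ltcR; exact: h.
Qed.

Lemma cvgCP (T : Type) (F : set_system T) {FF : Filter F} (f : T -> C) (l : C) :
  f x @[x --> F] --> l <->
  forall e : R, 0 < e -> \forall x \near F, cabs (f x - l) < e.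
Proof.
split=> [fl e e0|h].
  by apply: (fl [set w | cabs (w - l) < e]); apply/nbhsCP; exists e.
by move=> A /nbhsCP[e e0 he]; apply: filterS (h e e0) => x /he.
Qed.

Lemma cvg_cabs (T : Type) (F : set_system T) {FF : Filter F}
    (f : T -> C) (l : C) :
  f x @[x --> F] --> l -> cabs (f x) @[x --> F] --> cabs l.
Proof.
move=> /cvgCP h; apply/cvgrPdist_lt => e e0; apply: filterS (h e e0) => x.
apply: le_lt_trans; rewrite ler_norml lerNl opprB.
by rewrite cabs_triB (cabsC (f x)) cabs_triB.
Qed.

End Topology.

(** Limits with errors in [R], along filters that may be generated by real radii,
    as [cnbhs] is. *)
Definition tends (R : realType) (T : Type) (F : set_system T) (f : T -> R[i])
    (l : R[i]) : Prop :=
  forall e : R, 0 < e -> F [set x | cabs (f x - l) < e].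

Definition cnbhs (R : realType) (z : R[i]) : set_system R[i] :=
  [set P | exists2 d : R, 0 < d & forall w, cabs (w - z) < d -> P w].

Global Instance cnbhs_filter (R : realType) (z : R[i]) : Filter (cnbhs z).
Proof.
split.
- by exists 1.
- move=> P Q [d d0 hd] [e e0 he]; exists (Num.min d e); first by rewrite lt_min d0.
  by move=> w; rewrite lt_min => /andP[/hd ? /he ?].
- by move=> P Q PQ [d d0 hd]; exists d => // w /hd /PQ.
Qed.

Section ComplexLimits.
Variables (R : realType) (T : Type) (F : set_system T).
Context {FF : Filter F}.
Local Notation C := R[i].
Implicit Types (f g : T -> C) (l m : C).

Lemma tendsD f g l m : tends F f l -> tends F g m ->
  tends F (fun x => f x + g x) (l + m).
Proof.
move=> fl gm; move=> e e0.
have e20 : 0 < e / 2 by rewrite divr_gt0.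
apply: filterS2 (fl _ e20) (gm _ e20) => x /= h1 h2.
rewrite opprD addrACA; apply: le_lt_trans (cabsD _ _) _.
by rewrite [ltRHS]splitr ltrD.
Qed.

Lemma tendsN f l : tends F f l -> tends F (fun x => - f x) (- l).
Proof.
move=> fl; move=> e e0; apply: filterS (fl _ e0) => x /=.
by rewrite -opprD cabsN.
Qed.

Lemma tendsB f g l m : tends F f l -> tends F g m ->
  tends F (fun x => f x - g x) (l - m).
Proof. by move=> fl /tendsN; exact: tendsD. Qed.

Lemma tendsM f g l m : tends F f l -> tends F g m ->
  tends F (fun x => f x * g x) (l * m).
Proof.
move=> fl gm; move=> e e0.
have L0 := cabs_ge0 l; have M0 := cabs_ge0 m.
pose d := Num.min 1 (e / (cabs l + cabs m + 2)).
have D0 : 0 < cabs l + cabs m + 2 by rewrite ltr_wpDl ?addr_ge0.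
have d0 : 0 < d by rewrite lt_min ltr01/= divr_gt0.
apply: filterS2 (fl _ d0) (gm _ d0) => x /= h1 h2.
have -> : f x * g x - l * m = (f x - l) * (g x - m) + (f x - l) * m + l * (g x - m).
  by ring.
have de : d * (cabs l + cabs m + 2) <= e.
  by rewrite -ler_pdivlMr// ge_min lexx orbT.
have d1 : d <= 1 by rewrite ge_min lexx.
apply: le_lt_trans (cabsD _ _) _; apply: (@le_lt_trans _ _ (cabs (f x - l) * cabs (g x - m)
  + cabs (f x - l) * cabs m + cabs l * cabs (g x - m))).
  by rewrite -!cabsM lerD2r; exact: cabsD.
have A0 := cabs_ge0 (f x - l); have B0 := cabs_ge0 (g x - m).
have h3 : cabs (f x - l) * cabs (g x - m) <= d by nra.
have h4 : cabs (f x - l) * cabs m <= d * cabs m by rewrite ler_wpM2r// ltW.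
have h5 : cabs l * cabs (g x - m) <= cabs l * d by rewrite ler_wpM2l// ltW.
nra.
Qed.

Lemma tendsV f l : l != 0 -> tends F f l -> tends F (fun x => (f x)^-1) l^-1.
Proof.
move=> l0 fl; move=> e e0.
have L0 : 0 < cabs l by rewrite cabs_gt0.
have d1 : 0 < cabs l / 2 by rewrite divr_gt0.
have d2 : 0 < e * (cabs l ^+ 2 / 2) by rewrite !mulr_gt0.
apply: filterS2 (fl _ d1) (fl _ d2) => x /= h1 h2.
have h3 : cabs l / 2 < cabs (f x).
  by have := cabs_triB l (f x); rewrite cabsC; lra.
have fx0 : f x != 0 by rewrite -cabs_gt0; lra.
have -> : (f x)^-1 - l^-1 = - (f x - l) / (f x * l).
  by field; rewrite fx0 l0.
rewrite cabsM cabsN cabsV cabsM ltr_pdivrMr ?mulr_gt0//; last by lra.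
apply: (lt_le_trans h2); rewrite ler_pM2l//; nra.
Qed.

Lemma tends_cst l : tends F (fun=> l) l.
Proof. by move=> e e0; apply: filterE => x /=; rewrite subrr cabs0. Qed.

Lemma tends_near f g l : F [set x | f x = g x] -> tends F f l -> tends F g l.
Proof.
by move=> fg fl e e0; apply: filterS2 fg (fl _ e0) => x /= ->.
Qed.

Lemma tends_neq0 f l : l != 0 -> tends F f l -> F [set x | f x != 0].
Proof.
move=> l0 fl; have := fl (cabs l); rewrite cabs_gt0 => /(_ l0).
apply: filterS => x h; apply/eqP => fx0.
by move: h; rewrite /= fx0 sub0r cabsN ltxx.
Qed.

End ComplexLimits.

Section PointLimits.
Variable R : realType.
Local Notation C := R[i].
Implicit Types (z l : C) (f g : C -> C).

Lemma tends_id z : tends (cnbhs z) id z.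
Proof. by move=> e e0; exists e. Qed.

Lemma tends_comp f g z l : tends (cnbhs z) g (g z) -> tends (cnbhs (g z)) f l ->
  tends (cnbhs z) (f \o g) l.
Proof.
move=> gz fl e /fl[d d0 hd].
by have [d' d'0 hd'] := gz _ d0; exists d' => // w /hd' /hd.
Qed.

Lemma cnbhs_singleton z (P : set C) : cnbhs z P -> P z.
Proof. by move=> [d d0]; apply; rewrite subrr cabs0. Qed.

End PointLimits.


Section ComplexDerivative.
Variable R : realType.
Local Notation C := R[i].
Implicit Types (f g : C -> C) (z l m : C).

(** Carathéodory's form of complex differentiability: the difference quotient
    extends continuously to [z].  It turns products, compositions and local
    inverses into continuity statements. *)
Definition cderiv (f : C -> C) (z l : C) : Prop :=
  exists q : C -> C, [/\ tends (cnbhs z) q l, q z = l &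
    forall w, f w - f z = q w * (w - z)].

Lemma cderivP (f : C -> C) z :
  derivable f z 1 -> cderiv f z (derive1 f z).
Proof.
move=> df; rewrite derive1E.
exists (fun w => if w == z then 'D_1 f z else (f w - f z) / (w - z)).
split.
- move=> e e0.
  move: df => /(@cvgCP _ _ _ (dnbhs_filter (0 : C)) _ _) /(_ e e0).
  rewrite -[lim _]/('D_1 f z).
  rewrite near_withinE => /nbhsCP[d d0 hd].
  exists d => // w wz /=.
  have [wz0|wz0] := eqVneq w z; first by rewrite subrr cabs0.
  have := hd (w - z); rewrite subr0 => /(_ wz).
  rewrite subr_eq0 => /(_ wz0) /=.
  by rewrite -[(w - z)%:A]/((w - z) * 1) mulr1 subrK -[_ *: _]/(_ * _) mulrC.
- by rewrite eqxx.
- move=> w; have [->|wz0] := eqVneq w z; first by rewrite !subrr mulr0.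
  by rewrite divfK// subr_eq0.
Qed.

Lemma cderiv_derivable (f : C -> C) z l : cderiv f z l ->
  derivable f z 1 /\ derive1 f z = l.
Proof.
move=> [q [ql qz hq]].
suff h : (fun h => h^-1 *: ((f \o shift z) (h *: (1 : C)) - f z)) @ 0^' --> l.
  split; first by apply/cvg_ex; exists l.
  by rewrite derive1E; apply/cvg_lim.
apply/(@cvgCP _ _ _ (dnbhs_filter (0 : C))) => e e0.
have [d d0 hd] := ql _ e0.
rewrite near_withinE; apply/nbhsCP; exists d => // h; rewrite subr0 => hd1 h0.
rewrite /= hq -[h%:A]/(h * 1) mulr1 addrK -[_ *: _]/(_ * _) mulrCA mulVf// mulr1.
by apply: hd; rewrite addrK.
Qed.

Lemma cderiv_cont f z l : cderiv f z l -> tends (cnbhs z) f (f z).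
Proof.
move=> [q [ql qz hq]].
have h : tends (cnbhs z) (fun w => f z + q w * (w - z)) (f z + l * (z - z)).
  apply: tendsD; first exact: tends_cst.
  apply: tendsM => //; apply: tendsB; [exact: tends_id|exact: tends_cst].
rewrite subrr mulr0 addr0 in h; apply: tends_near h.
by exists 1 => // w _ /=; rewrite -hq addrC subrK.
Qed.

Lemma cderiv_cst (c z : C) : cderiv (fun=> c) z 0.
Proof. by exists (fun=> 0); split => [|//|w]; [exact: tends_cst|rewrite subrr mul0r]. Qed.

Lemma cderiv_id (z : C) : cderiv id z 1.
Proof. by exists (fun=> 1); split => [|//|w]; [exact: tends_cst|rewrite mul1r]. Qed.

Lemma cderivD f g z l m : cderiv f z l -> cderiv g z m ->
  cderiv (fun w => f w + g w) z (l + m).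
Proof.
move=> [p [pl pz hp]] [q [qm qz hq]]; exists (fun w => p w + q w); split.
- exact: tendsD.
- by rewrite pz qz.
- by move=> w; rewrite mulrDl -hp -hq opprD addrACA.
Qed.

Lemma cderivM f g z l m : cderiv f z l -> cderiv g z m ->
  cderiv (fun w => f w * g w) z (l * g z + f z * m).
Proof.
move=> fl [q [qm qz hq]]; have [p [pl pz hp]] := fl.
exists (fun w => p w * g z + f w * q w); split.
- apply: tendsD; apply: tendsM => //; [exact: tends_cst|exact: cderiv_cont fl].
- by rewrite pz qz.
- by move=> w; rewrite mulrDl mulrAC -hp -mulrA -hq; ring.
Qed.

Lemma cderivN f z l : cderiv f z l -> cderiv (fun w => - f w) z (- l).
Proof.
move=> [p [pl pz hp]]; exists (fun w => - p w); split.
- exact: tendsN.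
- by rewrite pz.
- by move=> w; rewrite mulNr -hp opprB opprK addrC.
Qed.

Lemma cderivB f g z l m : cderiv f z l -> cderiv g z m ->
  cderiv (fun w => f w - g w) z (l - m).
Proof. by move=> fl /cderivN; exact: cderivD. Qed.

Lemma cderiv_comp f g z l m : cderiv g z m -> cderiv f (g z) l ->
  cderiv (fun w => f (g w)) z (l * m).
Proof.
move=> gm [p [pl pz hp]]; have [q [qm qz hq]] := gm.
exists (fun w => p (g w) * q w); split.
- apply: tendsM => //; apply: (tends_comp _ pl); exact: cderiv_cont gm.
- by rewrite pz qz.
- by move=> w; rewrite hp hq mulrA.
Qed.

Lemma cderiv_near f g z l : (cnbhs z [set w | f w = g w]) ->
  cderiv f z l -> cderiv g z l.
Proof.
move=> fg fl; have fgz : f z = g z by exact: cnbhs_singleton fg.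
have [p [pl pz hp]] := fl.
exists (fun w => if w == z then l else (g w - g z) / (w - z)); split.
- apply: tends_near pl; apply: filterS fg => w /= fgw.
  case: eqVneq => [->//|wz].
  by rewrite -fgw -fgz hp mulfK// subr_eq0.
- by rewrite eqxx.
- move=> w; case: eqVneq => [->|wz]; first by rewrite !subrr mulr0.
  by rewrite divfK// subr_eq0.
Qed.

Lemma cderivV f z l : f z != 0 -> cderiv f z l ->
  cderiv (fun w => (f w)^-1) z (- l / (f z) ^+ 2).
Proof.
move=> fz fl; have fc := cderiv_cont fl; have [p [pl pz hp]] := fl.
(* where [f] vanishes the inverse is not a quotient, so the identity is only
   established near [z] *)
have nz : cnbhs z [set w | f w != 0] by exact: (tends_neq0 fz fc).
pose h w := if f w == 0 then (f z)^-1 - p w / (f z) ^+ 2 * (w - z) else (f w)^-1.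
have hz : h z = (f z)^-1 by rewrite /h (negbTE fz).
apply: (@cderiv_near h).
  by apply: filterS nz => w; rewrite /= /h => /negbTE ->.
exists (fun w => if f w == 0 then - p w / (f z) ^+ 2 else - p w / (f w * f z)).
split.
- apply: (@tends_near _ _ _ _ (fun w => - p w / (f w * f z))).
    by apply: filterS nz => w /= /negbTE ->.
  apply: tendsM; first exact: tendsN.
  apply: tendsV; first by rewrite expf_neq0.
  by rewrite expr2; apply: tendsM => //; exact: tends_cst.
- by rewrite (negbTE fz) pz expr2.
- move=> w; rewrite hz /h; case: ifPn => [fw0|fw0]; first by ring.
  have : p w * (w - z) = f w - f z by rewrite hp.
  rewrite mulrAC !mulNr => ->; field; by rewrite fz.
Qed.

Lemma cderiv_div f g z l m : g z != 0 -> cderiv f z l -> cderiv g z m ->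
  cderiv (fun w => f w / g w) z ((l * g z - f z * m) / g z ^+ 2).
Proof.
move=> gz fl gm; have := cderivM fl (cderivV gz gm).
by rewrite (_ : _ + _ = (l * g z - f z * m) / g z ^+ 2)//; field.
Qed.

(** A continuous right inverse of a map with non-zero derivative is
    differentiable: the Carathéodory quotient of the inverse is the reciprocal
    of that of the map. *)
Lemma cderiv_inverse f g z l : tends (cnbhs z) g (g z) ->
  cnbhs z [set w | f (g w) = w] -> l != 0 -> cderiv f (g z) l ->
  cderiv g z l^-1.
Proof.
move=> gc fg l0 [p [pl pz hp]]; have fgz := cnbhs_singleton fg.
exists (fun w => if w == z then l^-1 else (g w - g z) / (w - z)); split.
- have pg : tends (cnbhs z) (p \o g) l by exact: (tends_comp gc pl).
  have nz : cnbhs z [set w | (p \o g) w != 0] by exact: (tends_neq0 l0 pg).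
  apply: tends_near (tendsV l0 pg); apply: filterS2 nz fg => w /= pn fgw.
  case: eqVneq => [->|wz]; first by rewrite pz.
  rewrite -[X in _ / (X - _)]fgw -[X in _ / (_ - X)]fgz hp.
  have gwz : g w - g z != 0.
    by apply: contra_neq wz => /subr0_eq h; rewrite -fgw -fgz h.
  by rewrite invfM mulrCA divff// mulr1.
- by rewrite eqxx.
- move=> w; case: eqVneq => [->|wz]; first by rewrite !subrr mulr0.
  by rewrite divfK// subr_eq0.
Qed.

End ComplexDerivative.

(** * The complex exponential and complex-valued integrals *)

Section ComplexExponential.
Variable R : realType.
Local Notation C := R[i].
Implicit Types (z w : C) (s t x y e l : R).

Lemma cexpD z w : cexp (z + w) = cexp z * cexp w.
Proof.
rewrite /cexp ReD ImD expRD cosD sinD rmorphM /= mulrACA.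
by congr (_ * _); apply: complex_ext; rewrite ?ReM ?ImM /=; ring.
Qed.

Lemma cexp0 : cexp (0 : C) = 1.
Proof. by rewrite /cexp /= expR0 cos0 sin0 mul1r. Qed.

Lemma cexpN z : cexp (- z) = (cexp z)^-1.
Proof.
have h : cexp (- z) * cexp z = 1 by rewrite -cexpD addNr cexp0.
have z0 : cexp z != 0.
  by apply/eqP => z0; move: h; rewrite z0 mulr0 => /esym/eqP; rewrite oner_eq0.
by apply: (mulIf z0); rewrite h mulVf.
Qed.

Lemma cexp_neq0 z : cexp z != 0.
Proof.
apply/eqP => z0; have : cexp (- z) * cexp z = 1 by rewrite -cexpD addNr cexp0.
by rewrite z0 mulr0 => /esym/eqP; rewrite oner_eq0.
Qed.

Lemma cabs_cis t : cabs (cis t) = 1.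
Proof.
apply/eqP; rewrite -(@eqrXn2 _ 2)// ?cabs_ge0// cabs_sqr /= expr1n.
by rewrite cos2Dsin2.
Qed.

Lemma cisE t : cis t = cexp (0 +i* t)%C.
Proof. by rewrite /cexp /= expR0 mul1r. Qed.

Lemma cis_neq0 t : cis t != 0.
Proof. by rewrite cisE cexp_neq0. Qed.

Lemma cexpE z : cexp z = (expR (complex.Re z))%:C%C * cis (complex.Im z).
Proof. by []. Qed.

Lemma cabs_cexp z : cabs (cexp z) = expR (complex.Re z).
Proof. by rewrite cexpE cabsM cabs_cis mulr1 cabs_pos// expR_ge0. Qed.

Lemma cisD s t : cis (s + t) = cis s * cis t.
Proof.
by rewrite !cisE -cexpD; congr cexp; apply: complex_ext; rewrite ?ReD ?ImD //= addr0.
Qed.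

Lemma cisN t : cis (- t) = (cis t)^-1.
Proof. by rewrite !cisE -cexpN; congr cexp; apply: complex_ext; rewrite ?ReN ?ImN /= ?oppr0. Qed.

Lemma cis0 : cis (0 : R) = 1.
Proof. by rewrite cisE cexp0. Qed.

Lemma cis2pi : cis (2 * pi : R) = 1.
Proof. by rewrite /cis mulr_natl cos2pi sin2pi. Qed.

Lemma is_derive_eps (f : R -> R) x l : is_derive x 1 f l ->
  forall e, 0 < e -> exists2 d : R, 0 < d & forall h, `|h| < d ->
    `|f (x + h) - f x - l * h| <= e * `|h|.
Proof.
move=> [df dl] e e0.
have : (fun h => h^-1 *: ((f \o shift x) (h *: (1 : R)) - f x)) @ 0^' --> l.
  by rewrite -dl; exact: df.
move=> /cvgrPdist_lt /(_ e e0); rewrite near_withinE => /nbhs_ballP[d /= d0 hd].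
exists d => // h hh.
have [->|h0] := eqVneq h 0; first by rewrite addr0 subrr mulr0 subrr !normr0 mulr0.
have := hd h; rewrite /ball /= sub0r normrN => /(_ hh h0).
rewrite [h *: _]mulr1 [h + x]addrC [_ *: _]mulrC.
rewrite distrC => h1.
have -> : f (x + h) - f x - l * h = ((f (x + h) - f x) / h - l) * h by field.
by rewrite normrM ler_wpM2r// ltW.
Qed.

Lemma cexp_near0 e : 0 < e -> exists2 d : R, 0 < d & forall h : C, cabs h < d ->
  cabs (cexp h - 1 - h) <= e * cabs h.
Proof.
move=> e0; pose e1 := e / 8; have e10 : 0 < e1 by rewrite divr_gt0.
have [d1 d10 h1] := is_derive_eps (is_derive_expR (0 : R)) e10.
have [d2 d20 h2] := is_derive_eps (is_derive_cos (0 : R)) e10.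
have [d3 d30 h3] := is_derive_eps (is_derive_sin (0 : R)) e10.
pose d := Num.min (Num.min d1 d2) (Num.min (Num.min d3 1) e1).
exists d; first by rewrite !lt_min d10 d20 d30 ltr01 e10.
move=> [x y] hd.
have hx := le_lt_trans (Re_le_cabs _) hd; have hy := le_lt_trans (Im_le_cabs _) hd.
move: hx hy hd; rewrite /= !lt_min.
move=> /andP[/andP[x1 _] /andP[/andP[_ x4] xe]] /andP[/andP[_ y2] /andP[/andP[y3 _] _]] _.
have {}h1 := h1 x x1; have {}h2 := h2 y y2; have {}h3 := h3 y y3.
rewrite !add0r expR0 mul1r in h1.
rewrite !add0r cos0 sin0 oppr0 mul0r subr0 in h2.
rewrite !add0r cos0 sin0 subr0 mul1r in h3.
set al := expR x - 1 - x in h1.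
pose be : C := ((cos y - 1) +i* (sin y - y))%C.
have -> : cexp (x +i* y)%C - 1 - (x +i* y)%C =
    x%:C%C * (0 +i* y)%C + (1 + x)%:C%C * be + al%:C%C * cis y.
  apply: complex_ext; rewrite /cexp /cis /be /al; rewrite !(ReD, ImD, ReN, ImN, ReM, ImM) /=; ring.
set H := cabs (x +i* y)%C.
have xH : `|x| <= H := Re_le_cabs (x +i* y)%C.
have yH : `|y| <= H := Im_le_cabs (x +i* y)%C.
apply: le_trans (cabsD _ _) _; apply: (@le_trans _ _ (`|x| * `|y| + 2 * (e1 * `|y| + e1 * `|y|) + e1 * `|x|)).
  apply: lerD; last by rewrite cabsM cabs_cis mulr1 cabs_real.
  apply: le_trans (cabsD _ _) _; rewrite !cabsM !cabs_real; apply: lerD.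
    rewrite ler_wpM2l//; apply: le_trans (cabs_le_ReIm _) _.
    by rewrite /= normr0 add0r.
  apply: ler_pM => //; first exact: cabs_ge0.
    by apply: le_trans (ler_normD _ _) _; rewrite normr1 -[2]/(1 + 1) lerD2l ltW.
  by apply: le_trans (cabs_le_ReIm _) _; exact: lerD.
have X0 := normr_ge0 x; have Y0 := normr_ge0 y.
have H0 : 0 <= H by exact: cabs_ge0.
have k1 : `|x| * `|y| <= e1 * H by apply: ler_pM => //; exact: ltW.
have k2 : e1 * `|y| <= e1 * H by rewrite ler_pM2l.
have k3 : e1 * `|x| <= e1 * H by rewrite ler_pM2l.
have ee : e = 8 * e1 by rewrite /e1; field.
rewrite ee; nra.
Qed.

Lemma cexp_cont0 e : 0 < e -> exists2 d : R, 0 < d & forall h : C, cabs h < d ->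
  cabs (cexp h - 1) < e.
Proof.
move=> e0; have [d d0 hd] := cexp_near0 (@ltr01 R).
exists (Num.min d (e / 2)); first by rewrite lt_min d0 divr_gt0.
move=> h; rewrite lt_min => /andP[/hd h1 h2].
have -> : cexp h - 1 = (cexp h - 1 - h) + h by ring.
by apply: le_lt_trans (cabsD _ _) _; lra.
Qed.

Lemma cderiv_cexp z : cderiv (@cexp R) z (cexp z).
Proof.
exists (fun w => if w == z then cexp z else (cexp w - cexp z) / (w - z)).
split; last first.
- move=> w; case: eqVneq => [->|wz]; first by rewrite !subrr mulr0.
  by rewrite divfK// subr_eq0.
- by rewrite eqxx.
move=> e e0.
have c0 : 0 < cabs (cexp z) by rewrite cabs_gt0 cexp_neq0.
have e10 : 0 < e / 2 / cabs (cexp z) by rewrite !divr_gt0.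
have [d d0 hd] := cexp_near0 e10; exists d => // w wz /=.
case: eqVneq => [_|wz0]; first by rewrite subrr cabs0.
have wz1 : w - z != 0 by rewrite subr_eq0.
have -> : cexp w = cexp z * cexp (w - z) by rewrite -cexpD addrC subrK.
have -> : (cexp z * cexp (w - z) - cexp z) / (w - z) - cexp z =
  cexp z * ((cexp (w - z) - 1 - (w - z)) / (w - z)) by field.
have h1 := hd _ wz; rewrite cabsM cabsM cabsV.
apply: (@le_lt_trans _ _ (e / 2)); last by lra.
rewrite -ler_pdivlMl// ler_pdivrMr ?cabs_gt0// mulrC.
by rewrite (mulrC _^-1) mulrC.
Qed.

(** The exponential has modulus at most 1 on the left half-plane, so that its
    increments there are controlled by those at the origin. *)
Lemma cexp_lip : exists2 d : R, 0 < d & forall z w : C,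
  0 <= complex.Re z -> cabs (z - w) < d ->
  cabs (cexp (- z) - cexp (- w)) <= 2 * cabs (z - w).
Proof.
have [d d0 hd] := cexp_near0 (@ltr01 R); exists d => // z w z0 h.
have -> : cexp (- w) = cexp (- z) * cexp (z - w) by rewrite -cexpD addrA addNr add0r.
have -> : cexp (- z) - cexp (- z) * cexp (z - w) = - (cexp (- z) * (cexp (z - w) - 1)).
  by ring.
rewrite cabsN cabsM.
have h1 : cabs (cexp (z - w) - 1) <= 2 * cabs (z - w).
  have -> : cexp (z - w) - 1 = (cexp (z - w) - 1 - (z - w)) + (z - w) by ring.
  apply: le_trans (cabsD _ _) _; have := hd _ h; lra.
apply: le_trans h1; rewrite ler_piMl ?cabs_ge0//.
by rewrite cabs_cexp expR_le1 ReN oppr_le0.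
Qed.

Lemma cis_cont0 e : 0 < e -> exists2 d : R, 0 < d & forall s t, `|s - t| < d ->
  cabs (cis s - cis t) < e.
Proof.
move=> e0; have [d d0 hd] := cexp_cont0 e0; exists d => // s t st.
have -> : cis s = cis t * cis (s - t) by rewrite -cisD addrC subrK.
have -> : cis t * cis (s - t) - cis t = cis t * (cis (s - t) - 1) by ring.
rewrite cabsM cabs_cis mul1r cisE; apply: hd.
by apply: le_lt_trans (cabs_le_ReIm _) _; rewrite /= normr0 add0r.
Qed.

Lemma cis_surj z : cabs z = 1 -> exists2 t, 0 <= t < 2 * pi & cis t = z.
Proof.
move=> z1; have h : complex.Re z ^+ 2 + complex.Im z ^+ 2 = 1.
  by rewrite -cabs_sqr z1 expr1n.
case: z z1 h => x y z1 /= h.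
have x1 : -1 <= x <= 1.
  by rewrite -ler_norml; have := Re_le_cabs (x +i* y)%C; rewrite z1.
have s0 : 1 - x ^+ 2 = y ^+ 2 by rewrite -h; ring.
have a0 := acos_ge0 x1; have api := acos_lepi x1.
have pi0 := pi_gt0 R.
have ca : cos (acos x) = x by rewrite acosK// in_itv.
have [y0|y0] := leP 0 y.
  exists (acos x); first by rewrite a0/=; lra.
  by rewrite /cis ca sin_acos// s0 sqrtr_sqr ger0_norm.
exists (2 * pi - acos x); last first.
  rewrite /cis cosB sinB mulr_natl cos2pi sin2pi ca sin_acos// s0 sqrtr_sqr ltr0_norm//.
  by congr (_ +i* _)%C; ring.
have a1 : 0 < acos x.
  rewrite lt_neqAle a0 andbT; apply/eqP => e; move: ca; rewrite -e cos0 => x1'.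
  by move: s0; rewrite -x1' expr1n subrr => /esym/eqP; rewrite sqrf_eq0 lt_eqF.
by apply/andP; split; lra.
Qed.

Lemma polar z : exists2 t, 0 <= t < 2 * pi & z = (cabs z)%:C%C * cis t.
Proof.
have [->|z0] := eqVneq z 0.
  exists 0; first by rewrite lexx/= mulr_gt0// pi_gt0.
  by rewrite cabs0 mul0r.
have c0 : cabs z != 0 by rewrite cabs_eq0.
have c0' : (cabs z)%:C%C != 0 :> C by apply: contra_neq c0 => /complexI.
have [|t ht tz] := @cis_surj (z / (cabs z)%:C%C).
  by rewrite cabsM cabsV cabs_pos ?cabs_ge0// divff.
by exists t => //; rewrite tz mulrC divfK.
Qed.

End ComplexExponential.

Section ComplexIntegral.
Context d (T : measurableType d) (R : realType) (mu : {measure set T -> \bar R}).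
Variable D : set T.
Hypothesis mD : measurable D.
Local Notation C := R[i].
Implicit Types (f g : T -> C) (c : C).

Definition cintegral f : C :=
  (Rintegral mu D (fun t => complex.Re (f t)) +i*
   Rintegral mu D (fun t => complex.Im (f t)))%C.

Definition cintegrable f : Prop :=
  mu.-integrable D (EFin \o (fun t => complex.Re (f t))) /\
  mu.-integrable D (EFin \o (fun t => complex.Im (f t))).

Lemma eq_cintegral f g : (forall t, D t -> f t = g t) ->
  cintegral f = cintegral g.
Proof.
by move=> fg; congr (_ +i* _)%C; apply: eq_Rintegral => t /set_mem /fg ->.
Qed.

Lemma eq_cintegrable f g : (forall t, D t -> f t = g t) ->
  cintegrable f -> cintegrable g.
Proof.
move=> fg [h1 h2]; split; [apply: eq_integrable h1|apply: eq_integrable h2] => //;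
by move=> t /set_mem /fg /= ->.
Qed.

Lemma cintegrableD f g : cintegrable f -> cintegrable g ->
  cintegrable (fun t => f t + g t).
Proof.
move=> [f1 f2] [g1 g2]; split.
  apply: eq_integrable (integrableD mD f1 g1) => // t _ /=.
  by rewrite ReD EFinD.
apply: eq_integrable (integrableD mD f2 g2) => // t _ /=.
by rewrite ImD EFinD.
Qed.

Lemma cintegralD f g : cintegrable f -> cintegrable g ->
  cintegral (fun t => f t + g t) = cintegral f + cintegral g.
Proof.
move=> [f1 f2] [g1 g2]; apply: complex_ext; rewrite /cintegral ?ReD ?ImD /=.
  by rewrite -RintegralD//; apply: eq_Rintegral => t _; rewrite ReD.
by rewrite -RintegralD//; apply: eq_Rintegral => t _; rewrite ImD.
Qed.

Lemma cintegrableZ c f : cintegrable f -> cintegrable (fun t => c * f t).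
Proof.
move=> [f1 f2]; case: c => x y; split.
  have h := integrableB mD (integrableZl mD x f1) (integrableZl mD y f2).
  by apply: eq_integrable h => // t _ /=; rewrite ReM /= EFinB !EFinM.
have h := integrableD mD (integrableZl mD x f2) (integrableZl mD y f1).
by apply: eq_integrable h => // t _ /=; rewrite ImM /= EFinD !EFinM.
Qed.

Lemma cintegralZ c f : cintegrable f ->
  cintegral (fun t => c * f t) = c * cintegral f.
Proof.
move=> [f1 f2]; case: c => x y; apply: complex_ext; rewrite ?ReM ?ImM /=.
  have x1 : mu.-integrable D (EFin \o (fun t => x * complex.Re (f t))).
    by apply: eq_integrable (integrableZl mD x f1) => // t _.
  have y2 : mu.-integrable D (EFin \o (fun t => y * complex.Im (f t))).
    by apply: eq_integrable (integrableZl mD y f2) => // t _.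
  rewrite -(RintegralZl x mD f1) -(RintegralZl y mD f2) -RintegralB//.
  by apply: eq_Rintegral => t _; rewrite ReM.
have x2 : mu.-integrable D (EFin \o (fun t => x * complex.Im (f t))).
  by apply: eq_integrable (integrableZl mD x f2) => // t _.
have y1 : mu.-integrable D (EFin \o (fun t => y * complex.Re (f t))).
  by apply: eq_integrable (integrableZl mD y f1) => // t _.
rewrite -(RintegralZl x mD f2) -(RintegralZl y mD f1) -RintegralD//.
by apply: eq_Rintegral => t _; rewrite ImM.
Qed.

Lemma cintegrableN f : cintegrable f -> cintegrable (fun t => - f t).
Proof.
move=> fi; apply: eq_cintegrable (cintegrableZ (-1) fi) => t _.
by rewrite mulN1r.
Qed.

Lemma cintegrableB f g : cintegrable f -> cintegrable g ->
  cintegrable (fun t => f t - g t).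
Proof. by move=> fi /cintegrableN; exact: cintegrableD. Qed.

Lemma cintegralB f g : cintegrable f -> cintegrable g ->
  cintegral (fun t => f t - g t) = cintegral f - cintegral g.
Proof.
move=> fi gi; rewrite cintegralD//; last exact: cintegrableN.
congr (_ + _); rewrite -mulN1r -cintegralZ//.
by apply: eq_cintegral => t _; rewrite mulN1r.
Qed.

Lemma cintegral_cst c : cintegral (fun=> c) = (fine (mu D))%:C%C * c.
Proof.
apply: complex_ext; rewrite /cintegral ?ReZ ?ImZ /= Rintegral_cst// mulrC//.
Qed.

Lemma Re_cintegral f :
  complex.Re (cintegral f) = Rintegral mu D (fun t => complex.Re (f t)).
Proof. by []. Qed.

(** The sharp norm bound: after rotating the integral onto the positive axis it
    is the integral of a real part. *)
Lemma cabs_cintegral f (B : T -> R) : cintegrable f ->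
  mu.-integrable D (EFin \o B) -> (forall t, D t -> cabs (f t) <= B t) ->
  cabs (cintegral f) <= Rintegral mu D B.
Proof.
move=> fi Bi fB; set v := cintegral f.
have B0 : 0 <= Rintegral mu D B.
  by apply: Rintegral_ge0 => t /fB; apply: le_trans; exact: cabs_ge0.
have [->|v0] := eqVneq v 0; first by rewrite cabs0.
have cv0 : (cabs v)%:C%C != 0 :> C.
  by apply/eqP => /complexI /eqP; rewrite cabs_eq0 (negbTE v0).
pose c := (v^*)%C / (cabs v)%:C%C.
have c1 : cabs c = 1.
  by rewrite cabsM cabsV cabs_conj cabs_pos ?cabs_ge0// divff// cabs_eq0.
have cvE : c * v = (cabs v)%:C%C.
  by rewrite /c mulrAC (mulrC _ v) mulcJ rmorphXn /= expr2 mulfK.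
have -> : cabs v = complex.Re (cintegral (fun t => c * f t)).
  by rewrite cintegralZ// -/v cvE.
rewrite Re_cintegral; apply: le_Rintegral => //; first by have [] := cintegrableZ c fi.
move=> t /fB; apply: le_trans; apply: le_trans (cabs_Re _) _.
by rewrite cabsM c1 mul1r.
Qed.

Hypothesis muD : (mu D < +oo)%E.

Lemma cintegrable_bounded f (M : R) :
  measurable_fun D (fun t => complex.Re (f t)) ->
  measurable_fun D (fun t => complex.Im (f t)) ->
  (forall t, D t -> cabs (f t) <= M) -> cintegrable f.
Proof.
move=> m1 m2 fM; split; apply: measurable_bounded_integrable => //.
  exists M; split; [exact: num_real|move=> y My t /fM h].
  by apply: le_trans (ltW My); apply: le_trans h; exact: Re_le_cabs.
exists M; split; [exact: num_real|move=> y My t /fM h].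
by apply: le_trans (ltW My); apply: le_trans h; exact: Im_le_cabs.
Qed.

Lemma cintegrable_cst c : cintegrable (fun=> c).
Proof. by apply: (@cintegrable_bounded _ (cabs c)). Qed.

Lemma cabs_cintegral_cst f M : cintegrable f ->
  (forall t, D t -> cabs (f t) <= M) ->
  cabs (cintegral f) <= M * fine (mu D).
Proof.
move=> fi fM; rewrite -Rintegral_cst//; apply: cabs_cintegral => //.
have [h _] := cintegrable_cst (M%:C%C); exact: h.
Qed.

End ComplexIntegral.

(** * Goursat's theorem on rectangles *)

Section SegmentIntegral.
Variable R : realType.
Local Notation C := R[i].
Local Notation mu := (@lebesgue_measure R).
Implicit Types (f g : R -> C) (a b c m t s e M : R).

(** Continuity at the points of the segment, the nearby points being allowed to
    leave it: the functions integrated are restrictions of functions of [C]. *)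
Definition seg_continuous a b g : Prop :=
  forall t, a <= t <= b -> forall e, 0 < e ->
    exists2 d : R, 0 < d & forall s, `|s - t| < d -> cabs (g s - g t) < e.

Definition seg_integral a b g : C := cintegral mu `[a, b] g.

Lemma seg_measure a b : a <= b -> mu `[a, b] = (b - a)%:E.
Proof.
move=> ab; rewrite lebesgue_measure_itv /= lte_fin; case: ltP => [_|ba].
  by rewrite EFinB.
have -> : a = b by apply/le_anti; rewrite ab ba.
by rewrite subrr.
Qed.

Lemma seg_measure_fin a b : (mu `[a, b]%classic < +oo)%E.
Proof. by rewrite lebesgue_measure_itv /=; case: ifP => // _; rewrite ltry. Qed.

Lemma seg_cintegrable a b g : seg_continuous a b g -> cintegrable mu `[a, b] g.
Proof.
move=> gc; have cpt : compact `[a, b]%classic by exact: segment_compact.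
split.
- apply: (@continuous_compact_integrable R (fun t => complex.Re (g t)) `[a, b]) => //.
  apply: continuous_in_subspaceT => t /set_mem; rewrite /= in_itv /= => tab.
  apply/cvgrPdist_lt => e e0; have [d d0 hd] := gc _ tab _ e0.
  apply/nbhs_ballP; exists d => // s; rewrite /ball /= distrC => /hd.
  by apply: le_lt_trans; rewrite cabsC -ReN -ReD Re_le_cabs.
- apply: (@continuous_compact_integrable R (fun t => complex.Im (g t)) `[a, b]) => //.
  apply: continuous_in_subspaceT => t /set_mem; rewrite /= in_itv /= => tab.
  apply/cvgrPdist_lt => e e0; have [d d0 hd] := gc _ tab _ e0.
  apply/nbhs_ballP; exists d => // s; rewrite /ball /= distrC => /hd.
  by apply: le_lt_trans; rewrite cabsC -ImN -ImD Im_le_cabs.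
Qed.

Lemma seg_continuousB a b f g : seg_continuous a b f -> seg_continuous a b g ->
  seg_continuous a b (fun t => f t - g t).
Proof.
move=> fc gc t tab e e0; have e20 : 0 < e / 2 by rewrite divr_gt0.
have [d d0 hd] := fc _ tab _ e20; have [d' d'0 hd'] := gc _ tab _ e20.
exists (Num.min d d'); first by rewrite lt_min d0.
move=> s; rewrite lt_min => /andP[/hd h /hd' h'].
have -> : f s - g s - (f t - g t) = (f s - f t) - (g s - g t) by ring.
by apply: le_lt_trans (cabsD _ _) _; rewrite cabsN; lra.
Qed.

Lemma seg_integral_split a m b g : a <= m -> m <= b -> seg_continuous a b g ->
  seg_integral a b g = seg_integral a m g + seg_integral m b g.
Proof.
move=> am mb gc; have [g1 g2] := seg_cintegrable gc.
have h (k : R -> R) : mu.-integrable `[a, b] (EFin \o k) ->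
    Rintegral mu `[a, b] k = Rintegral mu `[a, m] k + Rintegral mu `[m, b] k.
  move=> ki; have := @Rintegral_itvB R k (BLeft a) (BRight b) m ki.
  rewrite !bnd_simp => /(_ am mb) h.
  rewrite -(@Rintegral_itv_obnd_cbnd _ m (BRight b)); last first.
    apply: integrableS ki => // t /=; rewrite !in_itv /= => /andP[h1 ->].
    by rewrite andbT (le_trans am)// ltW.
  by rewrite -h addrC subrK.
by apply: complex_ext; rewrite ?ReD ?ImD; exact: h.
Qed.

Lemma seg_integral_near_cst a b g (c0 : C) M : a <= b -> seg_continuous a b g ->
  (forall t, a <= t <= b -> cabs (g t - c0) <= M) ->
  cabs (seg_integral a b g - (b - a)%:C%C * c0) <= M * (b - a).
Proof.
move=> ab gc gM.
have mD : measurable `[a, b]%classic by exact: measurable_itv.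
have fin := seg_measure_fin a b.
have gi := seg_cintegrable gc.
have -> : (b - a)%:C%C * c0 = seg_integral a b (fun=> c0).
  rewrite /seg_integral cintegral_cst//; congr (_%:C%C * _).
  by rewrite [X in fine X](_ : _ = (b - a)%:E)//; exact: seg_measure.
rewrite -cintegralB//; last exact: cintegrable_cst.
have -> : b - a = fine (mu `[a, b]%classic).
  by rewrite [X in fine X](_ : _ = (b - a)%:E)//; exact: seg_measure.
apply: cabs_cintegral_cst => //.
by apply: cintegrableB => //; exact: cintegrable_cst.
Qed.

Lemma eq_seg_integral a b f g : (forall t, a <= t <= b -> f t = g t) ->
  seg_integral a b f = seg_integral a b g.
Proof.
move=> fg; apply: eq_cintegral => t /=; rewrite in_itv /=; exact: fg.
Qed.

Lemma seg_integralB a b f g : seg_continuous a b f -> seg_continuous a b g ->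
  seg_integral a b (fun t => f t - g t) = seg_integral a b f - seg_integral a b g.
Proof.
move=> fc gc; rewrite /seg_integral cintegralB//; exact: seg_cintegrable.
Qed.

End SegmentIntegral.

Section Goursat.
Variable R : realType.
Local Notation C := R[i].
Implicit Types (a b c d s t e : R) (F : C -> C) (S : set C).

Definition hol_on F S : Prop := forall z, S z -> exists l, cderiv F z l.

Lemma hol_onS F S S' : S' `<=` S -> hol_on F S -> hol_on F S'.
Proof. by move=> SS h z /SS /h. Qed.

Definition rectangle a b c d : set C :=
  [set z | a <= complex.Re z <= b /\ c <= complex.Im z <= d].

(** The integral of [F] along the boundary of a rectangle, opposite sides being
    grouped under one integral. *)
Definition rect_integral F a b c d : C :=
  seg_integral a b (fun s => F (s +i* c)%C - F (s +i* d)%C) +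
  ('i)%C * seg_integral c d (fun t => F (b +i* t)%C - F (a +i* t)%C).

Lemma hol_seg_h F S a b c : hol_on F S ->
  (forall s, a <= s <= b -> S (s +i* c)%C) ->
  seg_continuous a b (fun s => F (s +i* c)%C).
Proof.
move=> hF hS s sab e e0; have [l /cderiv_cont /(_ e e0) [d d0 hd]] := hF _ (hS _ sab).
exists d => // u us; apply: hd.
by apply: le_lt_trans us; apply: le_trans (cabs_le_ReIm _) _; rewrite /= subrr normr0 addr0.
Qed.

Lemma hol_seg_v F S a c d : hol_on F S ->
  (forall t, c <= t <= d -> S (a +i* t)%C) ->
  seg_continuous c d (fun t => F (a +i* t)%C).
Proof.
move=> hF hS s sab e e0; have [l /cderiv_cont /(_ e e0) [d' d0 hd]] := hF _ (hS _ sab).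
exists d' => // u us; apply: hd.
by apply: le_lt_trans us; apply: le_trans (cabs_le_ReIm _) _; rewrite /= subrr normr0 add0r.
Qed.

Lemma rect_integral_splith F a m b c d : a <= m <= b -> c <= d ->
  hol_on F (rectangle a b c d) ->
  rect_integral F a b c d = rect_integral F a m c d + rect_integral F m b c d.
Proof.
move=> /andP[am mb] cd hF; rewrite /rect_integral.
have hv x : a <= x <= b -> seg_continuous c d (fun t => F (x +i* t)%C).
  by move=> xab; apply: (hol_seg_v hF) => t tcd; split.
have hh y : c <= y <= d -> seg_continuous a b (fun t => F (t +i* y)%C).
  by move=> ycd; apply: (hol_seg_h hF) => t tcd; split.
have ha : a <= a <= b by rewrite lexx (le_trans am mb).
have hb : a <= b <= b by rewrite lexx (le_trans am mb).
have hm : a <= m <= b by rewrite am mb.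
rewrite (@seg_integral_split _ a m b)//; last first.
  by apply: seg_continuousB; apply: hh; rewrite lexx cd.
rewrite !(@seg_integralB _ c d); try exact: hv.
by ring.
Qed.

Lemma rect_integral_splitv F a b c m d : a <= b -> c <= m <= d ->
  hol_on F (rectangle a b c d) ->
  rect_integral F a b c d = rect_integral F a b c m + rect_integral F a b m d.
Proof.
move=> ab /andP[cm md] hF; rewrite /rect_integral.
have hv x : a <= x <= b -> seg_continuous c d (fun t => F (x +i* t)%C).
  by move=> xab; apply: (hol_seg_v hF) => t tcd; split.
have hh y : c <= y <= d -> seg_continuous a b (fun t => F (t +i* y)%C).
  by move=> ycd; apply: (hol_seg_h hF) => t tcd; split.
have ha : c <= c <= d by rewrite lexx (le_trans cm md).
have hb : c <= d <= d by rewrite lexx (le_trans cm md).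
have hm : c <= m <= d by rewrite cm md.
rewrite (@seg_integral_split _ c m d)//; last first.
  by apply: seg_continuousB; apply: hv; rewrite lexx ab.
rewrite !(@seg_integralB _ a b); try exact: hh.
by ring.
Qed.

Lemma rectangleS a b c d a' b' c' d' : a <= a' -> b' <= b -> c <= c' -> d' <= d ->
  rectangle a' b' c' d' `<=` rectangle a b c d.
Proof.
move=> aa bb cc dd z [/andP[h1 h2] /andP[h3 h4]].
split; apply/andP; split; [exact: le_trans h1|exact: le_trans bb|
  exact: le_trans h3|exact: le_trans dd].
Qed.

Lemma halves a A : 0 <= A -> a + A / 2 + A / 2 = a + A /\
  (a <= a + A / 2 <= a + A) /\ (a <= a <= a + A / 2) /\
  (a <= a + A / 2 <= a + A / 2).
Proof. by move=> A0; split; [field|split; [|split]; apply/andP; split; lra]. Qed.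

Lemma pigeonhole4 (z1 z2 z3 z4 : C) e :
  e <= cabs (z1 + z2 + (z3 + z4)) ->
  e / 4 <= cabs z1 \/ e / 4 <= cabs z2 \/ e / 4 <= cabs z3 \/ e / 4 <= cabs z4.
Proof.
move=> he; have {he} : e <= cabs z1 + cabs z2 + (cabs z3 + cabs z4).
  apply: le_trans he _; apply: le_trans (cabsD _ _) _.
  by apply: lerD; exact: cabsD.
move: (cabs z1) (cabs z2) (cabs z3) (cabs z4) => x y u v he.
have [h1|h1] := leP (e / 4) x; first by left.
have [h2|h2] := leP (e / 4) y; first by right; left.
have [h3|h3] := leP (e / 4) u; first by right; right; left.
by right; right; right; lra.
Qed.

(** The bisection step: the integral is the sum of those over the four quarters,
    since the inner sides cancel. *)
Lemma rect_integral_quarter F a c A B e : 0 <= A -> 0 <= B ->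
  hol_on F (rectangle a (a + A) c (c + B)) ->
  e <= cabs (rect_integral F a (a + A) c (c + B)) ->
  exists2 p : R * R, (a <= p.1 <= a + A / 2) /\ (c <= p.2 <= c + B / 2) &
    e / 4 <= cabs (rect_integral F p.1 (p.1 + A / 2) p.2 (p.2 + B / 2)).
Proof.
move=> A0 B0 hF he.
have [A2 [a1 [a2 a3]]] := halves a A0; have [B2 [b1 [b2 b3]]] := halves c B0.
have c1 : c <= c + B by rewrite lerDl.
have /andP[d1 d2] := a1; have /andP[d3 d4] := b1.
move: he; rewrite (rect_integral_splith a1 c1 hF).
rewrite (@rect_integral_splitv _ a (a + A / 2) c (c + B / 2))//; last first.
  by apply: hol_onS hF; apply: rectangleS.
rewrite (@rect_integral_splitv _ (a + A / 2) (a + A) c (c + B / 2))//; last first.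
  by apply: hol_onS hF; apply: rectangleS.
move/pigeonhole4 => [h|[h|[h|h]]].
- by exists (a, c).
- by exists (a, c + B / 2); rewrite /= ?B2.
- by exists (a + A / 2, c); rewrite /= ?A2.
- by exists (a + A / 2, c + B / 2); rewrite /= ?A2 ?B2.
Qed.

Lemma rect_integral_local F a b c d (z l : C) e : a <= b -> c <= d ->
  hol_on F (rectangle a b c d) ->
  (forall w, rectangle a b c d w -> cabs (F w - F z - l * (w - z)) <= e) ->
  cabs (rect_integral F a b c d) <= 2 * e * (b - a + (d - c)).
Proof.
move=> ab cd hF he; rewrite /rect_integral.
have h1 : cabs (seg_integral a b (fun s => F (s +i* c)%C - F (s +i* d)%C) -
    (b - a)%:C%C * (l * (0 +i* (c - d))%C)) <= 2 * e * (b - a).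
  apply: seg_integral_near_cst => //.
    by apply: seg_continuousB; apply: (hol_seg_h hF) => s sab; split;
      rewrite /= ?lexx ?cd.
  move=> t tab.
  have k1 := he (t +i* c)%C; have k2 := he (t +i* d)%C.
  have {}k1 : cabs (F (t +i* c)%C - F z - l * ((t +i* c)%C - z)) <= e.
    by apply: k1; split; rewrite //= lexx cd.
  have {}k2 : cabs (F (t +i* d)%C - F z - l * ((t +i* d)%C - z)) <= e.
    by apply: k2; split; rewrite //= lexx cd.
  have -> : (0 +i* (c - d))%C = (t +i* c)%C - (t +i* d)%C :> C.
    by apply: complex_ext; rewrite /= ?subrr.
  set u := (t +i* c)%C in k1 *; set v := (t +i* d)%C in k2 *.
  have -> : F u - F v - l * (u - v) = (F u - F z - l * (u - z)) - (F v - F z - l * (v - z)).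
    by ring.
  by apply: le_trans (cabsD _ _) _; rewrite cabsN mulr_natl mulr2n lerD.
have h2 : cabs (seg_integral c d (fun t => F (b +i* t)%C - F (a +i* t)%C) -
    (d - c)%:C%C * (l * (b - a)%:C%C)) <= 2 * e * (d - c).
  apply: seg_integral_near_cst => //.
    by apply: seg_continuousB; apply: (hol_seg_v hF) => s sab; split;
      rewrite /= ?lexx ?ab.
  move=> t tcd.
  have k1 := he (b +i* t)%C; have k2 := he (a +i* t)%C.
  have {}k1 : cabs (F (b +i* t)%C - F z - l * ((b +i* t)%C - z)) <= e.
    by apply: k1; split; rewrite //= lexx ab.
  have {}k2 : cabs (F (a +i* t)%C - F z - l * ((a +i* t)%C - z)) <= e.
    by apply: k2; split; rewrite //= lexx ab.
  have -> : (b - a)%:C%C = (b +i* t)%C - (a +i* t)%C :> C.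
    by apply: complex_ext; rewrite /= ?subrr.
  set u := (b +i* t)%C in k1 *; set v := (a +i* t)%C in k2 *.
  have -> : F u - F v - l * (u - v) = (F u - F z - l * (u - z)) - (F v - F z - l * (v - z)).
    by ring.
  by apply: le_trans (cabsD _ _) _; rewrite cabsN mulr_natl mulr2n lerD.
set I1 := seg_integral _ _ _ in h1 *; set I2 := seg_integral _ _ _ in h2 *.
(* the affine part of [F] contributes nothing *)
have -> : I1 + ('i)%C * I2 = (I1 - (b - a)%:C%C * (l * (0 +i* (c - d))%C)) +
    ('i)%C * (I2 - (d - c)%:C%C * (l * (b - a)%:C%C)).
  have -> : (0 +i* (c - d))%C = - (('i)%C * (d - c)%:C%C) :> C.
    by apply: complex_ext; rewrite ?ReN ?ImN ?ReM ?ImM /=; ring.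
  by ring.
apply: le_trans (cabsD _ _) _; rewrite cabsM cabs_i mul1r.
by rewrite mulrDr lerD.
Qed.

(** Bisection produces nested rectangles carrying a share of the integral
    proportional to the square of their size; near their common point [F] is affine
    up to an error that is small compared to the size, a contradiction. *)
Theorem goursat F a b c d : a < b -> c < d ->
  hol_on F (rectangle a b c d) -> rect_integral F a b c d = 0.
Proof.
move=> ab cd hF; apply/eqP; rewrite -cabs_eq0; apply/negPn/negP => J0.
set A := b - a; set B := d - c.
have A0 : 0 < A by rewrite subr_gt0.
have B0 : 0 < B by rewrite subr_gt0.
set e := cabs (rect_integral F a b c d) in J0.
have e0 : 0 < e by rewrite lt_neqAle cabs_ge0 andbT eq_sym.
pose h n : R := (2 ^+ n)^-1.
have h_gt0 n : 0 < h n by rewrite invr_gt0 exprn_gt0.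
have hS n : h n.+1 = h n / 2 by rewrite /h exprS invfM mulrC.
pose bad n (p : R * R) :=
  (a <= p.1 /\ p.1 + A * h n <= b) /\ (c <= p.2 /\ p.2 + B * h n <= d) /\
  e * h n ^+ 2 <= cabs (rect_integral F p.1 (p.1 + A * h n) p.2 (p.2 + B * h n)).
have step (np : nat * (R * R)) : exists q : R * R, bad np.1 np.2 ->
    bad np.1.+1 q /\ np.2.1 <= q.1 /\ np.2.2 <= q.2 /\
    q.1 + A * h np.1.+1 <= np.2.1 + A * h np.1 /\
    q.2 + B * h np.1.+1 <= np.2.2 + B * h np.1.
  case: np => n p /=; have [pb|pb] := pselect (bad n p); last by exists p.
  have [[p1 p2] [[p3 p4] p5]] := pb.
  have [||||q [/andP[q1 q2] /andP[q3 q4]] q5] :=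
      @rect_integral_quarter F p.1 p.2 (A * h n) (B * h n) (e * h n ^+ 2).
  - by rewrite mulr_ge0// ltW.
  - by rewrite mulr_ge0// ltW.
  - by apply: hol_onS hF; apply: rectangleS.
  - exact: p5.
  have EA : A * h n / 2 = A * h n.+1 by rewrite hS mulrA.
  have EB : B * h n / 2 = B * h n.+1 by rewrite hS mulrA.
  have Ee : e * h n ^+ 2 / 4 = e * h n.+1 ^+ 2 by rewrite hS; field.
  rewrite EA EB Ee in q2 q4 q5.
  have EA2 : A * h n = A * h n.+1 + A * h n.+1 by rewrite -EA; field.
  have EB2 : B * h n = B * h n.+1 + B * h n.+1 by rewrite -EB; field.
  exists q => _; rewrite EA2 EB2; split; last by clear - q1 q2 q3 q4; do !split => //; lra.
  rewrite EA2 EB2 in p2 p4.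
  by split; [split|split; [split|exact: q5]]; clear - p1 p2 p3 p4 q1 q2 q3 q4; lra.
have [g hg] := choice step.
pose p := fix p n := if n is m.+1 then g (m, p m) else (a, c).
have pbad n : bad n (p n).
  elim: n => [|n IH]; last by have [] := hg (n, p n) IH.
  rewrite /bad /= /h expr0 invr1 !mulr1 /A /B expr1n mulr1.
  by rewrite (addrC a) (addrC c) !subrK !lexx.
have pS n : (p n).1 <= (p n.+1).1 /\ (p n).2 <= (p n.+1).2 /\
    (p n.+1).1 + A * h n.+1 <= (p n).1 + A * h n /\
    (p n.+1).2 + B * h n.+1 <= (p n).2 + B * h n.
  by have [_ [? [? [? ?]]]] := hg (n, p n) (pbad n).
have pmono n k : (p n).1 <= (p (n + k)%N).1 /\ (p n).2 <= (p (n + k)%N).2 /\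
    (p (n + k)%N).1 + A * h (n + k)%N <= (p n).1 + A * h n /\
    (p (n + k)%N).2 + B * h (n + k)%N <= (p n).2 + B * h n.
  elim: k => [|k [i1 [i2 [i3 i4]]]]; first by rewrite addn0 !lexx.
  rewrite addnS; have [j1 [j2 [j3 j4]]] := pS (n + k)%N.
  by do !split; [exact: le_trans i1 j1|exact: le_trans i2 j2|
    exact: le_trans j3 i3|exact: le_trans j4 i4].
have pub n m : (p m).1 <= (p n).1 + A * h n /\ (p m).2 <= (p n).2 + B * h n.
  have Ap k : 0 <= A * h k by rewrite mulr_ge0// ltW.
  have Bp k : 0 <= B * h k by rewrite mulr_ge0// ltW.
  have [nm|mn] := leqP n m.
    have [_ [_ [i3 i4]]] := pmono n (m - n)%N; rewrite subnKC// in i3 i4.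
    by have := Ap m; have := Bp m; clear - i3 i4; split; lra.
  have [i1 [i2 _]] := pmono m (n - m)%N; rewrite subnKC 1?ltnW// in i1 i2.
  by have := Ap n; have := Bp n; clear - i1 i2; split; lra.
pose X := range (fun n => (p n).1); pose Y := range (fun n => (p n).2).
have X0 : X !=set0 by exists (p 0%N).1; exists 0%N.
have Y0 : Y !=set0 by exists (p 0%N).2; exists 0%N.
have Xub n : ubound X ((p n).1 + A * h n) by move=> _ [m _ <-]; have [] := pub n m.
have Yub n : ubound Y ((p n).2 + B * h n) by move=> _ [m _ <-]; have [] := pub n m.
have xle n : (p n).1 <= sup X <= (p n).1 + A * h n.
  apply/andP; split; last exact: ge_sup.
  by apply: ub_le_sup; [exists ((p n).1 + A * h n)|exists n].
have yle n : (p n).2 <= sup Y <= (p n).2 + B * h n.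
  apply/andP; split; last exact: ge_sup.
  by apply: ub_le_sup; [exists ((p n).2 + B * h n)|exists n].
pose z : C := (sup X +i* sup Y)%C.
have zin : rectangle a b c d z.
  have [[p1 p2] [[p3 p4] _]] := pbad 0%N.
  have /andP[x1 x2] := xle 0%N; have /andP[y1 y2] := yle 0%N.
  by clear - p1 p2 p3 p4 x1 x2 y1 y2; split; apply/andP; split => /=; lra.
have [l [q [ql _ hq]]] := hF _ zin.
have AB0 : 0 < A + B by rewrite addr_gt0.
pose e1 := e / (4 * (A + B) ^+ 2).
have e10 : 0 < e1 by rewrite divr_gt0// mulr_gt0// exprn_gt0.
have [dl dl0 hdl] := ql _ e10.
have [n hn] : exists n, (A + B) * h n < dl.
  have /cvgrPdist_lt /(_ (dl / (A + B))) : (fun n => (1 / 2) ^+ n : R) @ \oo --> (0 : R).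
    by apply: cvg_expr; rewrite ger0_norm; clear; lra.
  rewrite divr_gt0// => /(_ isT) [n _ /(_ n)] /=; rewrite leqnn => /(_ isT) hn.
  exists n; move: hn; rewrite sub0r normrN ger0_norm; last by rewrite exprn_ge0// divr_ge0.
  by rewrite ltr_pdivlMr// mulrC /h div1r exprVn.
have [[p1 p2] [[p3 p4] p5]] := pbad n.
have /andP[x1 x2] := xle n; have /andP[y1 y2] := yle n.
set P := p n in p1 p2 p3 p4 p5 x1 x2 y1 y2 *; set H := h n in p2 p4 p5 x2 y2 hn *.
have H0 : 0 < H by exact: h_gt0.
have loc w : rectangle P.1 (P.1 + A * H) P.2 (P.2 + B * H) w ->
    cabs (F w - F z - l * (w - z)) <= e1 * ((A + B) * H).
  move=> [/andP[w1 w2] /andP[w3 w4]].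
  have wz : cabs (w - z) <= (A + B) * H.
    apply: le_trans (cabs_le_ReIm _) _; rewrite ReD ImD ReN ImN /= mulrDl.
    by apply: lerD; rewrite ler_norml; clear - w1 w2 w3 w4 x1 x2 y1 y2; apply/andP; split; lra.
  rewrite hq -mulrBl cabsM; apply: ler_pM; rewrite ?cabs_ge0//.
  by apply/ltW/hdl; exact: le_lt_trans hn.
have AH : 0 < A * H by rewrite mulr_gt0.
have BH : 0 < B * H by rewrite mulr_gt0.
have := @rect_integral_local F P.1 (P.1 + A * H) P.2 (P.2 + B * H) z l _ _ _ _ loc.
have ha : P.1 <= P.1 + A * H by rewrite lerDl ltW.
have hb : P.2 <= P.2 + B * H by rewrite lerDl ltW.
move=> /(_ ha hb); have hol' : hol_on F (rectangle P.1 (P.1 + A * H) P.2 (P.2 + B * H)).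
  by apply: hol_onS hF; apply: rectangleS.
move=> /(_ hol') h3.
have h4 := le_trans p5 h3; move: h4; apply/negP; rewrite -ltNge.
have -> : 2 * (e1 * ((A + B) * H)) * (P.1 + A * H - P.1 + (P.2 + B * H - P.2)) =
   2 * (e1 * (A + B) ^+ 2) * H ^+ 2 by ring.
have -> : e1 * (A + B) ^+ 2 = e / 4.
  by rewrite /e1; field; rewrite gt_eqF.
by rewrite ltr_pM2r ?exprn_gt0//; clear - e0; lra.
Qed.

End Goursat.

(** * Means over circles *)

Section CircleMeans.
Variable R : realType.
Local Notation C := R[i].
Local Notation mu := (@lebesgue_measure R).
Implicit Types (rho r e M u v : R) (f g p : C -> C) (z l w : C).

Lemma cabs_le_eps z (c : R) : 0 <= c ->
  (forall e, 0 < e -> cabs z <= c * e) -> z = 0.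
Proof.
move=> c0 h; apply: cabs0P; apply/le_anti; rewrite cabs_ge0 andbT.
have [->//|z0] := eqVneq (cabs z) 0.
have zp : 0 < cabs z by rewrite lt_neqAle cabs_ge0 eq_sym z0.
have c1 : 0 < c + 1 by lra.
have := h (cabs z / (c + 1) / 2); rewrite !divr_gt0// => /(_ isT) h1.
suff : c * (cabs z / (c + 1) / 2) <= cabs z / 2 by lra.
rewrite mulrA ler_pM2r// mulrA ler_pdivrMr// mulrC.
by rewrite ler_pM2l//; lra.
Qed.

Definition mean g rho : C := seg_integral 0 (2 * pi) (fun t => g (rho%:C%C * cis t)).

Lemma twopi_gt0 : 0 < 2 * pi :> R.
Proof. by rewrite mulr_gt0// pi_gt0. Qed.

Lemma cabs_circle rho t : 0 <= rho -> cabs (rho%:C%C * cis t) = rho.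
Proof. by move=> r0; rewrite cabsM cabs_cis mulr1 cabs_pos. Qed.

Lemma seg_continuous_circle g rho a b : 0 <= rho ->
  (forall w, cabs w = rho -> tends (cnbhs w) g (g w)) ->
  seg_continuous a b (fun t => g (rho%:C%C * cis t)).
Proof.
move=> r0 gc t _ e e0.
have [d d0 hd] := gc _ (cabs_circle t r0) _ e0.
have [d' d'0 hd'] := @cis_cont0 R (d / (rho + 1)) (divr_gt0 d0 (ltr_wpDl r0 ltr01)).
exists d' => // s st; apply: hd.
rewrite -mulrBr cabsM cabs_pos//; have := hd' _ _ st.
rewrite ltr_pdivlMr ?ltr_wpDl// => h.
by have := cabs_ge0 (cis s - cis t); nra.
Qed.

Lemma seg_integral_cst (a b : R) l : a <= b ->
  seg_integral a b (fun=> l) = (b - a)%:C%C * l.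
Proof.
move=> ab; rewrite /seg_integral cintegral_cst//; congr (_%:C%C * _).
by rewrite [X in fine X](_ : _ = (b - a)%:E)//; exact: seg_measure.
Qed.

Lemma seg_integralZ (a b : R) l (h : R -> C) : seg_continuous a b h ->
  seg_integral a b (fun t => l * h t) = l * seg_integral a b h.
Proof. by move=> hc; rewrite /seg_integral cintegralZ//; exact: seg_cintegrable. Qed.

Lemma seg_integralD (a b : R) (h k : R -> C) :
  seg_continuous a b h -> seg_continuous a b k ->
  seg_integral a b (fun t => h t + k t) = seg_integral a b h + seg_integral a b k.
Proof.
by move=> hc kc; rewrite /seg_integral cintegralD//; exact: seg_cintegrable.
Qed.

Lemma seg_integral_conj (a b : R) (h : R -> C) : seg_continuous a b h ->
  seg_integral a b (fun t => ((h t)^*)%C) = ((seg_integral a b h)^*)%C.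
Proof.
move=> /seg_cintegrable [h1 h2]; apply: complex_ext; rewrite ?Re_conj ?Im_conj /=.
  by apply: eq_Rintegral => t _; rewrite Re_conj.
rewrite -mulN1r -RintegralZl//.
by apply: eq_Rintegral => t _; rewrite Im_conj mulN1r.
Qed.

(** The mean over a circle does not depend on the radius: in logarithmic polar
    coordinates an annulus becomes a rectangle whose horizontal sides cancel by
    periodicity. *)
Lemma mean_annulus g (r1 r2 : R) : 0 < r1 -> r1 < r2 ->
  hol_on g [set z | r1 <= cabs z <= r2] -> mean g r1 = mean g r2.
Proof.
move=> r10 r12 hg; have r20 := lt_trans r10 r12.
pose F w := g (cexp w).
have hF : hol_on F (rectangle (ln r1) (ln r2) 0 (2 * pi)).
  move=> z [/andP[z1 z2] _]; have [|l hl] := hg (cexp z).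
    rewrite /= cabs_cexp; apply/andP; split.
      by rewrite -[r1]lnK ?posrE// ler_expR.
    by rewrite -[X in _ <= X]lnK ?posrE// ler_expR.
  by exists (l * cexp z); apply: cderiv_comp => //; exact: cderiv_cexp.
have lnlt : ln r1 < ln r2 by rewrite ltr_ln ?posrE.
have := goursat lnlt twopi_gt0 hF; rewrite /rect_integral.
have -> : seg_integral (ln r1) (ln r2) (fun s => F (s +i* 0)%C - F (s +i* (2 * pi))%C) = 0.
  rewrite (@eq_seg_integral _ _ _ _ (fun=> 0)) ?seg_integral_cst ?mulr0 1?ltW// => s _.
  by rewrite /F !cexpE [complex.Im _]/= [X in cis X]/= cis0 [complex.Im _]/= cis2pi subrr.
rewrite add0r => /eqP; rewrite mulf_eq0 => /orP[/eqP h|].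
  by have := cabs_i R; rewrite h cabs0 => /esym/eqP; rewrite oner_eq0.
have cE (r : R) t : 0 < r -> F (ln r +i* t)%C = g (r%:C%C * cis t).
  by move=> r0; rewrite /F cexpE /= lnK.
rewrite seg_integralB.
- rewrite subr_eq0 => /eqP h; rewrite /mean.
  rewrite (@eq_seg_integral _ _ _ _ (fun t => F (ln r1 +i* t)%C)); last by move=> t _; rewrite cE.
  rewrite -h; apply: eq_seg_integral => t _; rewrite cE//.
- by apply: (hol_seg_v hF) => t tp; split; rewrite //= lexx andbT ltW.
- by apply: (hol_seg_v hF) => t tp; split; rewrite //= lexx /= ltW.
Qed.

(** Mean value property; the centre itself may be a point where only continuity
    is known. *)
Lemma mean_center g r rho : tends (cnbhs 0) g (g 0) ->
  hol_on g [set z | 0 < cabs z < r] -> 0 < rho < r ->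
  mean g rho = (2 * pi)%:C%C * g 0.
Proof.
move=> g0 hg /andP[rho0 rhor]; apply/eqP; rewrite -subr_eq0; apply/eqP.
apply: (@cabs_le_eps _ (2 * pi)); first exact/ltW/twopi_gt0.
move=> e e0; have [d d0 hd] := g0 _ e0.
pose r1 := Num.min (rho / 2) (d / 2).
have r10 : 0 < r1 by rewrite lt_min !divr_gt0.
have r1rho : r1 < rho by rewrite gt_min; apply/orP; left; lra.
have r1d : r1 < d by rewrite gt_min; apply/orP; right; lra.
have -> : mean g rho = mean g r1.
  apply/esym/mean_annulus => //; apply: hol_onS hg => z /andP[z1 z2].
  by apply/andP; split; [exact: lt_le_trans z1|exact: le_lt_trans rhor].
have := @seg_integral_near_cst R 0 (2 * pi) (fun t => g (r1%:C%C * cis t)) (g 0) e.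
rewrite subr0 (mulrC (2 * pi) e); apply; first exact/ltW/twopi_gt0.
- apply: seg_continuous_circle; first exact: ltW.
  move=> w w1; have [|l hl] := hg w; last exact: cderiv_cont hl.
  by rewrite /= w1 r10 (lt_trans r1rho).
- by move=> t _; apply/ltW/hd; rewrite subr0 cabs_circle// ltW.
Qed.

Lemma mean_continuous g M u v rho0 : 0 <= u -> u < rho0 < v ->
  (forall z, u < cabs z < v -> tends (cnbhs z) g (g z) /\ cabs (g z) <= M) ->
  forall e, 0 < e -> exists2 d : R, 0 < d &
    forall rho, `|rho - rho0| < d -> cabs (mean g rho - mean g rho0) < e.
Proof.
move=> u0 uv hg e e0.
have mD : measurable `[0, 2 * pi : R]%classic by exact: measurable_itv.
have inuv (x : R) : `]u, v[%classic x -> u < x < v by rewrite /= in_itv.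
have cint x : `]u, v[%classic x -> cintegrable mu `[0, 2 * pi] (fun t => g (x%:C%C * cis t)).
  move=> /inuv /andP[x1 x2]; apply: seg_cintegrable; apply: seg_continuous_circle.
    by rewrite ltW// (le_lt_trans u0).
  by move=> w wx; apply: (hg w _).1; rewrite wx x1.
have cRe (k : C -> R) : (forall z w, `|k z - k w| <= cabs (z - w)) ->
    forall t : R, {in `]u, v[%classic, continuous (fun x : R => k (g (x%:C%C * cis t)))}.
  move=> kl t x /set_mem /inuv /andP[x1 x2].
  have x0 : 0 <= x by rewrite ltW// (le_lt_trans u0).
  have [|h _] := hg (x%:C%C * cis t); first by rewrite cabs_circle// x1.
  apply/cvgrPdist_lt => e' e'0; have [d d0 hd] := h _ e'0.
  apply/nbhs_ballP; exists d => // y; rewrite /ball /= => xy.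
  apply: le_lt_trans (kl _ _) _; rewrite cabsC; apply: hd.
  by rewrite -mulrBl cabsM cabs_cis mulr1 -rmorphB /= cabs_real distrC.
have kRe (z w : C) : `|complex.Re z - complex.Re w| <= cabs (z - w).
  by rewrite -ReN -ReD Re_le_cabs.
have kIm (z w : C) : `|complex.Im z - complex.Im w| <= cabs (z - w).
  by rewrite -ImN -ImD Im_le_cabs.
have iM : mu.-integrable `[0, 2 * pi] (EFin \o (fun=> M)).
  have [] : cintegrable mu `[0, 2 * pi] (fun=> M%:C%C) => //.
  by apply: cintegrable_cst => //; exact: seg_measure_fin.
have rho0I : rho0 \in `]u, v[%classic by rewrite inE /= in_itv.
have bnd x t : `]u, v[%classic x -> cabs (g (x%:C%C * cis t)) <= M.
  move=> /inuv /andP[x1 x2]; have x0 : 0 <= x by rewrite ltW// (le_lt_trans u0).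
  by apply: (hg _ _).2; rewrite cabs_circle// x1.
have e20 : 0 < e / 2 by rewrite divr_gt0.
have under (k : C -> R) : (forall z w, `|k z - k w| <= cabs (z - w)) ->
    (forall z, `|k z| <= cabs z) ->
    (forall x, `]u, v[%classic x ->
      mu.-integrable `[0, 2 * pi] (EFin \o (fun t : R => k (g (x%:C%C * cis t))))) ->
    {for rho0, continuous (fun x : R => Rintegral mu `[0, 2 * pi] (fun t => k (g (x%:C%C * cis t))))}.
  move=> kl kb ki.
  apply: (@continuity_under_integral R _ _ mu (fun x t => k (g (x%:C%C * cis t)))
    _ mD u v ki _ (fun=> M) iM _ rho0 rho0I).
    by apply: aeW => t _; exact: cRe.
  move=> x hx; apply: aeW => t _; exact: le_trans (kb _) (bnd x t hx).
have h1 := under _ kRe (@Re_le_cabs R) (fun x hx => (cint x hx).1).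
have h2 := under _ kIm (@Im_le_cabs R) (fun x hx => (cint x hx).2).
have /cvgrPdist_lt /(_ _ e20) /nbhs_ballP[d1 /= d10 hd1] := h1.
have /cvgrPdist_lt /(_ _ e20) /nbhs_ballP[d2 /= d20 hd2] := h2.
exists (Num.min d1 d2); first by rewrite lt_min d10.
move=> rho; rewrite lt_min => /andP[k1 k2].
rewrite distrC in k1; rewrite distrC in k2.
apply: le_lt_trans (cabs_le_ReIm _) _; rewrite ReD ImD ReN ImN [ltRHS]splitr.
by apply: ltrD; rewrite distrC; [exact: hd1 k1|exact: hd2 k2].
Qed.

(** Nothing but continuity is known on the circle of radius [rho0]: on either side
    of it the mean is constant, and it depends continuously on the radius. *)
Lemma mean_center_circle g M rho0 rho : 0 < rho0 < 1 ->
  (forall z, disc z -> tends (cnbhs z) g (g z) /\ cabs (g z) <= M) ->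
  hol_on g [set z | disc z /\ z != 0 /\ cabs z != rho0] ->
  0 < rho < 1 -> mean g rho = (2 * pi)%:C%C * g 0.
Proof.
move=> /andP[rho00 rho01] gM hg /andP[r0 r1].
have inner x : 0 < x < rho0 -> mean g x = (2 * pi)%:C%C * g 0.
  apply: mean_center; first by have [] := gM _ (disc0 R).
  apply: hol_onS hg => z /andP[z0 zr]; split; [|split].
  - by apply/discE; exact: lt_trans rho01.
  - by rewrite -cabs_gt0.
  - by rewrite lt_eqF.
have mc := @mean_continuous g M 0 1 rho0 (lexx _).
have {}mc : forall e, 0 < e -> exists2 d : R, 0 < d &
    forall rho, `|rho - rho0| < d -> cabs (mean g rho - mean g rho0) < e.
  apply: mc; first by rewrite rho00.
  by move=> z /andP[_ z1]; apply: gM; apply/discE.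
have at0 : mean g rho0 = (2 * pi)%:C%C * g 0.
  apply/eqP; rewrite -subr_eq0; apply/eqP/(@cabs_le_eps _ 1) => // e e0.
  rewrite mul1r; have [d d0 hd] := mc _ e0.
  pose x := Num.max (rho0 / 2) (rho0 - d / 2).
  have x1 : x < rho0 by rewrite gt_max; apply/andP; split; lra.
  have x0 : 0 < x by rewrite lt_max divr_gt0.
  have x2 : rho0 - d / 2 <= x by rewrite le_max lexx orbT.
  have := hd x; rewrite inner ?x0// => h; rewrite cabsC ltW// h//.
  by rewrite ler0_norm; lra.
have [rr|rr|->//] := ltgtP rho rho0; first by rewrite inner// r0.
have outer x y : rho0 < x -> x < y -> y < 1 -> mean g x = mean g y.
  move=> hx xy y1; apply: mean_annulus => //; first exact: lt_trans hx.
  apply: hol_onS hg => z /andP[z0 zr]; have z1 : rho0 < cabs z := lt_le_trans hx z0.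
  split; [|split].
  - by apply/discE; exact: le_lt_trans y1.
  - by rewrite -cabs_gt0 (lt_trans _ z1).
  - by rewrite gt_eqF.
rewrite -at0; apply/eqP; rewrite -subr_eq0; apply/eqP/(@cabs_le_eps _ 1) => // e e0.
rewrite mul1r; have [d d0 hd] := mc _ e0.
pose x := Num.min ((rho0 + rho) / 2) (rho0 + d / 2).
have x1 : rho0 < x by rewrite lt_min; apply/andP; split; lra.
have x0 : x < rho by rewrite gt_min; apply/orP; left; lra.
have x2 : x <= rho0 + d / 2 by rewrite ge_min lexx orbT.
rewrite -(outer x)//; apply/ltW/hd; rewrite ger0_norm; lra.
Qed.

End CircleMeans.

(** * Schwarz's integral formula *)

Section SchwarzFormula.
Variable R : realType.
Local Notation C := R[i].
Implicit Types (rho r e M t x : R) (p q : C -> C) (z w l zeta : C).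

(** The Herglotz kernel, with its boundary point as a complex number; its real part
    is the Poisson kernel. *)
Definition hkernel z zeta : C := (zeta + z) / (zeta - z).

Lemma Re_hkernel z zeta : complex.Re (hkernel z zeta) =
  (cabs zeta ^+ 2 - cabs z ^+ 2) / cabs (zeta - z) ^+ 2.
Proof.
rewrite /hkernel !cabs_sqr; case: zeta z => a b [c d] /=.
by rewrite mulrN opprK !mulrA -mulrDl; congr (_ / _); ring.
Qed.

Lemma hkernel0 zeta : zeta != 0 -> hkernel 0 zeta = 1.
Proof. by move=> z0; rewrite /hkernel addr0 subr0 divff. Qed.

Lemma hkernel_sub z w zeta : zeta != z -> zeta != w ->
  hkernel z zeta - hkernel w zeta =
  2 * zeta * (z - w) / ((zeta - z) * (zeta - w)).
Proof.
move=> h1 h2; rewrite /hkernel; field.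
by rewrite !subr_eq0 h1 h2.
Qed.

Lemma cabs_lt_neq z w : cabs z < cabs w -> w != z.
Proof. by move=> h; apply: contraTneq h => ->; rewrite ltxx. Qed.

Lemma Re_hkernel_ge0 z zeta : cabs z <= cabs zeta -> 0 <= complex.Re (hkernel z zeta).
Proof.
move=> h; rewrite Re_hkernel divr_ge0 ?sqr_ge0// subr_ge0.
by rewrite ler_pXn2r// nnegrE cabs_ge0.
Qed.

Lemma tends_hkernel z zeta : zeta != z ->
  tends (cnbhs zeta) (hkernel z) (hkernel z zeta).
Proof.
move=> h; apply: tendsM; first by apply: tendsD; [exact: tends_id|exact: tends_cst].
apply: tendsV; first by rewrite subr_eq0.
by apply: tendsB; [exact: tends_id|exact: tends_cst].
Qed.

Lemma tends_conj (T : Type) (F : set_system T) {FF : Filter F} (f : T -> C) l :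
  tends F f l -> tends F (fun u => ((f u)^*)%C) ((l^*)%C).
Proof.
move=> fl e e0; apply: filterS (fl _ e0) => x /=.
by rewrite -raddfB /= cabs_conj.
Qed.

(** On the circle of radius [rho] the conjugate of the kernel is the restriction
    of a function holomorphic inside the circle. *)
Lemma conj_hkernel z zeta rho : cabs zeta = rho -> cabs z < rho ->
  ((hkernel z zeta)^*)%C =
  ((rho ^+ 2)%:C%C + (z^*)%C * zeta) / ((rho ^+ 2)%:C%C - (z^*)%C * zeta).
Proof.
move=> zr zlt; have z0 : zeta != 0.
  by rewrite -cabs_gt0 zr (le_lt_trans (cabs_ge0 z)).
have zc0 : (zeta^*)%C != 0 by rewrite conjc_eq0.
have d0 : (zeta^*)%C - (z^*)%C != 0.
  by rewrite -raddfB conjc_eq0 subr_eq0 cabs_lt_neq// zr.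
have -> : (rho ^+ 2)%:C%C = zeta * (zeta^*)%C by rewrite mulcJ zr.
have h0 : zeta * (zeta^*)%C - (z^*)%C * zeta != 0.
  by rewrite (mulrC _ zeta) -mulrBr mulf_neq0.
rewrite /hkernel rmorphM /= conjc_inv raddfD raddfB /=; field.
by rewrite h0 d0.
Qed.

Section Formula.
Variables (p : C -> C) (M : R).
Hypothesis pc : forall z, disc z -> tends (cnbhs z) p (p z) /\ cabs (p z) <= M.
Hypothesis ph : hol_on p [set z | disc z /\ z != 0].

Lemma mean_kernel_conj z rho q : cabs z < rho < 1 ->
  (forall w, disc w -> tends (cnbhs w) q (q w)) -> hol_on q [set w | disc w /\ w != 0] ->
  mean (fun w => ((rho ^+ 2)%:C%C + (z^*)%C * w) / ((rho ^+ 2)%:C%C - (z^*)%C * w) * q w) rho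
  = (2 * pi)%:C%C * q 0.
Proof.
move=> /andP[zr r1] qc qh; have r0 : 0 < rho := le_lt_trans (cabs_ge0 z) zr.
set f := fun w => _.
have z1 : cabs z < 1 by exact: lt_trans r1.
pose r := if z == 0 then 1 else Num.min 1 (rho ^+ 2 / cabs z).
have rr : rho < r.
  rewrite /r; case: eqVneq => [//|z0]; rewrite lt_min r1 /=.
  by rewrite ltr_pdivlMr ?cabs_gt0// expr2 ltr_pM2l.
have r_le1 : r <= 1 by rewrite /r; case: ifP => // _; rewrite ge_min lexx.
have den w : cabs w < r -> (rho ^+ 2)%:C%C - (z^*)%C * w != 0.
  move=> wr; rewrite subr_eq0; apply: cabs_lt_neq.
  rewrite cabsM cabs_conj cabs_pos ?sqr_ge0//.
  move: wr; rewrite /r; case: eqVneq => [->|z0]; first by rewrite cabs0 mul0r exprn_gt0.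
  by rewrite lt_min => /andP[_]; rewrite ltr_pdivlMr ?cabs_gt0// mulrC.
have -> : q 0 = f 0.
  rewrite /f mulr0 addr0 subr0 divff ?mul1r//.
  by apply/eqP => /complexI/eqP; rewrite expf_eq0 gt_eqF.
apply: (@mean_center _ f r); last by rewrite r0 rr.
- apply: tendsM; last exact/qc/disc0.
  apply: tendsM.
    apply: tendsD; first exact: tends_cst.
    by apply: tendsM; [exact: tends_cst|exact: tends_id].
  apply: tendsV; first by apply: den; rewrite cabs0 (lt_trans r0).
  apply: tendsB; first exact: tends_cst.
  by apply: tendsM; [exact: tends_cst|exact: tends_id].
- move=> w /andP[w0 wr]; have [|l hl] := qh w.
    by split; [apply/discE; exact: lt_le_trans r_le1|rewrite -cabs_gt0].
  eexists; apply: cderivM hl; apply: cderiv_div; first exact: den.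
    apply: cderivD; first exact: cderiv_cst.
    by apply: cderivM; [exact: cderiv_cst|exact: cderiv_id].
  apply: cderivB; first exact: cderiv_cst.
  by apply: cderivM; [exact: cderiv_cst|exact: cderiv_id].
Qed.

Lemma seg_continuous_hkernel z rho q a b : cabs z < rho < 1 ->
  (forall w, disc w -> tends (cnbhs w) q (q w)) ->
  seg_continuous a b (fun t => hkernel z (rho%:C%C * cis t) * q (rho%:C%C * cis t)).
Proof.
move=> /andP[zr r1] qc; have r0 : 0 < rho := le_lt_trans (cabs_ge0 z) zr.
apply: (@seg_continuous_circle _ (fun w => hkernel z w * q w)); first exact: ltW.
move=> w wr; apply: tendsM; last by apply: qc; apply/discE; rewrite wr.
by apply: tends_hkernel; apply: cabs_lt_neq; rewrite wr.
Qed.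

Lemma mean_hkernel1 z rho : cabs z < rho < 1 ->
  seg_integral 0 (2 * pi) (fun t => hkernel z (rho%:C%C * cis t)) = (2 * pi)%:C%C.
Proof.
move=> zr; have /andP[zr1 r1] := zr; have r0 : 0 < rho := le_lt_trans (cabs_ge0 z) zr1.
have h := @mean_kernel_conj z rho (fun=> 1) zr
  (fun w _ => tends_cst _) (fun w _ => ex_intro _ 0 (cderiv_cst 1 w)).
have kc : seg_continuous 0 (2 * pi) (fun t => hkernel z (rho%:C%C * cis t)).
  apply: seg_continuous_circle; first exact: ltW.
  by move=> w wr; apply: tends_hkernel; apply: cabs_lt_neq; rewrite wr.
apply: (can_inj (@conjcK R)); rewrite -seg_integral_conj//.
rewrite [RHS](_ : _ = (2 * pi)%:C%C); last exact: conjc_real.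
rewrite -[RHS]mulr1 -h; apply: eq_seg_integral => t _.
by rewrite mulr1 (@conj_hkernel _ _ rho)// cabs_circle// ltW.
Qed.

Lemma mean_hkernel_conj z rho : cabs z < rho < 1 ->
  seg_integral 0 (2 * pi) (fun t => hkernel z (rho%:C%C * cis t) *
     ((p (rho%:C%C * cis t))^*)%C) = (2 * pi)%:C%C * ((p 0)^*)%C.
Proof.
move=> zr; have /andP[zr1 r1] := zr; have r0 : 0 < rho := le_lt_trans (cabs_ge0 z) zr1.
have h := @mean_kernel_conj z rho p zr (fun w wd => (pc wd).1) ph.
have kc : seg_continuous 0 (2 * pi) (fun t => hkernel z (rho%:C%C * cis t) *
     ((p (rho%:C%C * cis t))^*)%C).
  apply: (@seg_continuous_hkernel z rho (fun w => ((p w)^*)%C)) => // w wd.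
  by apply: tends_conj; exact: (pc wd).1.
apply: (can_inj (@conjcK R)); rewrite -seg_integral_conj//.
have -> : (((2 * pi)%:C%C * ((p 0)^*)%C)^*)%C = (2 * pi)%:C%C * p 0 :> C.
  by rewrite rmorphM /= conjcK; congr (_ * _); exact: conjc_real.
rewrite -h; apply: eq_seg_integral => t _.
by rewrite rmorphM /= conjcK (@conj_hkernel _ _ rho)// cabs_circle// ltW.
Qed.

Lemma mean_hkernel z rho : cabs z < rho < 1 ->
  seg_integral 0 (2 * pi) (fun t => hkernel z (rho%:C%C * cis t) * p (rho%:C%C * cis t))
  = (2 * pi)%:C%C * (p z *+ 2 - p 0).
Proof.
move=> zr; have /andP[zr1 r1] := zr; have r0 : 0 < rho := le_lt_trans (cabs_ge0 z) zr1.
have [->|z0] := eqVneq z 0.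
  have -> : p 0 *+ 2 - p 0 = p 0 by rewrite mulr2n addrK.
  have h := @mean_center _ p 1 rho (pc (disc0 R)).1.
  rewrite -h ?r0//; last first.
    move=> w /andP[w0 w1]; apply: ph; split; first exact/discE.
    by rewrite -cabs_gt0.
  apply: eq_seg_integral => t _; rewrite hkernel0 ?mul1r//.
  by rewrite -cabs_gt0 cabs_circle// ltW.
have zd : disc z by apply/discE; exact: lt_trans r1.
have [l [Q [Ql Qz hQ]]] := ph (conj zd z0).
have QE w : w != z -> Q w = (p w - p z) / (w - z).
  by move=> wz; rewrite hQ mulfK// subr_eq0.
pose g w := (w + z) * Q w.
have M0 : 0 <= M by apply: le_trans (pc zd).2; exact: cabs_ge0.
have [d d0 hd] := Ql _ ltr01.
have Qc w : disc w -> tends (cnbhs w) Q (Q w).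
  move=> wd; have [->|wz] := eqVneq w z; first by rewrite Qz.
  rewrite (QE _ wz); apply: (@tends_near _ _ _ _ (fun u => (p u - p z) / (u - z))).
    exists (cabs (w - z)); first by rewrite cabs_gt0 subr_eq0.
    move=> u uw /=; rewrite QE//; apply: contraTneq uw => ->.
    by rewrite cabsC ltxx.
  apply: tendsM; first by apply: tendsB; [exact: (pc wd).1|exact: tends_cst].
  apply: tendsV; first by rewrite subr_eq0.
  by apply: tendsB; [exact: tends_id|exact: tends_cst].
have Qb w : disc w -> cabs (Q w) <= (cabs l + 1) + 2 * M / d.
  move=> wd; have [wz|wz] := ltP (cabs (w - z)) d.
    have /= h1 := hd _ wz; have h2 := cabs_triB (Q w) l.
    have : 0 <= 2 * M / d by rewrite divr_ge0 ?mulr_ge0// ltW.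
    lra.
  have wz0 : w != z.
    by apply: contraTneq wz => ->; rewrite subrr cabs0 -ltNge.
  rewrite QE// cabsM cabsV.
  have : cabs (p w - p z) / cabs (w - z) <= 2 * M / d.
    apply: ler_pM; rewrite ?invr_ge0 ?cabs_ge0//.
      apply: le_trans (cabsD _ _) _; rewrite cabsN mulr_natl mulr2n.
      by apply: lerD; [exact: (pc wd).2|exact: (pc zd).2].
    by rewrite lef_pV2 ?posrE// (lt_le_trans d0).
  have := cabs_ge0 l; lra.
have gE := @mean_center_circle _ g (2 * ((cabs l + 1) + 2 * M / d)) (cabs z) rho.
have {gE} gE : mean g rho = (2 * pi)%:C%C * g 0.
  apply: gE.
  - by rewrite cabs_gt0 z0; apply/discE.
  - move=> w wd; split.
      apply: tendsM; last exact: Qc.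
      by apply: tendsD; [exact: tends_id|exact: tends_cst].
    rewrite cabsM; apply: ler_pM; rewrite ?cabs_ge0//; last exact: Qb.
    apply: le_trans (cabsD _ _) _.
    have /discE := wd; have /discE := zd; lra.
  - move=> w [wd [w0 wz]]; have wz0 : w != z by apply: contra_neq wz => ->.
    have [m hm] := ph (conj wd w0).
    have : cderiv (fun u => (u + z) * ((p u - p z) / (u - z))) w
        ((1 + 0) * ((p w - p z) / (w - z)) + (w + z) *
         (((m - 0) * (w - z) - (p w - p z) * (1 - 0)) / (w - z) ^+ 2)).
      apply: cderivM; first by apply: cderivD; [exact: cderiv_id|exact: cderiv_cst].
      apply: cderiv_div; first by rewrite subr_eq0.
        by apply: cderivB => //; exact: cderiv_cst.
      by apply: cderivB; [exact: cderiv_id|exact: cderiv_cst].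
    move=> h; eexists; apply: cderiv_near h.
    exists (cabs (w - z)); first by rewrite cabs_gt0 subr_eq0.
    move=> u uw /=; rewrite /g QE//; apply: contraTneq uw => ->.
    by rewrite cabsC ltxx.
  - by rewrite r0.
have g0 : g 0 = p z - p 0.
  rewrite /g add0r QE; last by rewrite eq_sym.
  by field.
have kc := @seg_continuous_hkernel z rho p 0 (2 * pi) zr (fun w wd => (pc wd).1).
have kc1 : seg_continuous 0 (2 * pi) (fun t => p z * hkernel z (rho%:C%C * cis t)).
  apply: (@seg_continuous_circle _ (fun w => p z * hkernel z w)); first exact: ltW.
  move=> w wr; apply: tendsM; first exact: tends_cst.
  by apply: tends_hkernel; apply: cabs_lt_neq; rewrite wr.
have kc2 : seg_continuous 0 (2 * pi) (fun t => hkernel z (rho%:C%C * cis t)).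
  apply: seg_continuous_circle; first exact: ltW.
  by move=> w wr; apply: tends_hkernel; apply: cabs_lt_neq; rewrite wr.
have : mean g rho = seg_integral 0 (2 * pi) (fun t =>
    hkernel z (rho%:C%C * cis t) * p (rho%:C%C * cis t) - p z * hkernel z (rho%:C%C * cis t)).
  apply: eq_seg_integral => t _; set w := _ * cis t.
  have wz : w != z by apply: cabs_lt_neq; rewrite cabs_circle// ltW.
  rewrite /g QE// /hkernel; field.
  by rewrite subr_eq0.
rewrite seg_integralB// seg_integralZ// mean_hkernel1// gE g0 => h.
apply: (addIr (- (p z * (2 * pi)%:C%C))); rewrite -h; ring.
Qed.

(** Schwarz's integral formula: a function is determined inside a circle by its
    real part on the circle, up to an imaginary constant. *)
Theorem schwarz_formula z rho : cabs z < rho < 1 ->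
  seg_integral 0 (2 * pi) (fun t => (complex.Re (p (rho%:C%C * cis t)))%:C%C *
    hkernel z (rho%:C%C * cis t)) =
  (2 * pi)%:C%C * (p z - ('i)%C * (complex.Im (p 0))%:C%C).
Proof.
move=> zr; have h1 := mean_hkernel zr; have h2 := mean_hkernel_conj zr.
have kc1 := @seg_continuous_hkernel z rho p 0 (2 * pi) zr (fun w wd => (pc wd).1).
have kc2 : seg_continuous 0 (2 * pi) (fun t => hkernel z (rho%:C%C * cis t) *
     ((p (rho%:C%C * cis t))^*)%C).
  apply: (@seg_continuous_hkernel z rho (fun w => ((p w)^*)%C)) => // w wd.
  by apply: tends_conj; exact: (pc wd).1.
have reE w : (complex.Re w)%:C%C = (w + (w^*)%C) / 2 by rewrite ReJ_add.
have reI w : w^*%C = w - 2 * (('i)%C * (complex.Im w)%:C%C).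
  by rewrite mulr_natl mulr2n; case: w => u v; apply: complex_ext => /=; ring.
rewrite (@eq_seg_integral _ _ _ _ (fun t => 2^-1 * (hkernel z (rho%:C%C * cis t) * p (rho%:C%C * cis t)
  + hkernel z (rho%:C%C * cis t) * ((p (rho%:C%C * cis t))^*)%C))); last first.
  by move=> t _; rewrite reE; ring.
rewrite seg_integralZ; last first.
  move=> t tp e e0; have e20 : 0 < e / 2 by rewrite divr_gt0.
  have [d d0 hd] := kc1 _ tp _ e20; have [d' d'0 hd'] := kc2 _ tp _ e20.
  exists (Num.min d d'); first by rewrite lt_min d0.
  move=> s; rewrite lt_min => /andP[/hd h /hd' h'].
  rewrite opprD addrACA; apply: le_lt_trans (cabsD _ _) _.
  by rewrite [ltRHS]splitr ltrD.
by rewrite seg_integralD// h1 h2 (reI (p 0)); field.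
Qed.

End Formula.

End SchwarzFormula.

(** * Harnack's inequality and the Schwarz lemma *)

Section Harnack.
Variable R : realType.
Local Notation C := R[i].
Local Notation mu := (@lebesgue_measure R).
Implicit Types (rho r e M t x : R) (p q omega phi : C -> C) (a z w l zeta : C).

Lemma cabs_nat n : cabs (n%:R : C) = n%:R.
Proof. by apply: (@complexI R); rewrite rmorph_nat -normCE normr_nat. Qed.

Lemma rotate_to_cabs z : exists2 c : C, cabs c = 1 & c * z = (cabs z)%:C%C.
Proof.
have [->|z0] := eqVneq z 0; first by exists 1; rewrite ?cabs1// cabs0 mulr0.
have c0 : cabs z != 0 by rewrite cabs_eq0.
exists ((z^*)%C / (cabs z)%:C%C).
  by rewrite cabsM cabsV cabs_conj cabs_pos ?cabs_ge0// divff.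
rewrite mulrAC (mulrC _ z) mulcJ rmorphXn /= expr2 mulfK//.
by apply/eqP => /complexI /eqP; rewrite (negbTE c0).
Qed.

Lemma hkernel_sub1 z rho zeta : cabs zeta = rho -> cabs z < rho ->
  cabs (hkernel z zeta - 1) <= 2 * cabs z / (rho - cabs z).
Proof.
move=> zr zlt; have r0 : 0 < rho := le_lt_trans (cabs_ge0 z) zlt.
have z0 : zeta != 0 by rewrite -cabs_gt0 zr.
have zz : zeta != z by apply: cabs_lt_neq; rewrite zr.
have -> : hkernel z zeta - 1 = (2 * z) / (zeta - z).
  rewrite /hkernel; field; by rewrite subr_eq0.
rewrite !cabsM cabsV cabs_nat ler_wpM2l ?mulr_ge0 ?cabs_ge0// lef_pV2 ?posrE ?subr_gt0//.
  by rewrite -zr cabs_triB.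
by rewrite (lt_le_trans _ (cabs_triB _ _))// zr subr_gt0.
Qed.

Section Positive.
Variables (p : C -> C) (M : R).
Hypothesis pc : forall z, disc z -> tends (cnbhs z) p (p z) /\ cabs (p z) <= M.
Hypothesis ph : hol_on p [set z | disc z /\ z != 0].

Lemma Re_mean_ge0 z rho : cabs z < rho < 1 ->
  (forall w, cabs w = rho -> 0 <= complex.Re (p w)) -> 0 <= complex.Re (p z).
Proof.
move=> zr pos; have /andP[zr1 r1] := zr; have r0 : 0 < rho := le_lt_trans (cabs_ge0 z) zr1.
have := schwarz_formula pc ph zr; move/(congr1 (@complex.Re R)).
rewrite ReZ ReD ReN ReM /= mul0r mul1r subrr oppr0 addr0 => h.
rewrite -(pmulr_rge0 _ (twopi_gt0 R)) -h; apply: Rintegral_ge0 => t _.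
rewrite ReZ mulr_ge0//; first by apply: pos; rewrite cabs_circle// ltW.
by apply: Re_hkernel_ge0; rewrite cabs_circle ltW.
Qed.

Lemma harnack_circle z rho : cabs z < rho < 1 ->
  (forall w, cabs w = rho -> 0 <= complex.Re (p w)) ->
  cabs (p z - p 0) <= 2 * cabs z / (rho - cabs z) * complex.Re (p 0).
Proof.
move=> zr pos; have /andP[zr1 r1] := zr; have r0 : 0 < rho := le_lt_trans (cabs_ge0 z) zr1.
have r0r : cabs (0 : C) < rho < 1 by rewrite cabs0 r0.
have h1 := schwarz_formula pc ph zr; have h0 := schwarz_formula pc ph r0r.
set c := 2 * cabs z / (rho - cabs z).
have rhoE t : rho%:C%C * cis t != 0 :> C by rewrite -cabs_gt0 cabs_circle// ltW.
have cont w : cabs w < rho -> seg_continuous 0 (2 * pi) (fun t =>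
    (complex.Re (p (rho%:C%C * cis t)))%:C%C * hkernel w (rho%:C%C * cis t)).
  move=> wr; apply: (@seg_continuous_circle _ (fun u => (complex.Re (p u))%:C%C * hkernel w u)).
    exact: ltW.
  move=> u ur; apply: tendsM; last by apply/tends_hkernel/cabs_lt_neq; rewrite ur.
  have [|h _] := pc (z := u); first by apply/discE; rewrite ur.
  move=> e e0; apply: filterS (h e e0) => v /=; apply: le_lt_trans.
  by rewrite -rmorphB /= cabs_real -ReN -ReD Re_le_cabs.
have h0' : Rintegral mu `[0, 2 * pi] (fun t => complex.Re (p (rho%:C%C * cis t))) =
    2 * pi * complex.Re (p 0).
  have e0 : complex.Re ((2 * pi)%:C%C * (p 0 - ('i)%C * (complex.Im (p 0))%:C%C))
      = 2 * pi * complex.Re (p 0).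
    by rewrite ReZ ReD ReN ReM /= mul0r mul1r subrr oppr0 addr0.
  rewrite -e0 -h0.
  apply: eq_Rintegral => t _.
  have e : complex.Re ((complex.Re (p (rho%:C%C * cis t)))%:C%C *
      hkernel 0 (rho%:C%C * cis t)) = complex.Re (p (rho%:C%C * cis t)).
    by rewrite ReZ hkernel0// mulr1.
  exact: esym e.
have -> : p z - p 0 = (2 * pi)%:C%C^-1 * seg_integral 0 (2 * pi) (fun t =>
    (complex.Re (p (rho%:C%C * cis t)))%:C%C * hkernel z (rho%:C%C * cis t) -
    (complex.Re (p (rho%:C%C * cis t)))%:C%C * hkernel 0 (rho%:C%C * cis t)).
  rewrite seg_integralB ?h1 ?h0; [|exact: cont|by apply: cont; rewrite cabs0].
  have tp : (2 * pi)%:C%C != 0 :> C.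
    by apply/eqP => /complexI /eqP; rewrite gt_eqF// twopi_gt0.
  by rewrite -mulrBr mulKf//; ring.
rewrite cabsM cabsV cabs_pos; last exact/ltW/twopi_gt0.
rewrite mulrC ler_pdivrMr; last exact: twopi_gt0.
have -> : c * complex.Re (p 0) * (2 * pi) = c * (2 * pi * complex.Re (p 0)) by ring.
have mD : measurable `[0, 2 * pi : R]%classic by exact: measurable_itv.
have ip : mu.-integrable `[0, 2 * pi] (EFin \o (fun t => complex.Re (p (rho%:C%C * cis t)))).
  have [|h _] := @seg_cintegrable R 0 (2 * pi) (fun t => p (rho%:C%C * cis t)) => //.
  apply: seg_continuous_circle; first exact: ltW.
  by move=> w wr; apply: (pc _).1; apply/discE; rewrite wr.
rewrite -h0' -RintegralZl//.
apply: cabs_cintegral => //.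
- by apply: seg_cintegrable; apply: seg_continuousB; apply: cont => //; rewrite cabs0.
- by apply: eq_integrable (integrableZl _ c ip) => // t _.
- move=> t _; rewrite hkernel0// -mulrBr cabsM cabs_pos; last first.
    by apply: pos; rewrite cabs_circle// ltW.
  rewrite mulrC ler_wpM2r//; first by apply: pos; rewrite cabs_circle// ltW.
  by apply: hkernel_sub1; rewrite ?cabs_circle// ltW.
Qed.

(** Harnack's inequality on smaller circles follows from the bound of
    [hkernel_sub1] on the kernel; the radius then tends to 1. *)
Lemma harnack z : disc z -> (forall w, disc w -> 0 <= complex.Re (p w)) ->
  cabs (p z - p 0) <= 2 * cabs z / (1 - cabs z) * complex.Re (p 0).
Proof.
move=> /discE z1 pos.
set Y := 2 * cabs z * complex.Re (p 0).
have -> : 2 * cabs z / (1 - cabs z) * complex.Re (p 0) = Y / (1 - cabs z).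
  by rewrite /Y; ring.
rewrite ler_pdivlMr ?subr_gt0//; set X := cabs (p z - p 0).
have X0 : 0 <= X := cabs_ge0 _.
apply/ler_addgt0Pr => e e0.
pose d := Num.min ((1 - cabs z) / 2) (e / (X + 1)).
have X1 : 0 < X + 1 by lra.
have d0 : 0 < d by rewrite lt_min !divr_gt0// subr_gt0.
have d1 : d <= (1 - cabs z) / 2 by rewrite ge_min lexx.
have d2 : d * (X + 1) <= e by rewrite -ler_pdivlMr// ge_min lexx orbT.
have zr : cabs z < 1 - d < 1 by apply/andP; split; lra.
have hw w : cabs w = 1 - d -> disc w by move=> wd; apply/discE; rewrite wd; lra.
have := @harnack_circle z (1 - d) zr (fun w h => pos w (hw w h)); rewrite -/X.
have -> : 2 * cabs z / (1 - d - cabs z) * complex.Re (p 0) = Y / (1 - d - cabs z).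
  by rewrite /Y; ring.
rewrite ler_pdivlMr; last by lra.
nra.
Qed.

End Positive.

(** Schwarz lemma with a quantitative rigidity statement: the closer the
    derivative at the origin is to modulus one, the closer the map is to a
    rotation.  Rigidity is Harnack's inequality for the positive real part of
    [1 - c * omega z / z]. *)
Section Schwarz.
Variables (omega : C -> C) (l : C).
Hypothesis oh : forall z, disc z -> exists m, cderiv omega z m.
Hypothesis od : forall z, disc z -> disc (omega z).
Hypothesis o0 : omega 0 = 0.
Hypothesis ol : cderiv omega 0 l.

(** [omega z / z], extended by [l] at the origin, is bounded by [1 / rho] on the circle
    of radius [rho]; the maximum principle follows from the positivity of
    [1 / rho - Re (c * psi)]. *)
Lemma schwarz_quotient : exists psi : C -> C,
  [/\ forall z, omega z = psi z * z, psi 0 = l,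
      forall z, disc z -> cabs (psi z) <= 1,
      forall z, disc z -> tends (cnbhs z) psi (psi z) &
      hol_on psi [set z | disc z /\ z != 0]].
Proof.
have [psi [pl p0 hpsi]] := ol.
have oE z : omega z = psi z * z by have := hpsi z; rewrite o0 !subr0.
have pE z : z != 0 -> psi z = omega z / z by move=> z0; rewrite oE mulfK.
have ph : hol_on psi [set z | disc z /\ z != 0].
  move=> z [zd z0]; have [m hm] := oh zd.
  have h := cderiv_div z0 hm (cderiv_id z).
  eexists; apply: cderiv_near h; exists (cabs z); first by rewrite cabs_gt0.
  move=> w wz /=; rewrite pE//; apply: contraTneq wz => ->.
  by rewrite sub0r cabsN ltxx.
have pc z : disc z -> tends (cnbhs z) psi (psi z).
  move=> zd; have [->|z0] := eqVneq z 0; first by rewrite p0.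
  by have [m hm] := ph z (conj zd z0); exact: cderiv_cont hm.
have pinv z : disc z -> z != 0 -> cabs (psi z) <= (cabs z)^-1.
  move=> zd z0; rewrite pE// cabsM cabsV ler_piMl ?invr_ge0 ?cabs_ge0//.
  by apply/ltW/discE/od.
have [d d0 hd] := pl _ ltr01.
have pb z : disc z -> cabs (psi z) <= cabs l + 1 + d^-1.
  move=> zd; have [zs|zs] := ltP (cabs z) d.
    have /= h1 := hd z; rewrite subr0 in h1; have {}h1 := h1 zs.
    have h2 := cabs_triB (psi z) l.
    have : 0 < d^-1 by rewrite invr_gt0.
    by lra.
  have z0 : z != 0 by rewrite -cabs_gt0 (lt_le_trans d0).
  apply: le_trans (pinv _ zd z0) _.
  have : (cabs z)^-1 <= d^-1 by rewrite lef_pV2 ?posrE// (lt_le_trans d0).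
  by have := cabs_ge0 l; lra.
exists psi; split => // z zd; have /discE z1 := zd.
(* maximum principle: rotate [psi z] to the positive axis *)
have [c c1 cpz] := rotate_to_cabs (psi z).
have cz : complex.Re (c * psi z) = cabs (psi z) by rewrite cpz.
have key rho : cabs z < rho < 1 -> cabs (psi z) <= rho^-1.
  move=> zr; have /andP[zr1 r1] := zr; have r0 : 0 < rho := le_lt_trans (cabs_ge0 z) zr1.
  pose p w := (rho^-1)%:C%C - c * psi w.
  have := @Re_mean_ge0 p (rho^-1 + (cabs l + 1 + d^-1)) _ _ z rho zr.
  rewrite /p ReD ReN cz subr_ge0; apply.
  - move=> w wd; split.
      apply: tendsB; first exact: tends_cst.
      by apply: tendsM; [exact: tends_cst|exact: pc].
    apply: le_trans (cabsD _ _) _; rewrite cabsN cabsM c1 mul1r.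
    by rewrite cabs_pos ?lerD2l ?pb// invr_ge0 ltW.
  - move=> w /ph[m hm]; eexists; apply: cderivB; first exact: cderiv_cst.
    by apply: cderivM hm; exact: cderiv_cst.
  - move=> w wr; rewrite ReD ReN subr_ge0 /=.
    apply: le_trans (cabs_Re _) _; rewrite cabsM c1 mul1r -wr.
    apply: pinv; first by apply/discE; rewrite wr.
    by rewrite -cabs_gt0 wr.
rewrite leNgt; apply/negP => h.
have c0 : 0 < cabs (psi z) by rewrite (lt_trans ltr01).
pose rho := Num.max ((cabs z + 1) / 2) ((1 + (cabs (psi z))^-1) / 2).
have i1 : (cabs (psi z))^-1 < 1 by rewrite invf_lt1.
have zr : cabs z < rho < 1.
  by rewrite lt_max gt_max; apply/andP; split; [apply/orP; left|apply/andP; split]; lra.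
have r2 : (cabs (psi z))^-1 < rho.
  by rewrite lt_max; apply/orP; right; lra.
have /andP[zr1 zr2] := zr; have r0 : 0 < rho := le_lt_trans (cabs_ge0 z) zr1.
have := key _ zr; rewrite leNgt => /negP; apply.
by rewrite -[X in _ < X]invrK ltf_pV2 ?posrE// invr_gt0.
Qed.

Lemma schwarz_le z : disc z -> cabs (omega z) <= cabs z.
Proof.
have [psi [oE _ p1 _ _]] := schwarz_quotient.
by move=> /p1 h; rewrite oE cabsM ler_piMl ?cabs_ge0.
Qed.

Lemma schwarz_deriv : cabs l <= 1.
Proof. by have [psi [_ <- p1 _ _]] := schwarz_quotient; exact: p1 (disc0 R). Qed.

Lemma schwarz_rigid z : disc z ->
  cabs (omega z - l * z) <= 2 / (1 - cabs z) * (1 - cabs l).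
Proof.
have [psi [oE p0 p1 pc ph]] := schwarz_quotient => zd; have /discE z1 := zd.
have [c c1 cl'] := rotate_to_cabs l.
have cl : complex.Re (c * l) = cabs l by rewrite cl'.
pose p w := 1 - c * psi w.
have h := @harnack p (1 + 1) _ _ z zd.
have {h} : cabs (p z - p 0) <= 2 * cabs z / (1 - cabs z) * complex.Re (p 0).
  apply: h.
  - move=> w wd; split.
      apply: tendsB; first exact: tends_cst.
      by apply: tendsM; [exact: tends_cst|exact: pc].
    by apply: le_trans (cabsD _ _) _; rewrite cabsN cabsM c1 mul1r cabs1 lerD2l p1.
  - move=> w /ph[m hm]; eexists; apply: cderivB; first exact: cderiv_cst.
    by apply: cderivM hm; exact: cderiv_cst.
  - move=> w wd; rewrite ReD ReN subr_ge0 /=.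
    by apply: le_trans (cabs_Re _) _; rewrite cabsM c1 mul1r p1.
have -> : p z - p 0 = - (c * (psi z - l)) by rewrite /p p0; ring.
rewrite cabsN cabsM c1 mul1r ReD ReN p0 cl /= => h.
rewrite oE -mulrBl cabsM.
have z0 := cabs_ge0 z; have l1 := schwarz_deriv.
have q0 : 0 <= 2 / (1 - cabs z) * (1 - cabs l).
  by rewrite mulr_ge0 ?subr_ge0// divr_ge0// subr_ge0 ltW.
have q1 : cabs (psi z - l) <= 2 / (1 - cabs z) * (1 - cabs l) * cabs z.
  by apply: le_trans h _; rewrite le_eqVlt; apply/orP; left; apply/eqP; ring.
apply: le_trans (ler_wpM2r z0 q1) _.
move: q0; set Q := _ * (1 - cabs l) => q0.
by rewrite -mulrA ler_piMr// -expr2 exprn_ile1// ltW.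
Qed.

End Schwarz.

End Harnack.

(** * Disc automorphisms and the Schwarz-Pick lemma *)

Section Moebius.
Variable R : realType.
Local Notation C := R[i].
Implicit Types (a z w zeta : C) (phi : C -> C).

Definition moebius a w : C := (a + w) / (1 + (a^*)%C * w).

Lemma cabs_sqr_den a w : cabs (1 + (a^*)%C * w) ^+ 2 - cabs (a + w) ^+ 2 =
  (1 - cabs a ^+ 2) * (1 - cabs w ^+ 2).
Proof. by rewrite !cabs_sqr; case: a w => a1 a2 [w1 w2] /=; ring. Qed.

Lemma cabs2_lt1 z : cabs z < 1 -> 0 < 1 - cabs z ^+ 2.
Proof. by move=> h; rewrite subr_gt0 exprn_ilt1 ?cabs_ge0. Qed.

Lemma moebius_den a w : cabs a < 1 -> cabs w <= 1 -> 1 + (a^*)%C * w != 0.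
Proof.
move=> a1 w1; rewrite -cabs_gt0.
have h : 1 - cabs ((a^*)%C * w) <= cabs (1 + (a^*)%C * w).
  by have := cabs_triB 1 (- ((a^*)%C * w)); rewrite cabsN opprK cabs1.
apply: lt_le_trans h; rewrite subr_gt0 cabsM cabs_conj.
by rewrite (le_lt_trans _ a1)// ler_piMr ?cabs_ge0.
Qed.

Lemma cabs_moebius_sqr a w : cabs a < 1 -> cabs w <= 1 ->
  1 - cabs (moebius a w) ^+ 2 =
  (1 - cabs a ^+ 2) * (1 - cabs w ^+ 2) / cabs (1 + (a^*)%C * w) ^+ 2.
Proof.
move=> a1 w1; have d0 := moebius_den a1 w1.
rewrite -cabs_sqr_den cabsM cabsV; field.
by rewrite cabs_eq0.
Qed.

Lemma moebius_disc a w : cabs a < 1 -> cabs w < 1 -> cabs (moebius a w) < 1.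
Proof.
move=> a1 w1; have d0 := moebius_den a1 (ltW w1).
have h : 0 < 1 - cabs (moebius a w) ^+ 2.
  rewrite cabs_moebius_sqr ?ltW//; apply: divr_gt0.
    by apply: mulr_gt0; exact: cabs2_lt1.
  by apply: exprn_gt0; rewrite cabs_gt0.
rewrite ltNge; apply/negP => h1; move: h; rewrite subr_gt0 ltNge => /negP; apply.
by rewrite -[X in X <= _](expr1n _ 2) ler_pXn2r ?nnegrE ?ler01 ?cabs_ge0.
Qed.

Lemma moebius_circle a w : cabs a < 1 -> cabs w = 1 -> cabs (moebius a w) = 1.
Proof.
move=> a1 w1; apply/eqP; rewrite -(@eqrXn2 _ 2)// ?cabs_ge0// expr1n eq_sym.
by rewrite -subr_eq0 cabs_moebius_sqr ?w1// expr1n subrr mulr0 mul0r.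
Qed.

Lemma moebiusK a w : cabs a < 1 -> cabs w <= 1 -> moebius (- a) (moebius a w) = w.
Proof.
move=> a1 w1; have d0 := moebius_den a1 w1.
have aa : (a^*)%C * a = (cabs a ^+ 2)%:C%C by rewrite mulrC mulcJ.
have s0 : 1 - a * (a^*)%C != 0.
  rewrite mulcJ; apply/eqP => /(congr1 (@complex.Re R)) /=.
  by apply/eqP; rewrite gt_eqF// cabs2_lt1.
rewrite /moebius raddfN /=; move: d0 s0; set s := 1 - a * _; set D := 1 + _ => d0 s0.
have -> : - a + (a + w) / D = w * s / D by rewrite /s /D; field; exact: d0.
have -> : 1 + - (a^*)%C * ((a + w) / D) = s / D by rewrite /s /D; field; exact: d0.
by field; rewrite s0 d0.
Qed.

Lemma moebius0 a : moebius a 0 = a.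
Proof. by rewrite /moebius mulr0 !addr0 divr1. Qed.

Lemma moebiusN a : moebius (- a) a = 0.
Proof. by rewrite /moebius addNr mul0r. Qed.

Lemma cderiv_moebius a w : cabs a < 1 -> cabs w <= 1 ->
  cderiv (moebius a) w ((1 - cabs a ^+ 2)%:C%C / (1 + (a^*)%C * w) ^+ 2).
Proof.
move=> a1 w1; have d0 := moebius_den a1 w1.
have h := @cderiv_div _ (fun w => a + w) (fun w => 1 + (a^*)%C * w) w _ _ d0 (cderivD (cderiv_cst a w) (cderiv_id w))
  (cderivD (cderiv_cst 1 w) (cderivM (cderiv_cst (a^*)%C w) (cderiv_id w))).
rewrite rmorphB /= -mulcJ.
suff <- : ((0 + 1) * (1 + (a^*)%C * w) - (a + w) * (0 + (0 * w + (a^*)%C * 1))) /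
  (1 + (a^*)%C * w) ^+ 2 = (1%:C%C - a * (a^*)%C) / (1 + (a^*)%C * w) ^+ 2 by [].
by congr (_ / _); rewrite rmorph1; ring.
Qed.

Definition pseudo z w : R := cabs ((z - w) / (1 - (z^*)%C * w)).

Lemma pseudoE z w : pseudo z w = cabs (moebius (- z) w).
Proof.
by rewrite /pseudo /moebius raddfN /= mulNr !cabsM -cabsN opprB addrC.
Qed.

Lemma pseudoC z w : pseudo z w = pseudo w z.
Proof.
rewrite /pseudo !cabsM cabsC !cabsV; congr (_ / _).
by rewrite -cabs_conj raddfB /= rmorphM /= conjcK mulrC; congr (cabs (_ - _)); exact: conjc1.
Qed.

Lemma pseudo_ge0 z w : 0 <= pseudo z w.
Proof. exact: cabs_ge0. Qed.

Lemma pseudo_lt1 z w : cabs z < 1 -> cabs w < 1 -> pseudo z w < 1.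
Proof. by move=> z1 w1; rewrite pseudoE moebius_disc ?cabsN. Qed.

Lemma pseudo_sqr z w : cabs z < 1 -> cabs w < 1 ->
  1 - pseudo z w ^+ 2 =
  (1 - cabs z ^+ 2) * (1 - cabs w ^+ 2) / cabs (1 - (z^*)%C * w) ^+ 2.
Proof.
move=> z1 w1; rewrite pseudoE cabs_moebius_sqr ?cabsN 1?ltW//.
by rewrite raddfN /= mulNr.
Qed.

(** Schwarz-Pick for a self-map of the disc, by moving [phi 0] to the origin. *)
Section SchwarzPick.
Variables (phi : C -> C) (l : C).
Hypothesis ph : forall z, disc z -> exists m, cderiv phi z m.
Hypothesis pd : forall z, disc z -> disc (phi z).
Hypothesis pl : cderiv phi 0 l.
Let a := phi 0.
Let omega z := moebius (- a) (phi z).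

Let a1 : cabs a < 1. Proof. by apply/discE/pd/disc0. Qed.
Let na1 : cabs (- a) < 1. Proof. by rewrite cabsN. Qed.
Let p1 z : disc z -> cabs (phi z) <= 1.
Proof. by move=> /pd/discE/ltW. Qed.

Let oh z : disc z -> exists m, cderiv omega z m.
Proof.
move=> zd; have [m hm] := ph zd; eexists; apply: cderiv_comp hm _.
by apply: cderiv_moebius => //; exact: p1.
Qed.

Let od z : disc z -> disc (omega z).
Proof. by move=> /pd/discE h; apply/discE/moebius_disc. Qed.

Let o0 : omega 0 = 0. Proof. exact: moebiusN. Qed.

Let s0 : 1 - cabs a ^+ 2 != 0. Proof. by rewrite gt_eqF// cabs2_lt1. Qed.

Let ol : cderiv omega 0 (l / (1 - cabs a ^+ 2)%:C%C).
Proof.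
have h := cderiv_comp pl (cderiv_moebius na1 (p1 (disc0 R))).
suff <- : (1 - cabs (- a) ^+ 2)%:C%C / (1 + ((- a)^*)%C * phi 0) ^+ 2 * l =
   l / (1 - cabs a ^+ 2)%:C%C by [].
rewrite cabsN raddfN /= -/a mulNr mulrC; congr (_ * _).
have -> : 1 - (a^*)%C * a = (1 - cabs a ^+ 2)%:C%C.
  by rewrite (mulrC _ a) mulcJ rmorphB rmorph1.
have : (1 - cabs a ^+ 2)%:C%C != 0 :> C.
  by apply/eqP => /complexI /eqP; rewrite (negbTE s0).
by move: (1 - cabs a ^+ 2)%:C%C => s s1; field.
Qed.

Lemma self_map_moebius z : disc z -> phi z = moebius a (moebius (- a) (phi z)).
Proof. by move=> zd; rewrite -[X in moebius X]opprK moebiusK// p1. Qed.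

Lemma schwarz_pick z : disc z -> pseudo (phi 0) (phi z) <= cabs z.
Proof. by move=> zd; rewrite pseudoE; exact: (schwarz_le oh od o0 ol). Qed.

Lemma schwarz_pick_deriv : cabs l <= 1 - cabs (phi 0) ^+ 2.
Proof.
have := schwarz_deriv oh od o0 ol; rewrite cabsM cabsV cabs_pos.
  by rewrite ler_pdivrMr ?mul1r ?cabs2_lt1.
exact/ltW/cabs2_lt1.
Qed.

Lemma schwarz_pick_rigid z : disc z ->
  cabs (moebius (- phi 0) (phi z) - l / (1 - cabs (phi 0) ^+ 2)%:C%C * z) <=
  2 / (1 - cabs z) * (1 - cabs l / (1 - cabs (phi 0) ^+ 2)).
Proof.
move=> zd; have := schwarz_rigid oh od o0 ol zd.
rewrite [cabs (l / _)]cabsM cabsV cabs_pos//.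
exact/ltW/cabs2_lt1.
Qed.

End SchwarzPick.

(** Harnack's inequality for the Herglotz kernel with the sharp constant.  It is
    the triangle inequality for
    (zeta - z) (1 - |w|^2) = (zeta - w) (1 - w^* z) - (z - w) (1 - w^* zeta). *)
Lemma hkernel_harnack z w zeta : cabs z < 1 -> cabs w < 1 -> cabs zeta = 1 ->
  cabs (hkernel z zeta - hkernel w zeta) <=
  2 * pseudo w z / (1 - pseudo w z) * complex.Re (hkernel w zeta).
Proof.
move=> z1 w1 e1.
have ez : zeta != z by apply: cabs_lt_neq; rewrite e1.
have ew : zeta != w by apply: cabs_lt_neq; rewrite e1.
rewrite hkernel_sub// Re_hkernel e1 expr1n !cabsM cabsV cabsM cabs_nat e1 mulr1.
set X := cabs (zeta - z); set Y := cabs (zeta - w).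
have X0 : 0 < X by rewrite cabs_gt0 subr_eq0.
have Y0 : 0 < Y by rewrite cabs_gt0 subr_eq0.
have d0 : 1 - (w^*)%C * z != 0.
  have := @moebius_den (- w) z; rewrite cabsN raddfN /= mulNr; apply => //.
  exact: ltW.
set A := cabs (1 - (w^*)%C * z).
have A0 : 0 < A by rewrite cabs_gt0.
have ps1 : pseudo w z < 1 by exact: pseudo_lt1.
have psE : pseudo w z = cabs (z - w) / A by rewrite /pseudo cabsM cabsV cabsC.
rewrite psE in ps1 *; set B := cabs (z - w) in ps1 *.
have BA : B < A by rewrite ltr_pdivrMr// mul1r in ps1.
have B0 : 0 <= B := cabs_ge0 _.
have P0 : 0 < 1 - cabs w ^+ 2 by exact: cabs2_lt1.
have YE : cabs (1 - (w^*)%C * zeta) = Y.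
  have -> : 1 - (w^*)%C * zeta = ((zeta - w)^*)%C * zeta.
    rewrite raddfB /= mulrBl; congr (_ - _).
    by rewrite mulrC mulcJ e1 expr1n.
  by rewrite cabsM cabs_conj e1 mulr1.
have tri : A * Y <= (1 - cabs w ^+ 2) * X + B * Y.
  have <- : cabs ((zeta - w) * (1 - (w^*)%C * z)) = A * Y by rewrite cabsM mulrC.
  have -> : (zeta - w) * (1 - (w^*)%C * z) =
     (1 - cabs w ^+ 2)%:C%C * (zeta - z) + (z - w) * (1 - (w^*)%C * zeta).
    by rewrite rmorphB rmorph1 /= -mulcJ; ring.
  apply: le_trans (cabsD _ _) _; rewrite !cabsM YE cabs_pos//.
  exact: ltW.
have -> : 2 * (B / A) / (1 - B / A) * ((1 - cabs w ^+ 2) / Y ^+ 2) =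
   2 * B * ((1 - cabs w ^+ 2) / ((A - B) * Y ^+ 2)).
  by field; rewrite !gt_eqF// subr_gt0.
rewrite ler_wpM2l ?mulr_ge0// ler_pdivlMr ?mulr_gt0 ?subr_gt0 ?exprn_gt0//.
rewrite mulrC ler_pdivrMr ?mulr_gt0//.
have : (A - B) * Y <= (1 - cabs w ^+ 2) * X by lra.
move: (1 - cabs w ^+ 2) => P h.
have -> : (A - B) * Y ^+ 2 = (A - B) * Y * Y by ring.
by rewrite mulrA ler_pM2r.
Qed.

End Moebius.

(** * Herglotz integrals *)

Section HerglotzIntegral.
Variable R : realType.
Local Notation C := R[i].
Implicit Types (z w l zeta : C) (t : R).

Lemma cabs_hkernel z zeta : cabs z < 1 -> cabs zeta = 1 ->
  cabs (hkernel z zeta) <= 2 / (1 - cabs z).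
Proof.
move=> z1 e1; rewrite cabsM cabsV.
have d : 1 - cabs z <= cabs (zeta - z) by rewrite -e1 cabs_triB.
apply: ler_pM; rewrite ?invr_ge0 ?cabs_ge0//.
  apply: le_trans (cabsD _ _) _; rewrite e1; lra.
by rewrite lef_pV2 ?posrE ?subr_gt0// (lt_le_trans _ d)// subr_gt0.
Qed.

Lemma continuous_measurable (g : R -> C) (D : set (measurableTypeR R)) :
  (forall a b, seg_continuous a b g) -> measurable D ->
  measurable_fun D (fun t => complex.Re (g t)) /\
  measurable_fun D (fun t => complex.Im (g t)).
Proof.
move=> gc mD; split; apply: measurable_funTS; apply: continuous_measurable_fun.
  move=> t; apply/cvgrPdist_lt => e e0.
  have [|d d0 hd] := gc t t t _ e e0; first by rewrite lexx.
  apply/nbhs_ballP; exists d => // s; rewrite /ball /= distrC => /hd.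
  by apply: le_lt_trans; rewrite cabsC -ReN -ReD Re_le_cabs.
move=> t; apply/cvgrPdist_lt => e e0.
have [|d d0 hd] := gc t t t _ e e0; first by rewrite lexx.
apply/nbhs_ballP; exists d => // s; rewrite /ball /= distrC => /hd.
by apply: le_lt_trans; rewrite cabsC -ImN -ImD Im_le_cabs.
Qed.

Lemma seg_continuous_cis (f : C -> C) a b :
  (forall w, cabs w = 1 -> tends (cnbhs w) f (f w)) ->
  seg_continuous a b (fun t => f (cis t)).
Proof.
move=> fc; have h := @seg_continuous_circle R f 1 a b (@ler01 R) fc.
move=> t tab e e0; have [d d0 hd] := h t tab e e0; exists d => // s /hd.
by rewrite !mul1r.
Qed.

Variable mu : {finite_measure set (measurableTypeR R) -> \bar R}.
Local Notation H := (herglotz_integral mu).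
Let D : set (measurableTypeR R) := `[0, 2 * pi[%classic.

Let mD : measurable D. Proof. exact: measurable_itv. Qed.

Let muD : (mu D < +oo)%E.
Proof. by rewrite ltey_eq fin_num_measure. Qed.

Lemma herglotz_integralE z : H z = cintegral mu D (fun t => hkernel z (cis t)).
Proof. by []. Qed.

Lemma circle_cintegrable (f : C -> C) M :
  (forall w, cabs w = 1 -> tends (cnbhs w) f (f w)) ->
  (forall w, cabs w = 1 -> cabs (f w) <= M) ->
  cintegrable mu D (fun t => f (cis t)).
Proof.
move=> fc fM.
have [m1 m2] := @continuous_measurable (fun t => f (cis t)) D
  (fun a b => seg_continuous_cis fc) mD.
apply: (@cintegrable_bounded _ _ _ mu D mD muD _ M m1 m2) => t _.
by apply: fM; rewrite cabs_cis.
Qed.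

Lemma hkernel_cintegrable z : cabs z < 1 ->
  cintegrable mu D (fun t => hkernel z (cis t)).
Proof.
move=> z1; apply: (@circle_cintegrable (hkernel z)) => w w1.
  by apply: tends_hkernel; apply: cabs_lt_neq; rewrite w1.
exact: cabs_hkernel.
Qed.

Lemma Re_herglotz_ge0 z : cabs z < 1 -> 0 <= complex.Re (H z).
Proof.
move=> z1; rewrite herglotz_integralE Re_cintegral; apply: Rintegral_ge0 => t _.
by apply: Re_hkernel_ge0; rewrite cabs_cis ltW.
Qed.

Lemma herglotz_harnack z w : cabs z < 1 -> cabs w < 1 ->
  cabs (H z - H w) <= 2 * pseudo w z / (1 - pseudo w z) * complex.Re (H w).
Proof.
move=> z1 w1; have zi := hkernel_cintegrable z1; have wi := hkernel_cintegrable w1.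
rewrite herglotz_integralE (herglotz_integralE w) -cintegralB//.
set c := 2 * _ / _; rewrite Re_cintegral -RintegralZl//; last exact: wi.1.
apply: cabs_cintegral => //; first exact: cintegrableB.
  by apply: eq_integrable (integrableZl mD c wi.1) => // t _.
by move=> t _; apply: hkernel_harnack => //; exact: cabs_cis.
Qed.

Lemma cabs_herglotz z : cabs z < 1 ->
  cabs (H z) <= 2 / (1 - cabs z) * fine (mu D).
Proof.
move=> z1; rewrite herglotz_integralE; apply: cabs_cintegral_cst => //.
  exact: hkernel_cintegrable.
by move=> t _; apply: cabs_hkernel => //; exact: cabs_cis.
Qed.

(** Differentiation of the kernel: its difference quotient and its derivative
    are again rational in [zeta], so the Carathéodory quotient of the integral is
    the integral of that of the kernel. *)
Let Q z w zeta := 2 * zeta / ((zeta - w) * (zeta - z)) : C.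

Let tends_Q z w zeta : zeta != z -> zeta != w ->
  tends (cnbhs zeta) (Q z w) (Q z w zeta).
Proof.
move=> h1 h2; apply: tendsM.
  by apply: tendsM; [exact: tends_cst|exact: tends_id].
apply: tendsV; first by rewrite mulf_neq0// subr_eq0.
by apply: tendsM; apply: tendsB; (exact: tends_id || exact: tends_cst).
Qed.

Let cabs_Q z w zeta (r : R) : cabs z <= r -> cabs w <= r -> r < 1 -> cabs zeta = 1 ->
  cabs (Q z w zeta) <= 2 / (1 - r) ^+ 2.
Proof.
move=> zr wr r1 e1; rewrite !cabsM cabsV cabsM cabs_nat e1 mulr1.
rewrite ler_pM2l// expr2.
have h1 : 1 - r <= cabs (zeta - w).
  by apply: le_trans (cabs_triB _ _); rewrite e1 lerD2l lerN2.
have h2 : 1 - r <= cabs (zeta - z).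
  by apply: le_trans (cabs_triB _ _); rewrite e1 lerD2l lerN2.
have r0 : 0 < 1 - r by rewrite subr_gt0.
rewrite lef_pV2 ?posrE ?mulr_gt0//; last 2 first.
  exact: lt_le_trans h1.
  exact: lt_le_trans h2.
by apply: ler_pM => //; exact: ltW.
Qed.

Let Q_cintegrable z w : cabs z < 1 -> cabs w < 1 ->
  cintegrable mu D (fun t => Q z w (cis t)).
Proof.
move=> z1 w1; pose r := Num.max (cabs z) (cabs w).
apply: (@circle_cintegrable (Q z w) (2 / (1 - r) ^+ 2)) => u u1.
  by apply: tends_Q; apply: cabs_lt_neq; rewrite u1.
by apply: cabs_Q => //; rewrite ?le_max ?lexx ?orbT// gt_max z1.
Qed.

Lemma cderiv_herglotz z : cabs z < 1 ->
  exists2 l, cderiv H z l & cabs l * (1 - cabs z ^+ 2) <= 2 * complex.Re (H z).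
Proof.
move=> z1; pose l := cintegral mu D (fun t => Q z z (cis t)).
have HE w : cabs w < 1 ->
    H w - H z = cintegral mu D (fun t => Q z w (cis t)) * (w - z).
  move=> w1; rewrite herglotz_integralE (herglotz_integralE z).
  rewrite -cintegralB//; [|exact: hkernel_cintegrable|exact: hkernel_cintegrable].
  rewrite mulrC -cintegralZ//; last exact: Q_cintegrable.
  apply: eq_cintegral => t _; rewrite hkernel_sub; last 2 first.
  - by apply: cabs_lt_neq; rewrite cabs_cis.
  - by apply: cabs_lt_neq; rewrite cabs_cis.
  by rewrite /Q; ring.
exists l; last first.
  have zi := hkernel_cintegrable z1.
  have p0 : 0 < 1 - cabs z ^+ 2 by exact: cabs2_lt1.
  rewrite -ler_pdivlMr// mulrAC herglotz_integralE Re_cintegral -RintegralZl//; last exact: zi.1.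
  apply: cabs_cintegral => //; first exact: Q_cintegrable.
    by apply: eq_integrable (integrableZl mD _ zi.1) => // t _.
  move=> t _; rewrite Re_hkernel cabs_cis expr1n /Q !cabsM cabsV cabsM cabs_nat cabs_cis mulr1.
  have N0 : cabs (cis t - z) != 0.
    by rewrite cabs_eq0 subr_eq0; apply: cabs_lt_neq; rewrite cabs_cis.
  move: (cabs _) p0 N0 => N p0 N0; move: (1 - _) p0 => P p0.
  rewrite le_eqVlt; apply/orP; left; apply/eqP; field.
  by rewrite N0 gt_eqF.
pose r := (1 + cabs z) / 2.
have r1 : r < 1 by rewrite /r; lra.
have zr : cabs z <= r by rewrite /r; lra.
exists (fun w => if cabs w < 1 then cintegral mu D (fun t => Q z w (cis t))
   else (H w - H z) / (w - z)).
split.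
- (* on a disc of radius [r] the quotient is Lipschitz in [w] *)
  move=> e e0; pose K := 4 / (1 - r) ^+ 3 * fine (mu D).
  have K0 : 0 <= K.
    rewrite mulr_ge0 ?fine_ge0// divr_ge0// exprn_ge0//; lra.
  have d10 : 0 < (1 - cabs z) / 2 by rewrite divr_gt0// subr_gt0.
  have d20 : 0 < e / (K + 1) by rewrite divr_gt0//; lra.
  exists (Num.min ((1 - cabs z) / 2) (e / (K + 1))); first by rewrite lt_min d10.
  move=> w; rewrite lt_min => /andP[w1 w2] /=.
  have wr : cabs w <= r.
    by have := cabs_triB w z; rewrite /r; lra.
  have wlt : cabs w < 1 by exact: le_lt_trans r1.
  rewrite wlt /l -cintegralB//; [|exact: Q_cintegrable|exact: Q_cintegrable].
  apply: (@le_lt_trans _ _ (K * cabs (w - z))).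
    have -> : K * cabs (w - z) = (4 / (1 - r) ^+ 3 * cabs (w - z)) * fine (mu D).
      by rewrite /K; ring.
    apply: cabs_cintegral_cst => //.
      by apply: cintegrableB => //; exact: Q_cintegrable.
    move=> t _; have e1 := cabs_cis t; set u := cis t in e1 *.
    have uw : u - w != 0 by rewrite subr_eq0; apply: cabs_lt_neq; rewrite e1.
    have uz : u - z != 0 by rewrite subr_eq0; apply: cabs_lt_neq; rewrite e1.
    have -> : Q z w u - Q z z u = Q z w u * ((w - z) / (u - z)).
      by rewrite /Q; field; rewrite uw uz.
    have r0 : 0 < 1 - r by rewrite subr_gt0.
    have -> : 4 / (1 - r) ^+ 3 * cabs (w - z) =
        2 / (1 - r) ^+ 2 * (cabs (w - z) * (2 / (1 - r))).
      by field; rewrite gt_eqF.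
    rewrite (cabsM (Q z w u)) (cabsM (w - z)) cabsV; apply: ler_pM; rewrite ?cabs_ge0 ?mulr_ge0 ?invr_ge0 ?cabs_ge0//.
      exact: cabs_Q.
    rewrite ler_wpM2l ?cabs_ge0//.
    apply: (@le_trans _ _ (1 - r)^-1); last by rewrite ler_peMl ?invr_ge0 1?ltW//; lra.
    have h2 : 1 - r <= cabs (u - z).
      by apply: le_trans (cabs_triB _ _); rewrite e1 lerD2l lerN2.
    by rewrite lef_pV2 ?posrE// (lt_le_trans r0).
  have K1 : 0 < K + 1 by lra.
  rewrite ltr_pdivlMr// in w2; have := cabs_ge0 (w - z); nra.
- by rewrite z1.
- move=> w; case: ifPn => [w1|w1]; first exact: HE.
  rewrite divfK// subr_eq0; apply: contraNneq w1 => ->; exact: z1.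
Qed.

End HerglotzIntegral.

(** * Near-extremal functions in the Schwarz-Pick inequality *)

Section UniformApproximation.
Variable R : realType.
Local Notation C := R[i].
Local Notation CD := {family @disc_compact R, C -> C}.

Lemma entourage_cabs (e : R) : 0 < e ->
  entourage [set xy : C * C | cabs (xy.1 - xy.2) < e].
Proof.
move=> e0; have e0' : 0 < e%:C%C :> C by rewrite ltcR.
have := @entourage_ball C C (PosNum e0').
by apply: filterS => -[x y]; rewrite /ball /= normCE ltcR.
Qed.

Lemma circle_compact (r : R) : 0 <= r -> compact [set z : C | cabs z = r].
Proof.
move=> r0.
have -> : [set z : C | cabs z = r] = (fun t => r%:C%C * cis t) @` `[0, 2 * pi]%classic.
  apply/seteqP; split => z /=.
    move=> zr; have [t /andP[t0 t1] zt] := polar z; exists t.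
      by rewrite in_itv /= t0 ltW.
    by rewrite zt zr.
  by move=> [t _ <-]; rewrite cabs_circle.
apply: continuous_compact; last exact: segment_compact.
apply: continuous_subspaceT => t.
apply/(@cvgCP _ _ _ (nbhs_filter t)) => e e0.
have [d d0 hd] := @cis_cont0 R (e / (r + 1)) (divr_gt0 e0 (ltr_wpDl r0 ltr01)).
apply/nbhs_ballP; exists d => // s; rewrite /ball /= distrC => /hd.
rewrite ltr_pdivlMr ?ltr_wpDl// -mulrBr cabsM cabs_pos// => h.
by have := cabs_ge0 (cis s - cis t); nra.
Qed.

Lemma universal_approx (phi1 phi2 : nat -> C -> C) (f g1 g2 : C -> C) (K : set C) :
  @disjointly_universal R phi1 phi2 f -> classS g1 -> classS g2 ->
  disc_compact K -> forall e : R, 0 < e -> exists n, forall z, K z ->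
    cabs (f (phi1 n z) - g1 z) < e /\ cabs (f (phi2 n z) - g2 z) < e.
Proof.
move=> [_ hf] h1 h2 hK e e0.
pose E := [set xy : C * C | cabs (xy.1 - xy.2) < e].
have entE : entourage E by exact: entourage_cabs.
have n1 := @fam_nbhs C C (@disc_compact R) K E (g1 : CD) entE hK.
have n2 := @fam_nbhs C C (@disc_compact R) K E (g2 : CD) entE hK.
have [[k1 k2] [[n /= [-> ->]] [m1 m2]]] := hf (g1, g2) (conj h1 h2) _ (ex_intro2 _ _ (_, _) (conj n1 n2) (@subset_refl _ _)).
exists n => z zK; rewrite cabsC (cabsC (f (phi2 n z))).
by split; [exact: m1|exact: m2].
Qed.

End UniformApproximation.

Section Necessity.
Variable R : realType.
Local Notation C := R[i].
Implicit Types (z w : C) (c e eta u r : R) (n k : nat).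

(** Cauchy's estimate at the origin, read off from the mean of the difference
    quotient. *)
Lemma cauchy_estimate (h : C -> C) (l : C) (e : R) :
  (forall z, disc z -> exists m, cderiv h z m) -> cderiv h 0 l ->
  (forall z, z = 0 \/ cabs z = 1 / 2 -> cabs (h z) <= e) -> cabs l <= 4 * e.
Proof.
move=> hh [psi [pl p0 hpsi]] he.
have pE z : z != 0 -> psi z = (h z - h 0) / z.
  by move=> z0; rewrite hpsi subr0 mulfK.
have ph : hol_on psi [set z | 0 < cabs z < 1].
  move=> z /= /andP[z0 z1]; have [m hm] := hh z ((discE z).2 z1).
  rewrite cabs_gt0 in z0.
  have k := cderiv_div z0 (cderivB hm (cderiv_cst (h 0) z)) (cderiv_id z).
  eexists; apply: cderiv_near k; exists (cabs z); first by rewrite cabs_gt0.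
  move=> w wz /=; rewrite pE//; apply: contraTneq wz => ->.
  by rewrite sub0r cabsN ltxx.
have half : 0 < (1 / 2 : R) < 1 by apply/andP; split; lra.
have := @mean_center _ psi 1 (1 / 2); rewrite p0 => /(_ pl ph half) hm.
have two0 : 0 <= 1 / 2 :> R by lra.
have := @seg_integral_near_cst R 0 (2 * pi) (fun t => psi ((1 / 2)%:C%C * cis t)) 0 (4 * e).
rewrite -/(mean psi (1 / 2)) hm mulr0 !subr0 cabsM cabs_pos; last exact/ltW/twopi_gt0.
rewrite (mulrC (2 * pi) (cabs l)) ler_pM2r ?twopi_gt0//; apply.
- exact/ltW/twopi_gt0.
- apply: seg_continuous_circle => // w wr; have [|m hm'] := ph w.
    by rewrite /= wr.
  exact: cderiv_cont hm'.
- move=> t _; rewrite subr0; set w := _ * cis t.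
  have w1 : cabs w = 1 / 2 by rewrite cabs_circle.
  have w0 : w != 0 by rewrite -cabs_gt0 w1; lra.
  rewrite pE// cabsM cabsV w1; have := cabsD (h w) (- h 0); rewrite cabsN.
  have := he w (or_intror w1); have := he 0 (or_introl erefl).
  by rewrite ler_pdivrMr ?divr_gt0//; lra.
Qed.

(** The inner function of a mass [c] at the point 1.  It attains equality in
    |g'(0)| <= - 2 |g(0)| log |g(0)|, the Schwarz-Pick inequality for zero-free
    functions. *)
Definition extremal c z : C := cexp (- (c%:C%C * hkernel z 1)).

Lemma cderiv_hkernel1 z : cabs z < 1 ->
  cderiv (fun w => hkernel w 1) z (2 / (1 - z) ^+ 2).
Proof.
move=> z1; have d0 : 1 - z != 0.
  by rewrite subr_eq0; apply: cabs_lt_neq; rewrite cabs1.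
have h := @cderiv_div _ (fun z => 1 + z) (fun z => 1 - z) z _ _ d0
  (cderivD (cderiv_cst 1 z) (cderiv_id z)) (cderivB (cderiv_cst 1 z) (cderiv_id z)).
suff <- : ((0 + 1) * (1 - z) - (1 + z) * (0 - 1)) / (1 - z) ^+ 2 = 2 / (1 - z) ^+ 2 by [].
by congr (_ / _); ring.
Qed.

Lemma cderiv_extremal c z : cabs z < 1 ->
  cderiv (extremal c) z (extremal c z * - (c%:C%C * (2 / (1 - z) ^+ 2))).
Proof.
move=> z1; have h := cderivN (cderivM (cderiv_cst c%:C%C z) (cderiv_hkernel1 z1)).
have := cderiv_comp h (cderiv_cexp _).
by rewrite mul0r add0r.
Qed.

Lemma extremal_classS c : 0 <= c -> @classS R (extremal c).
Proof.
move=> c0; split.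
  by move=> z /discE z1; have [] := cderiv_derivable (cderiv_extremal c z1).
left => z /discE z1; rewrite normCE ltcR -[X in _ <= X]/((1 : R)%:C%C) lecR.
rewrite cabs_gt0 cexp_neq0 cabs_cexp expR_le1 ReN oppr_le0 ReZ mulr_ge0//.
by rewrite Re_hkernel_ge0// cabs1 ltW.
Qed.

Lemma extremal0 c : extremal c 0 = (expR (- c))%:C%C.
Proof.
rewrite /extremal hkernel0 ?oner_neq0// mulr1 -rmorphN cexpE /=.
by rewrite cis0 mulr1.
Qed.

(** If [exp (- H o phi)] is close to the extremal function of parameter [c], then
    [Re H] is close to [c] at [phi 0], and [phi] nearly attains equality in the
    Schwarz-Pick lemma at the origin, because
    |(exp (- H))'| (1 - |z|^2) <= 2 u e^-u with u = Re H. *)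
Section OneMap.
Variable mu : {finite_measure set (measurableTypeR R) -> \bar R}.
Variables (phi : C -> C) (l : C).
Hypothesis ph : forall z, disc z -> exists m, cderiv phi z m.
Hypothesis pd : forall z, disc z -> disc (phi z).
Hypothesis pl : cderiv phi 0 l.
Local Notation H := (herglotz_integral mu).
Let D := cabs l / (1 - cabs (phi 0) ^+ 2).
Let u := complex.Re (H (phi 0)).

Lemma near_extremal c e : 0 < c ->
  (forall z, z = 0 \/ cabs z = 1 / 2 -> cabs (cexp (- H (phi z)) - extremal c z) < e) ->
  `|expR (- u) - expR (- c)| <= e /\
  2 * c * expR (- c) <= 2 * u * expR (- u) * D + 4 * e.
Proof.
move=> c0 he.
have p1 z : disc z -> cabs (phi z) < 1 by move=> /pd/discE.
have d0 := disc0 R.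
split.
  have := ltW (he 0 (or_introl erefl)); apply: le_trans.
  have -> : expR (- c) = cabs (extremal c 0) by rewrite extremal0 cabs_pos ?expR_ge0.
  have -> : expR (- u) = cabs (cexp (- H (phi 0))) by rewrite cabs_cexp ReN.
  rewrite ler_norml cabs_triB andbT lerNl opprB.
  by rewrite (cabsC (cexp _)) cabs_triB.
have ext0 : cabs (extremal c 0 * - (c%:C%C * (2 / (1 - 0) ^+ 2))) = 2 * c * expR (- c).
  rewrite subr0 expr1n divr1 cabsM cabsN cabsM cabs_nat extremal0 !cabs_pos ?expR_ge0 1?ltW//.
  by ring.
have [m mh mb] := cderiv_herglotz mu (p1 0 d0).
pose h z := cexp (- H (phi z)) - extremal c z.
have hd : cderiv h 0 (cexp (- H (phi 0)) * - (m * l) - extremal c 0 * - (c%:C%C * (2 / (1 - 0) ^+ 2))).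
  apply: cderivB; last by apply: cderiv_extremal; rewrite cabs0.
  have := cderiv_comp (cderivN (cderiv_comp pl mh)) (cderiv_cexp _).
  exact.
have hh z : disc z -> exists m, cderiv h z m.
  move=> zd; have /discE z1 := zd; have [l' hl'] := ph zd.
  have [m' mh' _] := cderiv_herglotz mu (p1 z zd).
  eexists; apply: cderivB; last exact: cderiv_extremal.
  exact: cderiv_comp (cderivN (cderiv_comp hl' mh')) (cderiv_cexp _).
have := cauchy_estimate hh hd (fun z hz => ltW (he z hz)).
set A := cexp _ * _; set B := _ * - _ => hAB.
have : cabs B <= cabs A + 4 * e.
  have := cabs_triB B A; rewrite cabsC; lra.
rewrite ext0 => /le_trans; apply; rewrite lerD2r /A cabsM cabs_cexp ReN -/u cabsN cabsM.
have s0 : 0 < 1 - cabs (phi 0) ^+ 2 by apply: cabs2_lt1; exact: p1.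
have -> : 2 * u * expR (- u) * D = expR (- u) * (2 * u * D) by ring.
rewrite ler_pM2l ?expR_gt0//.
rewrite /D mulrA ler_pdivlMr// mulrAC ler_wpM2r ?cabs_ge0//.
Qed.

Lemma schwarz_pick_ratio_le1 : D <= 1.
Proof.
have := schwarz_pick_deriv ph pd pl; rewrite /D ler_pdivrMr ?mul1r//.
by apply/cabs2_lt1/discE/pd/disc0.
Qed.

End OneMap.

(** The real-variable part: a quantitative inverse of [u |-> u e^-u]. *)
Lemma near_extremal_eps c eta : 0 < c -> 0 < eta -> eta <= 1 ->
  exists2 e, 0 < e & forall u D, 0 <= D <= 1 -> 0 <= u ->
    `|expR (- u) - expR (- c)| <= e ->
    2 * c * expR (- c) <= 2 * u * expR (- u) * D + 4 * e ->
    1 - eta <= D /\ `|u - c| <= c / 4.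
Proof.
move=> c0 eta0 eta1; set x0 := expR (- c).
have x00 : 0 < x0 by exact: expR_gt0.
have x01 : x0 <= 1 by rewrite expR_le1 oppr_le0 ltW.
pose eta' := eta * c * x0 / 4.
have e'0 : 0 < eta' by rewrite !mulr_gt0// invr_gt0.
have /cvgrPdist_lt /(_ _ e'0) /nbhs_ballP[d /= d0 hd] := @continuous_ln R x0 x00.
pose e := Num.min (d / 2) (Num.min 1 (eta * c * x0 / (2 * c + 4))).
have den : 0 < 2 * c + 4 by lra.
have e0 : 0 < e by rewrite !lt_min divr_gt0//= ltr01 divr_gt0// !mulr_gt0.
have e1 : e <= d / 2 by rewrite ge_min lexx.
have e2 : e <= 1 by rewrite !ge_min lexx orbT.
have e3 : e * (2 * c + 4) <= eta * c * x0.
  by rewrite -ler_pdivlMr// !ge_min lexx !orbT.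
exists e => // u D /andP[D0 D1] u0 h1 h2.
have h3 : `|u - c| < eta'.
  have := hd (expR (- u)); rewrite /ball /= distrC => /(_ (le_lt_trans h1 _)).
  by rewrite !expRK opprK addrC; apply; lra.
have ex1 : eta * c * x0 <= c.
  have h5 : eta * c <= c by rewrite ler_piMl// ltW.
  have h6 : 0 < eta * c by rewrite mulr_gt0.
  by apply: le_trans h5; rewrite ler_piMr// ltW.
split; last by apply: le_trans (ltW h3) _; rewrite /eta'; lra.
move: h3; rewrite ltr_norml => /andP[h3 h4].
move: h1; rewrite ler_norml => /andP[h1 h1'].
set x := expR (- u) in h1 h1' h2.
have x_gt0 : 0 < x by exact: expR_gt0.
have k1 : u * x <= (c + eta') * (x0 + e).
  by apply: ler_pM => //; [exact: ltW|lra|lra].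
have k2 : u * x * D <= (c + eta') * (x0 + e) * D by rewrite ler_wpM2r.
have k3 : (c + eta') * (x0 + e) * D <= c * x0 * D + (2 * eta' + c * e).
  have -> : (c + eta') * (x0 + e) * D = c * x0 * D + (eta' * (x0 + e) + c * e) * D by ring.
  rewrite lerD2l; apply: (@le_trans _ _ (eta' * (x0 + e) + c * e)).
    rewrite ler_piMr// addr_ge0// mulr_ge0// ?ltW//; lra.
  by rewrite lerD2r mulrC ler_pM2r//; lra.
have k4 : c * x0 * (1 - D) <= c * x0 * eta.
  have : 4 * eta' = eta * c * x0 by rewrite /eta'; field.
  by nra.
by rewrite ler_pM2l ?mulr_gt0// in k4; lra.
Qed.

End Necessity.

(** * Necessity *)

Section Quotients.
Variable R : realType.
Local Notation C := R[i].

(** The ratio of the Schwarz-Pick inequality at the origin. *)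
Definition pick_ratio (phi : C -> C) : R :=
  cabs (derive1 phi 0) / (1 - cabs (phi 0) ^+ 2).

Lemma self_map_cderiv (phi : C -> C) : holomorphic_self_map phi ->
  [/\ forall z, disc z -> exists m, cderiv phi z m,
      forall z, disc z -> disc (phi z) & cderiv phi 0 (derive1 phi 0)].
Proof.
move=> [h1 h2]; split => //; last exact/cderivP/h1/disc0.
by move=> z /h1 /cderivP hz; exists (derive1 phi z).
Qed.

Lemma pick_ratio_le1 (phi : C -> C) : holomorphic_self_map phi -> pick_ratio phi <= 1.
Proof. by move=> /self_map_cderiv [h1 h2 h3]; exact: schwarz_pick_ratio_le1 h1 h2 h3. Qed.

Lemma pick_ratio_ge0 (phi : C -> C) : holomorphic_self_map phi -> 0 <= pick_ratio phi.
Proof.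
move=> /self_map_cderiv [h1 h2 h3]; rewrite divr_ge0 ?cabs_ge0//.
by apply/ltW/cabs2_lt1/discE/h2/disc0.
Qed.

Lemma pick_ratioE (phi : C -> C) :
  `|derive1 phi 0| / (1 - `|phi 0| ^+ 2) = (pick_ratio phi)%:C%C.
Proof. by rewrite !normCE -rmorphXn -(rmorph1 (real_complex R)) -rmorphB -fmorphV -rmorphM. Qed.

Lemma pseudo_hyperbolicE (z w : C) : pseudo_hyperbolic z w = (pseudo z w)%:C%C.
Proof. exact: normCE. Qed.

Lemma cvg_to1P (x : nat -> R) :
  ((x n)%:C%C @[n --> \oo] --> (1 : C)) <->
  (forall e, 0 < e -> exists N, forall n, (N <= n)%N -> `|x n - 1| < e).
Proof.
have E n : cabs ((x n)%:C%C - 1) = `|x n - 1|.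
  by rewrite -(rmorph1 (real_complex R)) -rmorphB cabs_real.
split.
  move=> /(@cvgCP _ _ _ (@eventually_filter)) h e /h [N _ hN].
  by exists N => n /hN; rewrite /= E.
move=> h; apply/(@cvgCP _ _ _ (@eventually_filter)) => e /h [N hN].
by exists N => // n /hN /=; rewrite E.
Qed.

End Quotients.

Section NecessityConclusion.
Variable R : realType.
Local Notation C := R[i].
Variables (phi1 phi2 : nat -> C -> C).
Hypothesis hphi1 : forall n, holomorphic_self_map (phi1 n).
Hypothesis hphi2 : forall n, holomorphic_self_map (phi2 n).

Let rho n := pseudo (phi1 n 0) (phi2 n 0).

Lemma rho_lt1 n : rho n < 1.
Proof.
have [_ h1] := hphi1 n; have [_ h2] := hphi2 n.
by apply: pseudo_lt1; apply/discE; [apply: h1|apply: h2]; exact: disc0.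
Qed.

(** Testing universality on [extremal c] with a large [c] for the first map and a
    small one for the second forces both derivatives to be nearly extremal, while [Re H] takes very different values
    at the two centres, which Harnack's inequality only allows for distant
    points. *)
Lemma universal_good_index (f : C -> C) (eta : R) :
  singular_inner f -> @disjointly_universal R phi1 phi2 f -> 0 < eta -> eta <= 1 ->
  exists n, [/\ 1 - eta <= pick_ratio (phi1 n), 1 - eta <= pick_ratio (phi2 n) &
    1 - eta <= rho n].
Proof.
move=> [mu [_ fE]] funi eta0 eta1.
pose c1 := 4 / eta; pose c2 := eta / 4.
have c10 : 0 < c1 by rewrite divr_gt0.
have c20 : 0 < c2 by rewrite divr_gt0.
have [e1 e10 he1] := near_extremal_eps c10 eta0 eta1.
have [e2 e20 he2] := near_extremal_eps c20 eta0 eta1.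
pose e := Num.min e1 e2; have e0 : 0 < e by rewrite lt_min e10.
have ee1 : e <= e1 by rewrite ge_min lexx.
have ee2 : e <= e2 by rewrite ge_min lexx orbT.
pose K : set C := [set 0] `|` [set z | cabs z = 1 / 2].
have Kd z : K z -> disc z.
  by move=> [->|zr]; [exact: disc0|apply/discE; rewrite zr; lra].
have hK : disc_compact K.
  split; last exact: Kd.
  by apply: compactU; [exact: compact_set1|apply: circle_compact; lra].
have [n hn] := universal_approx funi (extremal_classS (ltW c10))
  (extremal_classS (ltW c20)) hK e0.
have [ph1 pd1 pl1] := self_map_cderiv (hphi1 n).
have [ph2 pd2 pl2] := self_map_cderiv (hphi2 n).
have n1 z : z = 0 \/ cabs z = 1 / 2 ->
    cabs (cexp (- herglotz_integral mu (phi1 n z)) - extremal c1 z) < e1.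
  move=> zK; rewrite -fE; last exact/pd1/Kd.
  by have [h _] := hn z zK; exact: lt_le_trans ee1.
have n2 z : z = 0 \/ cabs z = 1 / 2 ->
    cabs (cexp (- herglotz_integral mu (phi2 n z)) - extremal c2 z) < e2.
  move=> zK; rewrite -fE; last exact/pd2/Kd.
  by have [_ h] := hn z zK; exact: lt_le_trans ee2.
have a1 : cabs (phi1 n 0) < 1 by apply/discE/pd1/disc0.
have b1 : cabs (phi2 n 0) < 1 by apply/discE/pd2/disc0.
have [k1 k2] := near_extremal ph1 pd1 pl1 c10 n1.
have [m1 m2] := near_extremal ph2 pd2 pl2 c20 n2.
have u10 := Re_herglotz_ge0 mu a1; have u20 := Re_herglotz_ge0 mu b1.
have D1 : 0 <= pick_ratio (phi1 n) <= 1 by rewrite pick_ratio_ge0// pick_ratio_le1.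
have D2 : 0 <= pick_ratio (phi2 n) <= 1 by rewrite pick_ratio_ge0// pick_ratio_le1.
have [r1 v1] := he1 _ _ D1 u10 k1 k2; have [r2 v2] := he2 _ _ D2 u20 m1 m2.
exists n; split => //.
have := herglotz_harnack mu a1 b1; rewrite pseudoC -/(rho n).
have := rho_lt1 n; have : 0 <= rho n by exact: pseudo_ge0.
move: (rho n) => r r0 rlt.
set H1 := herglotz_integral mu (phi1 n 0) in u10 v1 *.
set H2 := herglotz_integral mu (phi2 n 0) in u20 v2 *.
have hRe : complex.Re H1 - complex.Re H2 <= cabs (H1 - H2).
  by rewrite -ReN -ReD cabs_Re.
move: (cabs _) hRe => d; move: (complex.Re H1) (complex.Re H2) u10 u20 v1 v2 => u1 u2.
move=> u10 u20; rewrite !ler_norml => /andP[v1 _] /andP[_ v2] hd.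
move=> /(le_trans hd); rewrite mulrAC ler_pdivlMr ?subr_gt0// => h.
clear - u10 u20 v1 v2 rlt r0 h c10 c20 eta0 eta1 c1 c2.
have h1 : u1 * (1 - r) <= 2 * u2.
  have h7 : r * u2 <= u2 by rewrite ler_piMl// ltW.
  have -> : u1 * (1 - r) = (u1 - u2) * (1 - r) + (u2 - r * u2) by ring.
  have h8 : 2 * r * u2 = r * u2 + r * u2 by ring.
  by rewrite h8 in h; lra.
have h2 : 3 / 4 * c1 <= u1 by lra.
have h3 : u2 <= 5 / 4 * c2 by lra.
have h4 : 3 / 4 * c1 * (1 - r) <= 5 / 2 * c2.
  apply: (@le_trans _ _ (u1 * (1 - r))); last by lra.
  by rewrite ler_wpM2r// subr_ge0 ltW.
have h5 : 3 * (1 - r) <= 5 / 8 * eta ^+ 2.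
  have -> : 3 * (1 - r) = eta * (3 / 4 * c1 * (1 - r)) by rewrite /c1; field; rewrite gt_eqF.
  have -> : 5 / 8 * eta ^+ 2 = eta * (5 / 2 * c2) by rewrite /c2; field.
  by rewrite ler_pM2l.
have h6 : eta ^+ 2 <= eta by rewrite expr2 ler_piMr// ltW.
lra.
Qed.

(** Finitely many pairs of points are never at distance 1; hence the good indices are
    unbounded. *)
Lemma rho_bounded_away N : exists2 d : R, 0 < d & forall n, (n <= N)%N -> d <= 1 - rho n.
Proof.
elim: N => [|N [d d0 hd]].
  exists (1 - rho 0%N); first by rewrite subr_gt0 rho_lt1.
  by move=> n; rewrite leqn0 => /eqP ->.
exists (Num.min d (1 - rho N.+1)); first by rewrite lt_min d0 subr_gt0 rho_lt1.
move=> n; rewrite leq_eqVlt => /orP[/eqP ->|]; first by rewrite ge_min lexx orbT.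
by rewrite ltnS => /hd h; rewrite ge_min h.
Qed.

Theorem universal_necessary (f : C -> C) :
  singular_inner f -> @disjointly_universal R phi1 phi2 f ->
  exists nk : nat -> nat,
     [/\ {homo nk : i j / (i < j)%N},
         `|derive1 (phi1 (nk k)) 0| / (1 - `|phi1 (nk k) 0| ^+ 2) @[k --> \oo]
           --> (1 : C),
         `|derive1 (phi2 (nk k)) 0| / (1 - `|phi2 (nk k) 0| ^+ 2) @[k --> \oo]
           --> (1 : C)
       & pseudo_hyperbolic (phi1 (nk k) 0) (phi2 (nk k) 0) @[k --> \oo]
           --> (1 : C)].
Proof.
move=> fi fu.
pose good k n := [/\ 1 - k.+1%:R^-1 <= pick_ratio (phi1 n),
  1 - k.+1%:R^-1 <= pick_ratio (phi2 n) & 1 - k.+1%:R^-1 <= rho n].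
(* good indices are arbitrarily large since no single [rho n] equals 1 *)
have step (kN : nat * nat) : exists n, (kN.2 < n)%N /\ good kN.1 n.
  case: kN => k N /=; have [d d0 hd] := rho_bounded_away N.
  pose eta := Num.min (d / 2) k.+1%:R^-1.
  have k0 : 0 < k.+1%:R^-1 :> R by rewrite invr_gt0.
  have eta0 : 0 < eta by rewrite lt_min divr_gt0.
  have etak : eta <= k.+1%:R^-1 by rewrite ge_min lexx orbT.
  have etad : eta <= d / 2 by rewrite ge_min lexx.
  have eta1 : eta <= 1 by apply: le_trans etak _; rewrite invf_le1// ler1n.
  have [n [g1 g2 g3]] := universal_good_index fi fu eta0 eta1.
  exists n; split.
    by rewrite ltnNge; apply/negP => /hd h; lra.
  rewrite /good; move: (_^-1) etak => i etak.
  by split; [apply: le_trans g1|apply: le_trans g2|apply: le_trans g3]; rewrite lerD2l lerN2.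
have [g hg] := choice step.
pose nk := fix nk k := if k is j.+1 then g (j.+1, nk j) else g (0%N, 0%N).
have nkS k : (nk k < nk k.+1)%N by have [] := hg (k.+1, nk k).
have nkg k : good k (nk k) by case: k => [|k]; [have [] := hg (0%N, 0%N)|have [] := hg (k.+1, nk k)].
have lim (x : nat -> R) : (forall k, 1 - k.+1%:R^-1 <= x (nk k) <= 1) ->
    (x (nk k))%:C%C @[k --> \oo] --> (1 : C).
  move=> hx; apply/(@cvg_to1P R (x \o nk)) => e e0.
  have [N hN] : exists N : nat, e^-1 < N%:R.
    by exists (Num.bound e^-1); apply: archi_boundP; rewrite invr_ge0 ltW.
  exists N => n Nn /=; have /andP[x1 x2] := hx n.
  rewrite ler0_norm ?subr_le0// opprB.
  have n0 : 0 < n.+1%:R :> R by [].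
  have h1 : n.+1%:R^-1 < e.
    rewrite -[e]invrK ltf_pV2 ?posrE ?invr_gt0//.
    by apply: (lt_le_trans hN); rewrite ler_nat; exact: leqW.
  by move: (n.+1%:R^-1) h1 x1 => i h1 x1; lra.
exists nk; split.
- exact: (homo_ltn ltn_trans nkS).
- under eq_fun do rewrite pick_ratioE.
  by apply: (lim (fun n => pick_ratio (phi1 n))) => k; have [-> _ _] := nkg k; rewrite pick_ratio_le1.
- under eq_fun do rewrite pick_ratioE.
  by apply: (lim (fun n => pick_ratio (phi2 n))) => k; have [_ -> _] := nkg k; rewrite pick_ratio_le1.
- under eq_fun do rewrite pseudo_hyperbolicE.
  by apply: (lim rho) => k; have [_ _ ->] := nkg k; rewrite ltW// rho_lt1.
Qed.

End NecessityConclusion.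

(** * Logarithms of bounded zero-free functions *)

Section Logarithm.
Variable R : realType.
Local Notation C := R[i].
Implicit Types (z w : C) (e r x : R) (g : C -> C).

(** Principal logarithm, on the right half-plane. *)
Definition clog w : C := (ln (cabs w) +i* atan (complex.Im w / complex.Re w))%C.

Lemma clogK w : 0 < complex.Re w -> cexp (clog w) = w.
Proof.
move=> w0; rewrite cexpE /=.
have c0 : 0 < cabs w by exact: lt_le_trans (cabs_Re w).
rewrite lnK ?posrE//; case: w w0 c0 => x y /= x0; set r := cabs _ => r0.
have rE : r ^+ 2 = x ^+ 2 + y ^+ 2 by rewrite cabs_sqr.
have s : Num.sqrt (1 + (y / x) ^+ 2) = r / x.
  have -> : 1 + (y / x) ^+ 2 = (r / x) ^+ 2.
    by rewrite [RHS]expr_div_n rE; field; rewrite gt_eqF.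
  by rewrite sqrtr_sqr ger0_norm// divr_ge0// ltW.
have ca : cos (atan (y / x)) = x / r by rewrite cos_atan s invf_div.
have ca0 : cos (atan (y / x)) != 0 by rewrite ca mulf_neq0 ?invr_eq0 ?gt_eqF.
have sa : sin (atan (y / x)) = y / r.
  have h : sin (atan (y / x)) / cos (atan (y / x)) = y / x by exact: (atanK (y / x)).
  have -> : sin (atan (y / x)) = y / x * cos (atan (y / x)) by apply/esym; rewrite -[X in X * _]h divfK.
  by rewrite ca; field; rewrite !gt_eqF.
rewrite /cis ca sa; apply: complex_ext; rewrite ?ReZ ?ImZ /=.
  by field; rewrite gt_eqF.
by field; rewrite gt_eqF.
Qed.

Lemma tends_clog w : 0 < complex.Re w -> tends (cnbhs w) clog (clog w).
Proof.
move=> w0 e e0; have c0 : 0 < cabs w by exact: lt_le_trans (cabs_Re w).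
have e20 : 0 < e / 2 by rewrite divr_gt0.
have /cvgrPdist_lt /(_ _ e20) /nbhs_ballP[d1 /= d10 hd1] := continuous_ln c0.
have /cvgrPdist_lt /(_ _ e20) /nbhs_ballP[d2 /= d20 hd2] :=
  @continuous_atan R (complex.Im w / complex.Re w).
have tR : tends (cnbhs w) (fun u => (complex.Re u)%:C%C) (complex.Re w)%:C%C.
  move=> e' e'0; exists e' => // u; apply: le_lt_trans.
  by rewrite -rmorphB /= cabs_real -ReN -ReD Re_le_cabs.
have tI : tends (cnbhs w) (fun u => (complex.Im u)%:C%C) (complex.Im w)%:C%C.
  move=> e' e'0; exists e' => // u; apply: le_lt_trans.
  by rewrite -rmorphB /= cabs_real -ImN -ImD Im_le_cabs.
have w0' : (complex.Re w)%:C%C != 0 :> C.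
  by apply/eqP => /complexI /eqP; rewrite gt_eqF.
have [d3 d30 hd3] := tendsM tI (tendsV w0' tR) d20.
exists (Num.min d1 d3); first by rewrite lt_min d10.
move=> u; rewrite lt_min => /andP[u1 u3] /=.
apply: le_lt_trans (cabs_le_ReIm _) _; rewrite ReD ImD ReN ImN /= [ltRHS]splitr.
apply: ltrD; rewrite distrC.
  apply: hd1; rewrite /ball /=; apply: le_lt_trans u1.
  by rewrite ler_norml (cabsC u) cabs_triB andbT lerNl opprB cabsC cabs_triB.
apply: hd2; rewrite /ball /= distrC; apply: le_lt_trans (hd3 _ u3).
by rewrite -!fmorphV -!rmorphM -rmorphB /= cabs_real.
Qed.

Lemma cderiv_clog w : 0 < complex.Re w -> exists l, cderiv clog w l.
Proof.
move=> w0; exists (cexp (clog w))^-1.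
apply: (@cderiv_inverse _ (@cexp R)); last exact: cderiv_cexp.
- exact: tends_clog.
- exists (complex.Re w) => // u uw /=; apply: clogK.
  have := le_lt_trans (Re_le_cabs _) uw; rewrite ReD ReN ltr_norml => /andP[h _].
  by lra.
- exact: cexp_neq0.
Qed.

Lemma cabs_clog w : cabs (w - 1) <= 1 / 2 ->
  0 < complex.Re w /\ cabs (clog w) <= 3.
Proof.
move=> w1; have h0 := le_trans (Re_le_cabs _) w1.
rewrite ReD ReN /= ler_norml in h0; case/andP: h0 => h0 _.
split; first by lra.
have c1 : 1 / 2 <= cabs w.
  have e : 1 - (1 - w) = w by ring.
  by have := cabs_triB 1 (1 - w); rewrite e cabs1 (cabsC 1); lra.
have c2 : cabs w <= 3 / 2 by have := cabs_triB w 1; rewrite cabs1; lra.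
apply: le_trans (cabs_le_ReIm _) _ => /=; have -> : 3 = 1 + 2 :> R by ring.
have c0 : 0 < cabs w by lra.
apply: lerD.
  have lnle x : 0 < x -> ln x <= x - 1.
    by move=> x0; have := expR_ge1Dx (ln x); rewrite lnK ?posrE//; lra.
  rewrite ler_norml; apply/andP; split; last by have := lnle _ c0; lra.
  have := lnle (cabs w)^-1; rewrite invr_gt0 lnV ?posrE// => /(_ c0).
  have : (cabs w)^-1 <= 2 by rewrite invf_ple ?posrE//; lra.
  by lra.
have := atan_gtNpi2 (complex.Im w / complex.Re w).
have := atan_ltpi2 (complex.Im w / complex.Re w).
have := pihalf_lt2 R; rewrite ler_norml => h1 h2 h3.
by apply/andP; split; lra.
Qed.

Lemma clog_exists z : z != 0 -> exists w, cexp w = z.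
Proof.
move=> z0; have [t _ zt] := polar z; exists (ln (cabs z) +i* t)%C.
by rewrite cexpE /= lnK ?posrE ?cabs_gt0// -zt.
Qed.

(** Bounded holomorphic functions are uniformly continuous for the
    pseudo-hyperbolic distance: Harnack applied to [1 + g] after recentring. *)
Lemma bounded_harnack g z w :
  (forall u, disc u -> exists m, cderiv g u m) -> (forall u, disc u -> cabs (g u) <= 1) ->
  disc z -> disc w -> cabs (g w - g z) <= 4 * pseudo z w / (1 - pseudo z w).
Proof.
move=> gh g1 zd wd; have /discE z1 := zd; have /discE w1 := wd.
pose v := moebius (- z) w.
have v1 : cabs v < 1 by apply: moebius_disc; rewrite ?cabsN.
have md u : disc u -> disc (moebius z u).
  by move=> /discE u1; apply/discE/moebius_disc.
pose h u := 1 + g (moebius z u).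
have hh u : disc u -> exists m, cderiv h u m.
  move=> ud; have /discE u1 := ud; have [m hm] := gh _ (md u ud).
  eexists; apply: cderivD; first exact: cderiv_cst.
  by apply: cderiv_comp hm; apply: cderiv_moebius => //; exact: ltW.
have hR u : disc u -> 0 <= complex.Re (h u).
  move=> ud; rewrite ReD /=; have := le_trans (Re_le_cabs _) (g1 _ (md u ud)).
  by rewrite ler_norml => /andP[]; lra.
have := @harnack _ h 2 _ _ v _ hR.
have hb u : disc u -> tends (cnbhs u) h (h u) /\ cabs (h u) <= 2.
  move=> ud; have [m hm] := hh u ud; split; first exact: cderiv_cont hm.
  apply: le_trans (cabsD _ _) _; rewrite cabs1 -[leRHS]/(1 + 1) lerD2l.
  exact/g1/md.
have hol : hol_on h [set u | disc u /\ u != 0] by move=> u [ud _]; exact: hh.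
move=> /(_ hb hol) => /(_ ((discE _).2 v1)).
have -> : h v - h 0 = g w - g z.
  rewrite /h moebius0 -[X in moebius X v]opprK moebiusK ?cabsN ?ltW//; ring.
move=> /le_trans; apply; rewrite pseudoE -/v.
have Rh0 : complex.Re (h 0) <= 2.
  by apply: le_trans (cabs_Re _) _; exact: (hb 0 (disc0 R)).2.
have q0 : 0 <= 2 * cabs v / (1 - cabs v).
  by rewrite divr_ge0 ?mulr_ge0 ?cabs_ge0// subr_ge0 ltW.
apply: le_trans (ler_wpM2l q0 Rh0) _.
by rewrite le_eqVlt; apply/orP; left; apply/eqP; ring.
Qed.

Lemma pseudo_le z w r : cabs z <= r -> cabs w <= r -> r < 1 ->
  pseudo z w <= cabs (w - z) / (1 - r ^+ 2).
Proof.
move=> zr wr r1; have r0 : 0 <= r := le_trans (cabs_ge0 z) zr.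
have s0 : 0 < 1 - r ^+ 2 by rewrite subr_gt0 exprn_ilt1.
rewrite /pseudo cabsM cabsC cabsV ler_wpM2l ?cabs_ge0//.
have h : 1 - r ^+ 2 <= cabs (1 - (z^*)%C * w).
  apply: le_trans (cabs_triB _ _); rewrite cabs1 lerD2l lerN2 cabsM cabs_conj expr2.
  by apply: ler_pM; rewrite ?cabs_ge0.
by rewrite lef_pV2 ?posrE// (lt_le_trans s0).
Qed.

Lemma bounded_uniform g r e : r < 1 -> 0 < e ->
  (forall u, disc u -> exists m, cderiv g u m) -> (forall u, disc u -> cabs (g u) <= 1) ->
  exists2 d : R, 0 < d & forall z w, cabs z <= r -> cabs w <= r -> cabs (w - z) < d ->
    cabs (g w - g z) < e.
Proof.
move=> r1 e0 gh g1; have [r0|r0] := ltP r 0.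
  by exists 1 => // z w zr; have := cabs_ge0 z; lra.
have s0 : 0 < 1 - r ^+ 2 by rewrite subr_gt0 exprn_ilt1.
pose x := Num.min (1 / 2) (e / 9).
have x0 : 0 < x by rewrite lt_min !divr_gt0.
have x1 : x <= 1 / 2 by rewrite ge_min lexx.
have x2 : x <= e / 9 by rewrite ge_min lexx orbT.
exists (x * (1 - r ^+ 2)); first by rewrite mulr_gt0.
move=> z w zr wr wz.
have zd : disc z by apply/discE; exact: le_lt_trans r1.
have wd : disc w by apply/discE; exact: le_lt_trans r1.
apply: le_lt_trans (bounded_harnack gh g1 zd wd) _.
have := pseudo_le zr wr r1; have := pseudo_ge0 z w; move: (pseudo z w) => p p0 hp.
have {hp} px : p < x by apply: le_lt_trans hp _; rewrite ltr_pdivrMr.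
rewrite ltr_pdivrMr; last by lra.
have : e / 2 <= e * (1 - p) by rewrite ler_pM2l//; lra.
by lra.
Qed.

Lemma closed_disc_compact r : 0 <= r -> compact [set z : C | cabs z <= r].
Proof.
move=> r0.
have -> : [set z : C | cabs z <= r] =
    (fun p : R * R => p.1%:C%C * cis p.2) @` (`[0, r]%classic `*` `[0, 2 * pi]%classic).
  apply/seteqP; split => z /=.
    move=> zr; have [t /andP[t0 t1] zt] := polar z; exists (cabs z, t) => //=.
    by rewrite !in_itv /= cabs_ge0 zr t0 ltW.
  move=> [[s t] /= [+ _] <-]; rewrite in_itv /= => /andP[s0 sr].
  by rewrite cabs_circle.
apply: continuous_compact; last by apply: compact_setX; exact: segment_compact.
apply: continuous_subspaceT => -[s t].
apply/(@cvgCP _ _ _ (nbhs_filter (s, t))) => e e0.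
have e20 : 0 < e / 2 by rewrite divr_gt0.
have [d d0 hd] := @cis_cont0 R (e / 2 / (`|s| + 1)) (divr_gt0 e20 (ltr_wpDl (normr_ge0 s) ltr01)).
apply/nbhs_ballP; exists (Num.min d (e / 2)); first by rewrite /= lt_min d0.
move=> [s' t'] [] /=; rewrite /ball /= !lt_min !(distrC s) !(distrC t).
move=> /andP[_ h1] /andP[h2 _].
have -> : s'%:C%C * cis t' - s%:C%C * cis t =
   (s' - s)%:C%C * cis t' + s%:C%C * (cis t' - cis t) by rewrite rmorphB /=; ring.
apply: le_lt_trans (cabsD _ _) _; rewrite !cabsM cabs_cis mulr1 !cabs_real.
rewrite [ltRHS]splitr; apply: ltr_leD => //.
have := hd _ _ h2; rewrite ltr_pdivlMr ?ltr_wpDl// => h3.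
apply: le_trans (ltW h3); rewrite mulrC ler_wpM2l ?cabs_ge0//; lra.
Qed.

Lemma zero_free_lower g r : 0 <= r -> r < 1 ->
  (forall u, disc u -> exists m, cderiv g u m) -> (forall u, disc u -> g u != 0) ->
  exists2 m : R, 0 < m & forall z, cabs z <= r -> m <= cabs (g z).
Proof.
move=> r0 r1 gh g0; pose K := [set z : C | cabs z <= r].
have Kd z : K z -> disc z by move=> zr; apply/discE; exact: le_lt_trans r1.
have : compact ((fun z => (cabs (g z))^-1) @` K).
  apply: continuous_compact; last exact: closed_disc_compact.
  apply: continuous_in_subspaceT => z /set_mem /Kd zd.
  have [m /cderiv_cont hm] := gh z zd; have hV := tendsV (g0 z zd) hm.
  move=> A /nbhs_ballP[e /= e0 hA]; have [d d0 hd] := hV _ e e0.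
  apply/nbhsCP; exists d => // w /hd /= h; apply: hA.
  rewrite /ball /= -!cabsV; apply: le_lt_trans h.
  by rewrite ler_norml (cabsC (g w)^-1) cabs_triB andbT lerNl opprB cabsC cabs_triB.
move=> /compact_bounded [M [_ hM]].
pose B := Num.max (M + 1) 1.
have B0 : 0 < B by rewrite lt_max ltr01 orbT.
exists B^-1; first by rewrite invr_gt0.
move=> z zr; have := hM B; rewrite lt_max ltrDl ltr01 => /(_ isT ((cabs (g z))^-1)).
move=> /(_ (ex_intro2 _ _ z zr erefl)) /= h.
have c0 : 0 < cabs (g z) by rewrite cabs_gt0 g0//; exact: Kd.
rewrite ger0_norm ?invr_ge0 ?cabs_ge0// in h.
by rewrite -[leRHS]invrK lef_pV2 ?posrE ?invr_gt0.
Qed.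

(** A logarithm of a zero-free bounded [g] on a smaller disc.  Along each radius
    it is a sum of principal logarithms of the ratios of consecutive values, all
    of which are close to 1 when the subdivision is fine. *)
Lemma holomorphic_log g r : 0 < r -> r < 1 ->
  (forall u, disc u -> exists m, cderiv g u m) ->
  (forall u, disc u -> g u != 0) -> (forall u, disc u -> cabs (g u) <= 1) ->
  exists p : C -> C, exists M : R,
    (forall z, disc z -> cexp (- p z) = g (r%:C%C * z)) /\
    (forall z, disc z -> exists m, cderiv p z m) /\
    (forall z, disc z -> cabs (p z) <= M).
Proof.
move=> r0 r1 gh g0 g1.
have [m m0 hm] := zero_free_lower (ltW r0) r1 gh g0.
have m20 : 0 < m / 2 by rewrite divr_gt0.
have [d d0 hd] := bounded_uniform r1 m20 gh g1.
pose N := (Num.bound d^-1).+1.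
have N0 : 0 < N%:R :> R by [].
have Nd : N%:R^-1 < d.
  rewrite -[d]invrK ltf_pV2 ?posrE ?invr_gt0//.
  apply: lt_le_trans (archi_boundP _) _; first by rewrite invr_ge0 ltW.
  by rewrite ler_nat leqnSn.
pose s k : R := r * (k%:R / N%:R).
have s0 k : 0 <= s k by rewrite mulr_ge0 ?divr_ge0// ltW.
have sr k : (k <= N)%N -> s k <= r.
  move=> kN; have h : k%:R / N%:R <= 1 :> R by rewrite ler_pdivrMr// mul1r ler_nat.
  by rewrite /s ler_piMr// ltW.
have sz k z : (k <= N)%N -> disc z -> cabs ((s k)%:C%C * z) <= r.
  move=> kN /discE z1; rewrite cabsM cabs_pos//.
  by apply: le_trans (sr _ kN); rewrite ler_piMr// ltW.
have sd k z : (k <= N)%N -> disc z -> disc ((s k)%:C%C * z).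
  by move=> kN zd; apply/discE; exact: le_lt_trans (sz _ _ kN zd) r1.
have [c0 hc0] := clog_exists (g0 _ (disc0 R)).
suff : forall k, (k <= N)%N -> exists p : C -> C,
    (forall z, disc z -> cexp (p z) = g ((s k)%:C%C * z)) /\
    (forall z, disc z -> exists m, cderiv p z m) /\
    (forall z, disc z -> cabs (p z) <= cabs c0 + 3 * k%:R).
  move=> /(_ N (leqnn _)) [p [p1 [p2 p3]]].
  exists (fun z => - p z), (cabs c0 + 3 * N%:R); split; [|split].
  - by move=> z zd; rewrite opprK p1// /s divff ?mulr1// gt_eqF.
  - by move=> z /p2[m' hm']; exists (- m'); exact: cderivN.
  - by move=> z zd; rewrite cabsN p3.
elim=> [_|k IH kN].
  exists (fun=> c0); split; [|split].
  - by move=> z zd; rewrite /s mul0r mulr0 mul0r.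
  - by move=> z _; exists 0; exact: cderiv_cst.
  - by move=> z _; rewrite mulr0 addr0.
have [p [p1 [p2 p3]]] := IH (ltnW kN).
pose q z := g ((s k.+1)%:C%C * z) / g ((s k)%:C%C * z).
have q1 z : disc z -> cabs (q z - 1) <= 1 / 2.
  move=> zd; have gk0 := g0 _ (sd _ _ (ltnW kN) zd).
  have -> : q z - 1 = (g ((s k.+1)%:C%C * z) - g ((s k)%:C%C * z)) / g ((s k)%:C%C * z).
    by rewrite /q; field.
  rewrite cabsM cabsV ler_pdivrMr ?cabs_gt0//.
  apply: (@le_trans _ _ (m / 2)).
    apply/ltW/hd; [exact/sz/zd/ltnW|exact: sz|].
    rewrite -mulrBl -rmorphB cabsM cabs_real.
    have -> : s k.+1 - s k = r * N%:R^-1.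
      by rewrite /s -(natr1 k); field; rewrite gt_eqF.
    rewrite ger0_norm ?mulr_ge0 ?invr_ge0 1?ltW//.
    have /discE z1 := zd; apply: le_lt_trans Nd.
    have i0 : 0 < N%:R^-1 :> R by rewrite invr_gt0.
    have h : r * N%:R^-1 <= N%:R^-1 by rewrite ler_piMl// ltW.
    by apply: le_trans h; rewrite ler_piMr ?mulr_ge0 ?ltW.
  have := hm _ (sz _ _ (ltnW kN) zd); lra.
exists (fun z => p z + clog (q z)); split; [|split].
- move=> z zd; rewrite cexpD p1// clogK; last by have [] := cabs_clog (q1 z zd).
  by rewrite /q mulrC divfK// g0//; exact: sd (ltnW kN) zd.
- move=> z zd; have [m1 hm1] := p2 z zd.
  have [Rq _] := cabs_clog (q1 z zd); have [m2 hm2] := cderiv_clog Rq.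
  have lin j : cderiv (fun z => (s j)%:C%C * z) z (0 * z + (s j)%:C%C * 1).
    by apply: cderivM; [exact: cderiv_cst|exact: cderiv_id].
  have [a ha] := gh _ (sd _ _ kN zd); have [b hb] := gh _ (sd _ _ (ltnW kN) zd).
  eexists; apply: cderivD; first exact: hm1.
  apply: cderiv_comp hm2; apply: cderiv_div; first exact: g0 (sd _ _ (ltnW kN) zd).
    exact: cderiv_comp (lin _) ha.
  exact: cderiv_comp (lin _) hb.
- move=> z zd; apply: le_trans (cabsD _ _) _.
  rewrite -(natr1 k) mulrDr mulr1 addrA; apply: lerD; first exact: p3.
  by have [] := cabs_clog (q1 z zd).
Qed.

End Logarithm.

(** * Density of finite atomic inner functions *)

Section AtomicSums.
Variable R : realType.
Local Notation C := R[i].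
Local Notation mu := (@lebesgue_measure R).
Implicit Types (z w zeta : C) (e r x : R) (g : C -> C) (L : seq (R * C)).

(** Finite atomic measures on the circle are lists of weighted points. *)
Definition hsum L z : C := \sum_(p <- L) p.1%:C%C * hkernel z p.2.

Definition mass L : R := \sum_(p <- L) p.1.

Definition circle_atoms L : Prop := forall p, p \in L -> 0 <= p.1 /\ cabs p.2 = 1.

Lemma hkernel_lip z zeta zeta' : cabs z < 1 -> cabs zeta = 1 -> cabs zeta' = 1 ->
  cabs (hkernel z zeta - hkernel z zeta') <= 2 / (1 - cabs z) ^+ 2 * cabs (zeta - zeta').
Proof.
move=> z1 e1 e1'.
have h1 : zeta != z by apply: cabs_lt_neq; rewrite e1.
have h2 : zeta' != z by apply: cabs_lt_neq; rewrite e1'.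
have -> : hkernel z zeta - hkernel z zeta' =
    2 * z * (zeta' - zeta) / ((zeta - z) * (zeta' - z)).
  by rewrite /hkernel; field; rewrite !subr_eq0 h1 h2.
rewrite !cabsM cabsV cabsM cabs_nat (cabsC zeta').
have d1 : 1 - cabs z <= cabs (zeta - z) by rewrite -e1 cabs_triB.
have d2 : 1 - cabs z <= cabs (zeta' - z) by rewrite -e1' cabs_triB.
have s0 : 0 < 1 - cabs z by rewrite subr_gt0.
rewrite mulrAC ler_wpM2r ?cabs_ge0//; apply: ler_pM; rewrite ?invr_ge0 ?mulr_ge0 ?cabs_ge0//.
  by rewrite ler_piMr// ltW.
rewrite lef_pV2 ?posrE ?mulr_gt0 ?exprn_gt0//; last 2 first.
  exact: lt_le_trans d1.
  exact: lt_le_trans d2.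
by rewrite expr2; apply: ler_pM => //; exact: ltW.
Qed.

Section Arcs.
Variables (x : R -> R).
Hypothesis xc : forall a b, seg_continuous a b (fun t => (x t)%:C%C).
Hypothesis x0 : forall t, 0 <= x t.

Let arc_mass a b := Rintegral mu `[a, b] x.

Lemma arc_mass_ge0 a b : 0 <= arc_mass a b.
Proof. by apply: Rintegral_ge0. Qed.

Lemma seg_integral_real a b : seg_integral a b (fun t => (x t)%:C%C) = (arc_mass a b)%:C%C.
Proof.
apply: complex_ext => //=; rewrite Rintegral_cst ?mul0r//.
Qed.

Lemma arc_mass_split a m b : a <= m -> m <= b -> arc_mass a b = arc_mass a m + arc_mass m b.
Proof.
move=> am mb; apply: (@complexI R); rewrite rmorphD /= -!seg_integral_real.
exact: seg_integral_split.
Qed.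

Lemma arc_approx a b z0 (k : R -> C) (delta : R) :
  seg_continuous a b (fun t => (x t)%:C%C * k t) ->
  (forall t, a <= t <= b -> cabs (k t - z0) <= delta) ->
  cabs (seg_integral a b (fun t => (x t)%:C%C * k t) - (arc_mass a b)%:C%C * z0) <= delta * arc_mass a b.
Proof.
move=> kc kd.
have mD : measurable `[a, b]%classic by exact: measurable_itv.
have xi : mu.-integrable `[a, b] (EFin \o x) by have [] := seg_cintegrable (@xc a b).
have zc : seg_continuous a b (fun t => z0 * (x t)%:C%C).
  move=> t tab e e0; have c0 : 0 < cabs z0 + 1 by rewrite ltr_wpDl ?cabs_ge0.
  have [d d0 hd] := xc tab (divr_gt0 e0 c0); exists d => // s /hd h.
  rewrite -mulrBr cabsM; rewrite ltr_pdivlMr// in h.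
  by have := cabs_ge0 ((x s)%:C%C - (x t)%:C%C); nra.
have -> : (arc_mass a b)%:C%C * z0 = seg_integral a b (fun t => z0 * (x t)%:C%C).
  by rewrite seg_integralZ// seg_integral_real mulrC.
rewrite -seg_integralB//.
have -> : delta * arc_mass a b = Rintegral mu `[a, b] (fun t => delta * x t).
  by rewrite RintegralZl.
apply: cabs_cintegral => //.
- by apply: seg_cintegrable; apply: seg_continuousB.
- by apply: eq_integrable (integrableZl _ delta xi) => // t _.
- move=> t; rewrite /= in_itv /= => tab.
  have -> : (x t)%:C%C * k t - z0 * (x t)%:C%C = (x t)%:C%C * (k t - z0) by ring.
  by rewrite cabsM cabs_pos// mulrC ler_wpM2r// kd.
Qed.

Lemma arcs_approx z (h delta : R) n : 0 <= h -> cabs z < 1 ->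
  (forall a b, seg_continuous a b (fun t => (x t)%:C%C * hkernel z (cis t))) ->
  (forall s t, `|s - t| <= h -> cabs (hkernel z (cis s) - hkernel z (cis t)) <= delta) ->
  cabs (seg_integral 0 (n%:R * h) (fun t => (x t)%:C%C * hkernel z (cis t)) -
    \sum_(0 <= j < n) (arc_mass (j%:R * h) (j.+1%:R * h))%:C%C * hkernel z (cis (j%:R * h)))
  <= delta * arc_mass 0 (n%:R * h).
Proof.
move=> h0 z1 kc kd; elim: n => [|n IH].
  rewrite big_geq// subr0 mul0r.
  have -> : seg_integral 0 0 (fun t => (x t)%:C%C * hkernel z (cis t)) = 0.
    have := @seg_integral_split R 0 0 0 (fun t => (x t)%:C%C * hkernel z (cis t)) (lexx _) (lexx _) (@kc _ _).
    by move/eqP; rewrite -subr_eq subrr => /eqP.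
  rewrite cabs0 mulr_ge0 ?arc_mass_ge0//; apply: le_trans (kd 0 0 _); first exact: cabs_ge0.
  by rewrite subrr normr0.
have nh : 0 <= n%:R * h by rewrite mulr_ge0.
have nh1 : n%:R * h <= n.+1%:R * h by rewrite ler_wpM2r// ler_nat.
rewrite big_nat_recr//= (@seg_integral_split _ 0 (n%:R * h))//.
rewrite (@arc_mass_split 0 (n%:R * h))// mulrDr opprD addrACA.
apply: le_trans (cabsD _ _) _; apply: lerD => //.
apply: arc_approx => // t /andP[t1 t2]; apply: kd.
rewrite ger0_norm ?subr_ge0//; move: t2; rewrite -natr1 mulrDl mul1r; lra.
Qed.

End Arcs.

(** Discretised Herglotz representation: the atoms carry the mass of the
    boundary real part over each arc. *)
Lemma herglotz_approx (p : C -> C) (M rho r e : R) :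
  (forall z, disc z -> tends (cnbhs z) p (p z) /\ cabs (p z) <= M) ->
  hol_on p [set z | disc z /\ z != 0] ->
  (forall z, disc z -> 0 <= complex.Re (p z)) ->
  0 < rho < 1 -> r < 1 -> 0 < e ->
  exists N : nat, exists c : nat -> R, (0 < N)%N /\ (forall j, 0 <= c j) /\
    forall z, cabs z <= r ->
      cabs (p (rho%:C%C * z) - (('i)%C * (complex.Im (p 0))%:C%C +
        \sum_(0 <= j < N) (c j)%:C%C * hkernel z (cis (j%:R * (2 * pi / N%:R))))) <= e.
Proof.
move=> pc ph pos /andP[rho0 rho1] r1 e0.
have tp := twopi_gt0 R.
pose x t := complex.Re (p (rho%:C%C * cis t)).
have wd t : disc (rho%:C%C * cis t) by apply/discE; rewrite cabs_circle// ltW.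
have x0 t : 0 <= x t by exact: pos.
have Pc a b : seg_continuous a b (fun t => p (rho%:C%C * cis t)).
  apply: seg_continuous_circle; first exact: ltW.
  by move=> w wr; apply: (pc _ _).1; apply/discE; rewrite wr.
have xc a b : seg_continuous a b (fun t => (x t)%:C%C).
  move=> t tab e' e'0; have [d d0 hd] := Pc a b t tab e' e'0.
  exists d => // s /hd; apply: le_lt_trans.
  by rewrite -rmorphB /= cabs_real -ReN -ReD Re_le_cabs.
pose K0 := complex.Re (p 0) + 1.
have K00 : 0 < K0 by have := pos _ (disc0 R); rewrite /K0; lra.
have s0 : 0 < 1 - r by rewrite subr_gt0.
pose delta := e / K0.
have delta0 : 0 < delta by rewrite divr_gt0.
have [d d0 hd] := @cis_cont0 R (delta * (1 - r) ^+ 2 / 2)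
  (divr_gt0 (mulr_gt0 delta0 (exprn_gt0 _ s0)) (ltr0Sn _ 1)).
pose N := (Num.bound (2 * pi / d)).+1.
have N0 : 0 < N%:R :> R by [].
pose h : R := 2 * pi / N%:R; have h0 : 0 < h by rewrite divr_gt0.
have hd' : h < d.
  rewrite /h ltr_pdivrMr// (mulrC d) -ltr_pdivrMr//.
  apply: lt_le_trans (archi_boundP _) _; first by apply: divr_ge0; exact: ltW.

  by rewrite ler_nat leqnSn.
exists N, (fun j => Rintegral mu `[j%:R * h, j.+1%:R * h] x / (2 * pi)); split => //; split.
  by move=> j; apply: divr_ge0; [by apply: Rintegral_ge0 => t _; exact: x0|exact: ltW].
move=> z zr; have z1 : cabs z < 1 by exact: le_lt_trans r1.
have hk w : hkernel (rho%:C%C * z) (rho%:C%C * w) = hkernel z w.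
  rewrite /hkernel -mulrDr -mulrBr invfM mulrACA divff ?mul1r//.
  by apply/eqP => /complexI /eqP; rewrite gt_eqF.
have rz : cabs (rho%:C%C * z) < rho.
  by rewrite cabsM cabs_pos ?ltW// -[X in _ < X]mulr1 ltr_pM2l.
have rzr : cabs (rho%:C%C * z) < rho < 1 by rewrite rz.
have F := schwarz_formula pc ph rzr.
have kc a b : seg_continuous a b (fun t => (x t)%:C%C * hkernel z (cis t)).
  have := @seg_continuous_circle R (fun u => (complex.Re (p u))%:C%C * hkernel (rho%:C%C * z) u) rho a b (ltW rho0).
  move=> hc; have {hc} hc : seg_continuous a b (fun t => (complex.Re (p (rho%:C%C * cis t)))%:C%C * hkernel (rho%:C%C * z) (rho%:C%C * cis t)).
    apply: hc => w wr; apply: tendsM; last by apply: tends_hkernel; apply: cabs_lt_neq; rewrite wr.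
    move=> e' e'0; have [|hw _] := pc w; first by apply/discE; rewrite wr.
    apply: filterS (hw e' e'0) => v /=; apply: le_lt_trans.
    by rewrite -rmorphB /= cabs_real -ReN -ReD Re_le_cabs.
  by move=> t tab e' e'0; have [d' d'0 hd''] := hc t tab e' e'0; exists d' => // s /hd''; rewrite !hk.
have kd s t : `|s - t| <= h -> cabs (hkernel z (cis s) - hkernel z (cis t)) <= delta.
  move=> st; apply: le_trans (hkernel_lip z1 (cabs_cis s) (cabs_cis t)) _.
  have h1 := ltW (hd _ _ (le_lt_trans st hd')).
  have s1 : 0 < 1 - cabs z by rewrite subr_gt0.
  apply: (@le_trans _ _ (2 / (1 - r) ^+ 2 * (delta * (1 - r) ^+ 2 / 2))).
    apply: ler_pM => //; first by apply: divr_ge0 => //; apply: exprn_ge0; exact: ltW.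
      exact: cabs_ge0.
    rewrite ler_pM2l// lef_pV2 ?posrE ?exprn_gt0// ler_pXn2r ?nnegrE//; last 2 first.
    - exact: ltW.
    - exact: ltW.
    by rewrite lerD2l lerN2.
  by rewrite le_eqVlt; apply/orP; left; apply/eqP; field; rewrite gt_eqF.
have A := arcs_approx xc x0 N (ltW h0) z1 kc kd.
have Nh : N%:R * h = 2 * pi by rewrite /h mulrC divfK// gt_eqF.
rewrite Nh in A.
have X2 : Rintegral mu `[0, 2 * pi] x = 2 * pi * complex.Re (p 0).
  have r0r : cabs (0 : C) < rho < 1 by rewrite cabs0 rho0.
  have F0 := schwarz_formula pc ph r0r.
  have e1 : complex.Re ((2 * pi)%:C%C * (p 0 - ('i)%C * (complex.Im (p 0))%:C%C))
      = 2 * pi * complex.Re (p 0).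
    by rewrite ReZ ReD ReN ReM /= mul0r mul1r subrr oppr0 addr0.
  rewrite -e1 -F0; apply: eq_Rintegral => t _.
  have e2 : complex.Re ((complex.Re (p (rho%:C%C * cis t)))%:C%C *
      hkernel 0 (rho%:C%C * cis t)) = x t.
    by rewrite ReZ hkernel0 ?mulr1// -cabs_gt0 cabs_circle// ltW.
  exact: esym e2.
have tpC : (2 * pi)%:C%C != 0 :> C by apply/eqP => /complexI /eqP; rewrite gt_eqF.
have F' : seg_integral 0 (2 * pi) (fun t => (x t)%:C%C * hkernel z (cis t)) =
    (2 * pi)%:C%C * (p (rho%:C%C * z) - ('i)%C * (complex.Im (p 0))%:C%C).
  by rewrite -F; apply: eq_seg_integral => t _; rewrite hk.
rewrite F' X2 in A.
set S := \sum_(0 <= j < N) _ in A *; set S' := \sum_(0 <= j < N) _.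
have SS : S = (2 * pi)%:C%C * S'.
  rewrite /S /S' big_distrr /=; apply: eq_bigr => j _.
  rewrite mulrA -rmorphM /=; congr (_%:C%C * _).
  by rewrite [RHS]mulrC divfK// gt_eqF.
rewrite SS -mulrBr cabsM (cabs_pos (ltW tp)) in A.
have -> : p (rho%:C%C * z) - (('i)%C * (complex.Im (p 0))%:C%C + S') =
  p (rho%:C%C * z) - ('i)%C * (complex.Im (p 0))%:C%C - S' by ring.
have A' : cabs (p (rho%:C%C * z) - ('i)%C * (complex.Im (p 0))%:C%C - S') <= delta * complex.Re (p 0).
  rewrite -(ler_pM2l tp); apply: le_trans A _.
  by rewrite le_eqVlt; apply/orP; left; apply/eqP; ring.
by apply: le_trans A' _; rewrite /delta mulrAC ler_pdivrMr// ler_pM2l// /K0 lerDl.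
Qed.

(** A countable family of finite atomic sums with rational weights, atoms at roots
    of unity and a rational phase; [(N, M, ns, k)] gives the atom of index [j < N]
    the weight [ns`_j / M], and the phase [k / M]. *)
Definition code : Type := (nat * nat * seq nat * nat)%type.

Definition code_atoms (c : code) : seq (R * C) :=
  let: (N, M, ns, _) := c in
  [seq ((nth 0%N ns j)%:R / M%:R, cis (j%:R * (2 * pi / N%:R))) | j <- iota 0 N].

Definition code_phase (c : code) : R := let: (_, M, _, k) := c in k%:R / M%:R.

Definition code_fun (c : code) (z : C) : C :=
  cexp (- (hsum (code_atoms c) z + ('i)%C * (code_phase c)%:C%C)).

Lemma code_atoms_circle c : circle_atoms (code_atoms c).
Proof.
case: c => [[[N M] ns] k] p /mapP[j _ ->] /=; split; last exact: cabs_cis.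
by rewrite divr_ge0.
Qed.

Lemma Re_hsum_ge0 L z : circle_atoms L -> cabs z < 1 -> 0 <= complex.Re (hsum L z).
Proof.
move=> hL z1; rewrite /hsum; elim: L hL => [|p L IH] hL; first by rewrite big_nil.
rewrite big_cons ReD addr_ge0 ?IH//; last by move=> q qL; apply: hL; rewrite inE qL orbT.
have [p0 p1] := hL p (mem_head _ _).
by rewrite ReZ mulr_ge0// Re_hkernel_ge0// p1 ltW.
Qed.

Lemma nat_approx x (M : nat) : 0 <= x -> (0 < M)%N ->
  exists n : nat, `|x - n%:R / M%:R| <= M%:R^-1.
Proof.
move=> x0 M0; have M0' : 0 < M%:R :> R by rewrite ltr0n.
have /andP[h1 h2] := truncn_itv (mulr_ge0 x0 (ltW M0')).
exists (Num.truncn (x * M%:R)); move: (Num.truncn _) h1 h2 => n h1 h2.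
have -> : x - n%:R / M%:R = (x * M%:R - n%:R) / M%:R by field; rewrite gt_eqF.
have i0 : 0 <= M%:R^-1 :> R by rewrite invr_ge0.
rewrite normrM (ger0_norm i0) ger0_norm ?subr_ge0// ler_piMl//.
by move: h2; rewrite -natr1; lra.
Qed.

(** [g] is close to a dilate [exp (- p)] with [p] bounded of nonnegative real part, and
    discretizing Schwarz's formula for [p] gives the atoms. *)
Lemma code_dense_nonzero g r e :
  (forall u, disc u -> exists m, cderiv g u m) ->
  (forall u, disc u -> g u != 0) -> (forall u, disc u -> cabs (g u) <= 1) ->
  0 <= r -> r < 1 -> 0 < e ->
  exists c, forall z, cabs z <= r -> cabs (g z - code_fun c z) <= e.
Proof.
move=> gh g0 g1 r0 r1 e0.
have e20 : 0 < e / 2 by rewrite divr_gt0.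
have [d d0 hd] := bounded_uniform r1 e20 gh g1.
pose rho := Num.max (1 / 2) (1 - d / 4).
have rho0 : 0 < rho by rewrite lt_max; apply/orP; left; lra.
have rho1 : rho < 1 by rewrite gt_max; apply/andP; split; lra.
have rhod : 1 - d / 4 <= rho by rewrite le_max lexx orbT.
have [p [M [p1 [p2 p3]]]] := holomorphic_log rho0 rho1 gh g0 g1.
have pos z : disc z -> 0 <= complex.Re (p z).
  move=> zd; have := p1 z zd => /(congr1 (@cabs R)); rewrite cabs_cexp ReN => h.
  rewrite -oppr_le0 -expR_le1 h; apply: g1; have /discE z1 := zd; apply/discE.
  rewrite cabsM cabs_pos ?ltW//; have := cabs_ge0 z; nra.
have pc z : disc z -> tends (cnbhs z) p (p z) /\ cabs (p z) <= M.
  by move=> zd; have [m hm] := p2 z zd; split; [exact: cderiv_cont hm|exact: p3].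
have ph : hol_on p [set z | disc z /\ z != 0] by move=> z [zd _]; exact: p2.
have [dl dl0 hdl] := cexp_lip R.
pose e1 := Num.min (dl / 2) (e / 4).
have e10 : 0 < e1 by rewrite lt_min !divr_gt0.
have e1dl : e1 <= dl / 2 by rewrite ge_min lexx.
have e1e : e1 <= e / 4 by rewrite ge_min lexx orbT.
have e120 : 0 < e1 / 2 by rewrite divr_gt0.
have rho01 : 0 < rho < 1 by rewrite rho0.
have [N [c [N0 [c0 hc]]]] := herglotz_approx pc ph pos rho01 r1 e120.
have [b /andP[b0 _] hb] := cis_surj (cabs_cis (complex.Im (p 0))).
have s0 : 0 < 1 - r by rewrite subr_gt0.
pose B := N%:R * (2 / (1 - r)) + 1.
have B0 : 0 < B.
  by rewrite /B ltr_wpDl// mulr_ge0// divr_ge0// ltW.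
pose M1 := (Num.bound (B / (e1 / 2))).+1.
have M10 : 0 < M1%:R :> R by [].
have BM : B / M1%:R <= e1 / 2.
  rewrite ler_pdivrMr// (mulrC (e1 / 2)) -ler_pdivrMr//; apply/ltW.
  apply: lt_le_trans (archi_boundP _) _; first by apply: divr_ge0; exact: ltW.
  by rewrite ler_nat leqnSn.
have [n hn] := choice (fun j => @nat_approx (c j) M1 (c0 j) isT).
have [k hk] := @nat_approx b M1 b0 isT.
exists (N, M1, mkseq n N, k) => z zr; have z1 : cabs z < 1 by exact: le_lt_trans r1.
set cd : code := (N, M1, mkseq n N, k).
have cdE : hsum (code_atoms cd) z =
    \sum_(0 <= j < N) ((n j)%:R / M1%:R)%:C%C * hkernel z (cis (j%:R * (2 * pi / N%:R))).
  rewrite /hsum big_map /= /index_iota subn0; apply: eq_big_seq => j.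
  by rewrite mem_iota /= add0n => jN; rewrite nth_mkseq.
have rz : disc (rho%:C%C * z).
  by apply/discE; rewrite cabsM cabs_pos ?ltW//; have := cabs_ge0 z; clear - z1 rho0 rho1; nra.
have -> : g z - code_fun cd z = (g z - g ((rho ^+ 2)%:C%C * z)) +
   (cexp (- (p (rho%:C%C * z) + ('i)%C * (b - complex.Im (p 0))%:C%C)) - code_fun cd z).
  have -> : cexp (- (p (rho%:C%C * z) + ('i)%C * (b - complex.Im (p 0))%:C%C)) = g ((rho ^+ 2)%:C%C * z).
    have phase : cexp (('i)%C * (b - complex.Im (p 0))%:C%C) = 1.
      have -> : ('i)%C * (b - complex.Im (p 0))%:C%C = (0 +i* (b - complex.Im (p 0)))%C.
        by apply: complex_ext => /=; ring.
      by rewrite -cisE cisD hb cisN divff// cis_neq0.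
    rewrite opprD cexpD [X in _ * X]cexpN phase invr1 mulr1 p1//.
    by rewrite mulrA -rmorphM /= expr2.
  by rewrite addrA subrK.
apply: le_trans (cabsD _ _) _; rewrite [leRHS]splitr; apply: lerD.
  rewrite cabsC; apply/ltW/hd => //.
    have rho2 : 0 <= rho ^+ 2 by rewrite exprn_ge0// ltW.
    rewrite cabsM (cabs_pos rho2); apply: le_trans zr.
    by rewrite ler_piMl ?cabs_ge0// exprn_ile1// ltW.
  have -> : (rho ^+ 2)%:C%C * z - z = - ((1 - rho ^+ 2)%:C%C * z).
    by rewrite rmorphB rmorph1; ring.
  have q0 : 0 <= 1 - rho ^+ 2 by rewrite subr_ge0 exprn_ile1// ltW.
  rewrite cabsN cabsM cabs_pos//.
  apply: (@le_lt_trans _ _ (1 - rho ^+ 2)); first by rewrite ler_piMr// ltW.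
  rewrite expr2; clear - d0 rho0 rho1 rhod; nra.
set P := p _ + _; set Q := hsum (code_atoms cd) z + ('i)%C * (code_phase cd)%:C%C.
have PQ : cabs (P - Q) <= e1.
  have -> : P - Q = (p (rho%:C%C * z) - (('i)%C * (complex.Im (p 0))%:C%C +
        \sum_(0 <= j < N) (c j)%:C%C * hkernel z (cis (j%:R * (2 * pi / N%:R))))) +
    (\sum_(0 <= j < N) (c j - (n j)%:R / M1%:R)%:C%C * hkernel z (cis (j%:R * (2 * pi / N%:R)))
     + ('i)%C * (b - k%:R / M1%:R)%:C%C).
    rewrite /P /Q cdE /code_phase /cd.
    under [X in _ = _ + (X + _)]eq_bigr do rewrite rmorphB mulrBl.
    by rewrite sumrB !rmorphB /=; ring.
  apply: le_trans (cabsD _ _) _; rewrite [leRHS]splitr; apply: lerD; first exact: hc.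
  apply: le_trans BM; apply: le_trans (cabsD _ _) _.
  have -> : B / M1%:R = N%:R * (2 / (1 - r)) / M1%:R + M1%:R^-1 by rewrite /B mulrDl mul1r.
  apply: lerD; last by rewrite cabsM cabs_i mul1r cabs_real.
  apply: le_trans (cabs_sum _ _ _) _.
  apply: (@le_trans _ _ (\sum_(0 <= j < N) (2 / (1 - r) / M1%:R))).
    apply: ler_sum => j _; rewrite cabsM cabs_real mulrC.
    apply: ler_pM; rewrite ?cabs_ge0//.
    apply: le_trans (cabs_hkernel z1 (cabs_cis _)) _.
    by rewrite ler_pM2l// lef_pV2 ?posrE ?subr_gt0// lerD2l lerN2.
  rewrite sumr_const_nat subn0 -(mulr_natl _ N) le_eqVlt; apply/orP; left; apply/eqP.
  ring.
have ReP : 0 <= complex.Re P.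
  by rewrite ReD ReM /= !mul0r mulr0 subr0 addr0 pos.
have lt1 : cabs (P - Q) < dl by apply: le_lt_trans PQ _; clear - e1dl dl0; lra.
have := hdl P Q ReP lt1; rewrite /code_fun -/Q; clear - PQ e1e; lra.
Qed.

Lemma code_dense g r e : @classS R g -> 0 <= r -> r < 1 -> 0 < e ->
  exists c, forall z, cabs z <= r -> cabs (g z - code_fun c z) <= e.
Proof.
move=> [gh [g01|g0]] r0 r1 e0.
  apply: code_dense_nonzero => //.
  - by move=> u /gh /cderivP h; exists (derive1 g u).
  - by move=> u /g01 /andP[+ _]; rewrite normr_gt0.
  - move=> u /g01 /andP[_]; rewrite normCE -[X in _ <= X -> _]/((1 : R)%:C%C) lecR.
    exact.
(* an atom of large mass approximates the zero function *)
have s0 : 0 < (1 - r) / 4 by rewrite divr_gt0// subr_gt0.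
have [n hn] : exists n : nat, expR (- (n%:R * ((1 - r) / 4))) < e.
  exists (Num.bound (e^-1 / ((1 - r) / 4))).
  set n := Num.bound _.
  have hb : e^-1 < n%:R * ((1 - r) / 4).
    by rewrite -ltr_pdivrMr//; apply: archi_boundP; rewrite divr_ge0 ?invr_ge0 ?ltW.
  rewrite expRN -[e]invrK ltf_pV2 ?posrE ?invr_gt0 ?expR_gt0//.
  by apply: lt_le_trans hb _; have := expR_ge1Dx (n%:R * ((1 - r) / 4)); lra.
exists (1%N, 1%N, [:: n], 0%N) => z zr; have z1 : cabs z < 1 by exact: le_lt_trans r1.
rewrite g0; last exact/discE.
rewrite sub0r cabsN /code_fun /hsum /= big_seq1 /= mul0r cis0 divr1.
rewrite /code_phase mul0r rmorph0 mulr0 addr0 cabs_cexp ReN ReZ.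
apply/ltW/(le_lt_trans _ hn); rewrite ler_expR lerN2 ler_wpM2l//.
rewrite Re_hkernel cabs1 expr1n.
have c1 : cabs (1 - z) <= 2 by have := cabsD 1 (- z); rewrite cabs1 cabsN; lra.
have c2 : 0 < cabs (1 - z) by have := cabs_triB 1 z; rewrite cabs1; lra.
have c3 : 1 - r <= 1 - cabs z ^+ 2.
  rewrite lerD2l lerN2; apply: le_trans zr.
  by rewrite expr2 ler_piMl ?cabs_ge0// ltW.
apply: ler_pM => //; first by rewrite subr_ge0 ltW.
rewrite lef_pV2 ?posrE ?exprn_gt0//.
have -> : 4 = 2 ^+ 2 :> R by ring.
by rewrite ler_pXn2r ?nnegrE ?cabs_ge0.
Qed.

End AtomicSums.

(** * Transport of atoms by disc automorphisms *)

Section PushedAtoms.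
Variable R : realType.
Local Notation C := R[i].
Implicit Types (a z w xi zeta e : C) (c s x y r : R) (L : seq (R * C)).

(** The phase picked up by an atom of unit weight at [xi] when it is transported by
    [moebius a]. *)
Definition phase a xi : R := complex.Im (hkernel (- ((a^*)%C * xi)) 1).

(** The transport of atoms by [moebius a]; the factor is the modulus of the derivative
    of [moebius a] at a point of the circle. *)
Definition push a L : seq (R * C) :=
  [seq (p.1 * (1 - cabs a ^+ 2) / cabs (1 + (a^*)%C * p.2) ^+ 2, moebius a p.2) | p <- L].

Definition phase_sum a L : R := \sum_(p <- L) p.1 * phase a p.2.

Lemma conj1D z : ((1 + z)^*)%C = 1 + (z^*)%C.
Proof. by case: z => x y; apply: complex_ext => /=; ring. Qed.

Lemma conj1B z : ((1 - z)^*)%C = 1 - (z^*)%C.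
Proof. by case: z => x y; apply: complex_ext => /=; ring. Qed.

Lemma Im_hkernel z : complex.Im (hkernel z 1) = 2 * complex.Im z / cabs (1 - z) ^+ 2.
Proof.
rewrite /hkernel cabs_sqr; case: z => x y /=.
by rewrite !mulrA mulrN !mulrA -mulNr -mulrDl; congr (_ / _); ring.
Qed.

Lemma i_phase a xi : cabs a < 1 -> cabs xi = 1 ->
  ('i)%C * (phase a xi)%:C%C = (1 + (a^*)%C * xi)^-1 - xi / (xi + a) :> C.
Proof.
move=> a1 x1.
have x0 : xi != 0 by rewrite -cabs_gt0 x1.
have d0 : 1 + (a^*)%C * xi != 0 by apply: moebius_den; rewrite ?x1.
have xc : (xi^*)%C = xi^-1.
  by apply: (mulfI x0); rewrite mulcJ x1 expr1n divff.
have e0 : xi + a != 0.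
  by rewrite -[a]opprK subr_eq0; apply: cabs_lt_neq; rewrite x1 cabsN.
rewrite /phase; set X := hkernel _ 1.
have -> : ('i)%C * (complex.Im X)%:C%C = (X - (X^*)%C) / 2.
  rewrite -[LHS](mulfK (_ : 2 != 0))//; congr (_ / _).
  rewrite mulr_natr mulr2n; case: X => u v; apply: complex_ext => /=; ring.
have XE : X = (1 - (a^*)%C * xi) / (1 + (a^*)%C * xi) by rewrite /X /hkernel opprK.
have XcE : (X^*)%C = (xi - a) / (xi + a).
  rewrite XE rmorphM /= conjc_inv conj1B conj1D rmorphM /= conjcK xc.
  by field; rewrite e0 x0.
by rewrite XcE XE; field; rewrite d0 e0.
Qed.

(** Transport of an atom by a disc automorphism: the Herglotz kernel is
    covariant, with the Poisson factor as Jacobian, up to an imaginary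
    constant. *)
Lemma hkernel_moebius a w xi c : cabs a < 1 -> cabs w < 1 -> cabs xi = 1 ->
  (c * (1 - cabs a ^+ 2) / cabs (1 + (a^*)%C * xi) ^+ 2)%:C%C *
    hkernel (moebius a w) (moebius a xi) =
  c%:C%C * (hkernel w xi + ('i)%C * (phase a xi)%:C%C).
Proof.
move=> a1 w1 x1; rewrite i_phase//.
have x0 : xi != 0 by rewrite -cabs_gt0 x1.
have d0 : 1 + (a^*)%C * xi != 0 by apply: moebius_den; rewrite ?x1.
have f0 : 1 + (a^*)%C * w != 0 by apply: moebius_den; rewrite // ltW.
have xc : (xi^*)%C = xi^-1.
  by apply: (mulfI x0); rewrite mulcJ x1 expr1n divff.
have e0 : xi + a != 0.
  by rewrite -[a]opprK subr_eq0; apply: cabs_lt_neq; rewrite x1 cabsN.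
have w0 : xi - w != 0 by rewrite subr_eq0; apply: cabs_lt_neq; rewrite x1.
have s0 : 1 - a * (a^*)%C != 0.
  rewrite mulcJ; apply/eqP => /(congr1 (@complex.Re R)) /=.
  by apply/eqP; rewrite gt_eqF// cabs2_lt1.
have dc : ((1 + (a^*)%C * xi)^*)%C = (xi + a) / xi.
  by rewrite conj1D rmorphM /= conjcK xc; field; rewrite x0.
have -> : (c * (1 - cabs a ^+ 2) / cabs (1 + (a^*)%C * xi) ^+ 2)%:C%C =
    c%:C%C * (1 - a * (a^*)%C) / ((1 + (a^*)%C * xi) * ((xi + a) / xi)).
  by rewrite -dc !mulcJ -(rmorph1 (real_complex R)) -rmorphB -rmorphM -fmorphV -rmorphM rmorph1.
rewrite /hkernel /moebius.
have num : (a + xi) / (1 + (a^*)%C * xi) - (a + w) / (1 + (a^*)%C * w) =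
   (xi - w) * (1 - a * (a^*)%C) / ((1 + (a^*)%C * xi) * (1 + (a^*)%C * w)).
  by field; rewrite d0 f0.
rewrite num; field.
by rewrite x0 d0 f0 e0 w0 s0.
Qed.

Lemma push_circle a L : cabs a < 1 -> circle_atoms L -> circle_atoms (push a L).
Proof.
move=> a1 hL p /mapP[q /hL [q0 q1] ->] /=; split; last exact: moebius_circle.
by rewrite divr_ge0 ?sqr_ge0// mulr_ge0// ltW// cabs2_lt1.
Qed.

Lemma hsum_push a L w : cabs a < 1 -> cabs w < 1 -> circle_atoms L ->
  hsum (push a L) (moebius a w) = hsum L w + ('i)%C * (phase_sum a L)%:C%C.
Proof.
move=> a1 w1; rewrite /hsum /phase_sum /push big_map.
elim: L => [|p L IH] hL; first by rewrite !big_nil rmorph0 mulr0 addr0.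
rewrite !big_cons IH; last by move=> q qL; apply: hL; rewrite inE qL orbT.
have [_ p1] := hL p (mem_head _ _).
by rewrite hkernel_moebius// rmorphD rmorphM /=; ring.
Qed.

Lemma mass_ge0 L : circle_atoms L -> 0 <= mass L.
Proof.
move=> hL; rewrite /mass big_seq sumr_ge0// => p /hL[]//.
Qed.

Lemma mass_push a L (d : R) : cabs a < 1 -> circle_atoms L -> 0 < d ->
  (forall p, p \in L -> d <= cabs (1 + (a^*)%C * p.2)) ->
  mass (push a L) <= mass L * ((1 - cabs a ^+ 2) / d ^+ 2).
Proof.
move=> a1 hL d0 hd; rewrite /mass /push big_map /= mulr_suml.
rewrite big_seq [leRHS]big_seq; apply: ler_sum => p pL.
have [p0 _] := hL p pL; have h := hd p pL.
rewrite -mulrA ler_wpM2l// ler_wpM2l//; first by rewrite ltW// cabs2_lt1.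
have c0 : 0 < cabs (1 + (a^*)%C * p.2) by exact: lt_le_trans h.
by rewrite lef_pV2 ?posrE ?exprn_gt0// ler_pXn2r// nnegrE ltW.
Qed.

(** Points of the circle near 1, rationally parametrized so that distances reduce
    to algebra. *)
Definition cayley x : C := (1 + x%:C%C * ('i)%C) / (1 - x%:C%C * ('i)%C).

Lemma cayley_den x : 1 - x%:C%C * ('i)%C != 0 :> C.
Proof.
apply/eqP => /(congr1 (@complex.Re R)); rewrite ReD ReN ReM /= mulr0 mul0r subrr subr0.
by apply/eqP; rewrite oner_eq0.
Qed.

Lemma cabs_cayley x : cabs (cayley x) = 1.
Proof.
rewrite /cayley cabsM cabsV.
have -> : cabs (1 + x%:C%C * ('i)%C) = cabs (1 - x%:C%C * ('i)%C).
  rewrite -cabs_conj; congr cabs.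
  by apply: complex_ext; rewrite ?Re_conj ?Im_conj ?(ReD, ImD, ReN, ImN, ReM, ImM) /=; ring.
by rewrite divff// cabs_eq0 cayley_den.
Qed.

Lemma cabs_cayley_den x : 0 <= x <= 1 -> 1 <= cabs (1 - x%:C%C * ('i)%C) <= 2.
Proof.
move=> /andP[x0 x1]; apply/andP; split.
  apply: le_trans (Re_le_cabs _); rewrite ReD ReN ReM /= mulr0 mul0r subrr subr0.
  by rewrite normr1.
by apply: le_trans (cabsD _ _) _; rewrite cabsN cabsM cabs_i cabs1 cabs_pos//; lra.
Qed.

Lemma cayley_sub x y : cayley x - cayley y =
  2 * ('i)%C * (x - y)%:C%C / ((1 - x%:C%C * ('i)%C) * (1 - y%:C%C * ('i)%C)).
Proof.
rewrite /cayley rmorphB; field.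
by rewrite !cayley_den.
Qed.

Lemma cayley_dist x y : 0 <= x <= 1 -> 0 <= y <= 1 ->
  `|x - y| / 2 <= cabs (cayley x - cayley y).
Proof.
move=> hx hy; rewrite cayley_sub cabsM cabsV !cabsM cabs_nat cabs_i mulr1 cabs_real.
have /andP[a1 a2] := cabs_cayley_den hx; have /andP[b1 b2] := cabs_cayley_den hy.
set A := cabs _ in a1 a2 *; set B := cabs (1 - y%:C%C * _) in b1 b2 *.
have A0 : 0 < A by lra.
have B0 : 0 < B by lra.
have AB : A * B <= 2 * 2 by apply: ler_pM => //; exact: ltW.
rewrite ler_pdivlMr ?mulr_gt0//; apply: (@le_trans _ _ (`|x - y| / 2 * (2 * 2))).
  by rewrite ler_wpM2l// divr_ge0.
lra.
Qed.

Lemma cayley_near1 x : 0 <= x <= 1 -> cabs (cayley x - 1) <= 2 * x.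
Proof.
move=> hx; have /andP[a1 _] := cabs_cayley_den hx; have /andP[x0 _] := hx.
have -> : cayley x - 1 = 2 * ('i)%C * x%:C%C / (1 - x%:C%C * ('i)%C).
  by rewrite /cayley; field; rewrite cayley_den.
rewrite cabsM cabsV !cabsM cabs_nat cabs_i mulr1 cabs_pos//.
rewrite ler_pdivrMr; last by lra.
by rewrite ler_peMr// mulr_ge0.
Qed.

Lemma Im_cayley x : 0 <= x <= 1 -> x <= complex.Im (cayley x).
Proof.
move=> /andP[x0 x1]; have -> : complex.Im (cayley x) = 2 * x / (1 + x ^+ 2).
  by rewrite /cayley ImM /=; field; rewrite gt_eqF// ltr_pwDl// sqr_ge0.
have q0 : 0 < 1 + x ^+ 2 by rewrite ltr_pwDl// sqr_ge0.
rewrite ler_pdivlMr//.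
have x2 : x ^+ 2 <= 1 by rewrite exprn_ile1.
by rewrite mulrC ler_wpM2r//; lra.
Qed.

(** Five well-separated candidates cannot all be close to one of four points. *)
Lemma avoid_points e s (B : seq C) : cabs e = 1 -> 0 < s -> s <= 1 / 5 ->
  (size B <= 4)%N ->
  exists x, s <= x <= 5 * s /\ forall b, b \in B -> s / 4 <= cabs (e * cayley x - b).
Proof.
move=> e1 s0 s1 sB; apply: contrapT => no.
pose x (k : nat) := s * k.+1%:R.
have xr k : (k < 5)%N -> s <= x k <= 5 * s.
  move=> k5; have k1 : 1 <= k.+1%:R :> R by rewrite ler1n.
  have k2 : k.+1%:R <= 5%:R :> R by rewrite ler_nat.
  by apply/andP; split; rewrite /x; [rewrite ler_peMr// ltW|rewrite mulrC ler_pM2r].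
have x01 k : (k < 5)%N -> 0 <= x k <= 1.
  by move=> /xr /andP[h1 h2]; apply/andP; split; lra.
have hb k : exists b, (k < 5)%N -> b \in B /\ cabs (e * cayley (x k) - b) < s / 4.
  have [k5|k5] := boolP (k < 5)%N; last by exists 0.
  apply: contrapT => nb; apply: no; exists (x k); split; first exact: xr.
  move=> b bB; rewrite leNgt; apply/negP => h; apply: nb; exists b => _; split => //.
have [f hf] := choice hb.
have inj i j : (i < 5)%N -> (j < 5)%N -> f i = f j -> i = j.
  move=> i5 j5 fij; have [_ h1] := hf i i5; have [_ h2] := hf j j5.
  rewrite -fij in h2; have h3 := cayley_dist (x01 i i5) (x01 j j5).
  have h4 : cabs (cayley (x i) - cayley (x j)) < s / 2.
    have -> : cabs (cayley (x i) - cayley (x j)) = cabs (e * cayley (x i) - e * cayley (x j)).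
      by rewrite -mulrBr cabsM e1 mul1r.
    apply: le_lt_trans (cabs_tri _ (f i) _) _; rewrite (cabsC (f i)); lra.
  have h5 : `|x i - x j| < s by lra.
  have h6 : `|i.+1%:R - j.+1%:R| < 1 :> R.
    rewrite -(ltr_pM2l s0) mulr1 -[X in X * _](ger0_norm (ltW s0)) -normrM mulrBr.
    exact: h5.
  move: h6; rewrite ltr_norml ltrBlDr ltrBrDl => /andP[h7 h8].
  have k1 : (j.+1 < i.+2)%N.
    by rewrite -(ltr_nat R) -(natr1 i.+1); move: h7; rewrite -!natr1; lra.
  have k2 : (i.+1 < j.+2)%N.
    by rewrite -(ltr_nat R) -(natr1 j.+1); move: h8; rewrite -!natr1; lra.
  by apply/eqP; rewrite eqn_leq; apply/andP; split.
pose S := map f (iota 0 5).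
have uS : uniq S.
  rewrite map_inj_in_uniq ?iota_uniq// => i j; rewrite !mem_iota /= add0n => i5 j5.
  exact: inj.
have subS : {subset S <= B}.
  move=> b; rewrite /S => /mapP[i + ->]; rewrite mem_iota /= add0n => i5.
  by have [] := hf i i5.
have := uniq_leq_size uS subS; rewrite size_map size_iota => h.
by have := leq_trans h sB.
Qed.

End PushedAtoms.

(** * Finite atomic sums prescribed near one point *)

Section LocalAtoms.
Variable R : realType.
Local Notation C := R[i].
Implicit Types (a z w xi zeta lam : C) (c s x y r theta : R) (L : seq (R * C)).

Lemma hkernel_rot lam z zeta : cabs lam = 1 ->
  hkernel (lam * z) (lam * zeta) = hkernel z zeta.
Proof.
move=> l1; have l0 : lam != 0 by rewrite -cabs_gt0 l1.
by rewrite /hkernel -mulrDr -mulrBr invfM mulrACA divff ?mul1r.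
Qed.

Lemma hkernel_lip_point w w' zeta (q : R) : 0 < q -> cabs w <= 1 - q ->
  cabs w' <= 1 - q -> cabs zeta = 1 ->
  cabs (hkernel w zeta - hkernel w' zeta) <= 2 / q ^+ 2 * cabs (w - w').
Proof.
move=> q0 wq w'q e1.
have d1 : q <= cabs (zeta - w) by have := cabs_triB zeta w; rewrite e1; lra.
have d2 : q <= cabs (zeta - w') by have := cabs_triB zeta w'; rewrite e1; lra.
have h1 : zeta != w by rewrite -subr_eq0 -cabs_gt0; lra.
have h2 : zeta != w' by rewrite -subr_eq0 -cabs_gt0; lra.
rewrite hkernel_sub// !cabsM cabsV cabsM cabs_nat e1 mulr1 mulrAC.
rewrite ler_wpM2r ?cabs_ge0// ler_pM2l// lef_pV2 ?posrE ?mulr_gt0 ?exprn_gt0//; last 2 first.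
- by apply: lt_le_trans d1.
- by apply: lt_le_trans d2.
by rewrite expr2; apply: ler_pM => //; exact: ltW.
Qed.

(** The phase atom: close to the direction opposite to [a] the transported phase
    per unit weight is large, so a small weight produces any phase. *)
Lemma phase_large a x (d : R) : cabs a < 1 -> 1 - cabs a <= d -> d <= 1 / 2 -> d <= x -> 0 < x <= 1 ->
  (9 * x)^-1 <= phase a (- (a / (cabs a)%:C%C) * cayley x).
Proof.
move=> a1 ad d1 dx /andP[x0 x1].
have a2 : 1 / 2 <= cabs a by lra.
have ca0 : cabs a != 0 by rewrite gt_eqF//; lra.
have caC : (cabs a)%:C%C != 0 :> C by apply/eqP => /complexI /eqP; rewrite (negbTE ca0).
rewrite /phase.
have -> : - ((a^*)%C * (- (a / (cabs a)%:C%C) * cayley x)) = (cabs a)%:C%C * cayley x.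
  have -> : - ((a^*)%C * (- (a / (cabs a)%:C%C) * cayley x)) =
     (a * (a^*)%C) / (cabs a)%:C%C * cayley x by ring.
  by rewrite mulcJ rmorphXn /= expr2 mulfK.
have x01 : 0 <= x <= 1 by rewrite ltW.
rewrite Im_hkernel ImZ; have hI := Im_cayley x01; have hN := cayley_near1 x01.
set u := cayley x in hI hN *.
have den : cabs (1 - (cabs a)%:C%C * u) <= 3 * x.
  have -> : 1 - (cabs a)%:C%C * u = (1 - u) + (1 - cabs a)%:C%C * u.
    by rewrite rmorphB rmorph1; ring.
  apply: le_trans (cabsD _ _) _; rewrite cabsM cabs_cayley mulr1 (cabsC 1).
  by rewrite cabs_pos; lra.
have den0 : 0 < cabs (1 - (cabs a)%:C%C * u).
  have := cabs_triB 1 ((cabs a)%:C%C * u).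
  by rewrite cabsM cabs_cayley mulr1 cabs1 cabs_pos ?cabs_ge0//; lra.
set N := cabs _ in den den0 *.
have k1 : x <= 2 * (cabs a * complex.Im u).
  have : 1 / 2 * x <= cabs a * complex.Im u by apply: ler_pM => //; exact: ltW.
  by lra.
apply: (@le_trans _ _ (x / N ^+ 2)); last by rewrite ler_wpM2r// invr_ge0 sqr_ge0.
rewrite ler_pdivlMr ?exprn_gt0//.
have N2 : N ^+ 2 <= (3 * x) ^+ 2 by rewrite ler_pXn2r// nnegrE ltW// mulr_gt0.
apply: (@le_trans _ _ ((9 * x)^-1 * (3 * x) ^+ 2)).
  by rewrite ler_wpM2l// invr_ge0 mulr_ge0// ltW.
by rewrite le_eqVlt; apply/orP; left; apply/eqP; field; rewrite gt_eqF.
Qed.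

(** The point to keep away from besides those of [B] is [- a / |a| ^ 2], close to the
    circle, where the factor in [push] blows up. *)
Definition keeps_away (d : R) a (B : seq C) L : Prop := forall p, p \in L ->
  d <= cabs (1 + (a^*)%C * p.2) /\ forall b, b \in B -> d <= cabs (p.2 - b).

(** Any finite atomic sum, with any phase, is realized near the rotation [lam] in
    the coordinates centred at [a], by atoms that stay away from prescribed
    points.  The bounds depend on the target only, not on [a]. *)
Lemma local_atoms L r (eps : R) : circle_atoms L -> 0 <= r -> r < 1 -> 0 < eps ->
  exists d M : R, [/\ 0 < d, d <= 1 / 2 & forall a lam (B : seq C) theta,
    cabs a < 1 -> 1 - cabs a <= d -> cabs lam = 1 -> (size B <= 3)%N ->
    exists L' (beta : R), [/\ circle_atoms L', mass L' <= M, keeps_away d a B L',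
      cexp (('i)%C * beta%:C%C) = 1 &
      forall z w, cabs z <= r -> cabs (w - lam * z) <= d -> cabs w < 1 /\
        cabs (hsum L' w + ('i)%C * (phase_sum a L' + theta)%:C%C -
          (hsum L z + ('i)%C * beta%:C%C)) <= eps]].
Proof.
move=> hL r0 r1 eps0.
have pi0 := pi_gt0 R.
pose q := (1 - r) / 2; have q0 : 0 < q by rewrite divr_gt0// subr_gt0.
have q1 : q <= 1 by rewrite /q; lra.
pose K := 2 / q ^+ 2; have K0 : 0 < K by rewrite divr_gt0// exprn_gt0.
have m0 := mass_ge0 hL.
pose A := K * (11 * mass L + 90 * pi) + 1.
have pi90 : 0 <= 90 * pi :> R by apply: mulr_ge0 => //; exact: ltW.
have A0 : 0 < A.
  have : 0 <= K * (11 * mass L + 90 * pi).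
    by apply: mulr_ge0; [exact: ltW|apply: addr_ge0 => //; exact: mulr_ge0].
  by rewrite /A; lra.
pose s := Num.min (1 / 5) (Num.min q (eps / A)).
have s0 : 0 < s by rewrite !lt_min q0 !divr_gt0.
have s1 : s <= 1 / 5 by rewrite ge_min lexx.
have sq : s <= q by rewrite !ge_min lexx !orbT.
have se : s * A <= eps by rewrite -ler_pdivlMr// !ge_min lexx !orbT.
exists (s / 8), (mass L + 90 * pi); split; [by rewrite divr_gt0|by lra|].
move=> a lam B theta a1 ad l1 sB.
have a2 : 1 / 2 <= cabs a by lra.
have a0 : a != 0 by rewrite -cabs_gt0; lra.
have ac0 : (a^*)%C != 0 by rewrite conjc_eq0.
pose B' := - ((a^*)%C)^-1 :: B.
have away xi : (forall b, b \in B' -> s / 4 <= cabs (xi - b)) ->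
    s / 8 <= cabs (1 + (a^*)%C * xi) /\ forall b, b \in B -> s / 8 <= cabs (xi - b).
  move=> h; split; last first.
    by move=> b bB; have := h b; rewrite inE bB orbT => /(_ isT); lra.
  have := h (- ((a^*)%C)^-1); rewrite inE eqxx opprK => /(_ isT) h1.
  have -> : 1 + (a^*)%C * xi = (a^*)%C * (xi + ((a^*)%C)^-1) by rewrite mulrDr divff// addrC.
  rewrite cabsM cabs_conj; have -> : s / 8 = 1 / 2 * (s / 4) by field.
  by apply: ler_pM => //; rewrite divr_ge0// ltW.
have hx (p : R * C) : exists x, cabs p.2 = 1 ->
    s <= x <= 5 * s /\ forall b, b \in B' -> s / 4 <= cabs (lam * p.2 * cayley x - b).
  have [p1|p1] := eqVneq (cabs p.2) 1; last by exists 0 => h; move: p1; rewrite h eqxx.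
  have e1 : cabs (lam * p.2) = 1 by rewrite cabsM l1 p1 mulr1.
  by have [x hx] := @avoid_points R _ s B' e1 s0 s1 sB; exists x.
have [X hX] := choice hx.
pose nu (p : R * C) := lam * p.2 * cayley (X p).
have nu1 p : cabs p.2 = 1 -> cabs (nu p) = 1.
  by move=> p1; rewrite /nu cabsM (cabsM lam) l1 p1 cabs_cayley !mulr1.
pose Lm := [seq (p.1, nu p) | p <- L].
have caC : (cabs a)%:C%C != 0 :> C by apply/eqP => /complexI /eqP; rewrite cabs_eq0 (negbTE a0).
pose e0 : C := - (a / (cabs a)%:C%C).
have e01 : cabs e0 = 1.
  by rewrite cabsN cabsM cabsV cabs_pos ?cabs_ge0// divff// cabs_eq0.
have [xp [/andP[xp1 xp2] hxp]] := @avoid_points R e0 s B' e01 s0 s1 sB.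
(* one more atom, close to the direction opposite to [a], corrects the phase *)
pose xip := e0 * cayley xp.
have xip1 : cabs xip = 1 by rewrite /xip cabsM e01 cabs_cayley mulr1.
have T1 : (9 * xp)^-1 <= phase a xip.
  have [k1 k2] : s / 8 <= 1 / 2 /\ s / 8 <= xp by clear - xp1 xp2 s0 s1; split; lra.
  have k3 : 0 < xp <= 1 by clear - xp1 xp2 s0 s1; apply/andP; split; lra.
  exact: (@phase_large a xp (s / 8)).
have T0 : 0 < phase a xip by apply: lt_le_trans T1; rewrite invr_gt0; clear - s0 xp1; lra.
pose S := phase_sum a Lm + theta.
have [t /andP[t0 t2] ht] := cis_surj (cabs_cis (- S)).
pose cp := t / phase a xip.
have cp0 : 0 <= cp by rewrite divr_ge0// ltW.
have cps : cp <= 90 * pi * s.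
  rewrite ler_pdivrMr//; apply: (@le_trans _ _ (2 * pi)); first exact: ltW.
  apply: (@le_trans _ _ (90 * pi * s * (9 * xp)^-1)).
    rewrite ler_pdivlMr; last by clear - s0 xp1; lra.
    have : pi * xp <= pi * (5 * s) by rewrite ler_pM2l.
    clear; lra.
  by rewrite ler_wpM2l//; apply: mulr_ge0 => //; exact: ltW.
exists ((cp, xip) :: Lm), (S + t); split.
- move=> p; rewrite inE => /orP[/eqP ->|/mapP[p' /hL [p0 p1] ->]] /=.
    by split.
  by split => //; exact: nu1.
- rewrite /mass big_cons big_map /= addrC lerD2l.
  by apply: le_trans cps _; rewrite ler_piMr//; clear - s1; lra.
- move=> p; rewrite inE => /orP[/eqP ->|/mapP[p' /hL [p0 p1] ->]] /=.
    exact: away.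
  by apply: away; have [] := hX p' p1.
- have -> : ('i)%C * (S + t)%:C%C = (0 +i* (S + t))%C by apply: complex_ext => /=; ring.
  by rewrite -cisE cisD ht -cisD addrN cis0.
move=> z w zr wz.
have lz : cabs (lam * z) <= 1 - q by rewrite cabsM l1 mul1r; clear - zr r1; rewrite /q; lra.
have wq : cabs w <= 1 - q.
  have -> : w = (w - lam * z) + lam * z by rewrite subrK.
  apply: le_trans (cabsD _ _) _; rewrite cabsM l1 mul1r.
  by clear - wz zr sq s0; rewrite /q in sq *; lra.
have w1 : cabs w < 1 by clear - wq q0; lra.
split => //.
have -> : hsum ((cp, xip) :: Lm) w + ('i)%C * (phase_sum a ((cp, xip) :: Lm) + theta)%:C%C -
    (hsum L z + ('i)%C * (S + t)%:C%C) =
    cp%:C%C * hkernel w xip + \sum_(p <- L) p.1%:C%C * (hkernel w (nu p) - hkernel z p.2).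
  rewrite /phase_sum big_cons /= -/(phase_sum a Lm).
  have -> : cp * phase a xip + phase_sum a Lm + theta = S + t.
    by rewrite /cp divfK ?gt_eqF// /S; ring.
  rewrite /hsum big_cons big_map /=.
  under [X in _ = _ + X]eq_bigr do rewrite mulrBr.
  by rewrite sumrB; ring.
apply: le_trans (cabsD _ _) _; apply: le_trans se.
have -> : s * A = 90 * pi * s * K + (11 * K * s * mass L + s) by rewrite /A; ring.
apply: lerD.
  rewrite cabsM cabs_pos//; apply: ler_pM => //; first exact: cabs_ge0.
  apply: le_trans (cabs_hkernel w1 xip1) _; rewrite /K ler_pM2l//.
  have qw : q <= 1 - cabs w by rewrite lerBrDr addrC -lerBrDr.
  rewrite lef_pV2 ?posrE ?exprn_gt0 ?(lt_le_trans q0 qw)//.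
  by apply: le_trans qw; rewrite expr2 ler_piMr// ltW.
apply: (@le_trans _ _ (11 * K * s * mass L)); last by rewrite lerDl ltW.
apply: le_trans (cabs_sum _ _ _) _.
rewrite /mass mulr_sumr big_seq [leRHS]big_seq; apply: ler_sum => p pL.
have [p0 p1] := hL p pL; rewrite cabsM cabs_pos// mulrC ler_wpM2r//.
have [/andP[X1 X2] _] := hX p p1.
have lp : cabs (lam * p.2) = 1 by rewrite cabsM l1 p1 mulr1.
have np := nu1 p p1.
rewrite -(hkernel_rot z p.2 l1).
apply: le_trans (cabs_tri _ (hkernel w (lam * p.2)) _) _.
have -> : 11 * K * s = K * (10 * s) + K * s by ring.
apply: lerD.
  apply: le_trans (hkernel_lip w1 np lp) _; rewrite /K; apply: ler_pM; rewrite ?cabs_ge0//.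
  - by rewrite divr_ge0// sqr_ge0.
  - have qw : q <= 1 - cabs w by rewrite lerBrDr addrC -lerBrDr.
    rewrite ler_pM2l// lef_pV2 ?posrE ?exprn_gt0 ?(lt_le_trans q0 qw)//.
    by rewrite ler_pXn2r// nnegrE ltW// (lt_le_trans q0 qw).
  have -> : nu p - lam * p.2 = lam * p.2 * (cayley (X p) - 1) by rewrite /nu; ring.
  rewrite cabsM lp mul1r; apply: le_trans (cayley_near1 _) _; last by clear - X2; lra.
  by clear - X1 X2 s0 s1; apply/andP; split; lra.
apply: le_trans (hkernel_lip_point q0 wq lz lp) _.
rewrite -/K ler_pM2l//; clear - wz s0; lra.
Qed.

End LocalAtoms.

(** * Interaction of two distant points *)

Section TwoPoints.
Variable R : realType.
Local Notation C := R[i].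
Implicit Types (a b z w xi zeta lam : C) (r theta : R) (L P S : seq (R * C)).

(** Solves the finitely many smallness constraints on a parameter all at once. *)
Lemma exists_small (s : seq (R * R)) : (forall p, p \in s -> 0 < p.2) ->
  exists2 d : R, 0 < d & forall p, p \in s -> p.1 * d <= p.2.
Proof.
elim: s => [_|p s IH hs]; first by exists 1.
have [|d d0 hd] := IH; first by move=> q qs; apply: hs; rewrite inE qs orbT.
have p0 : 0 < p.2 by apply: hs; exact: mem_head.
have n0 : 0 < `|p.1| + 1 by rewrite ltr_wpDl.
exists (Num.min d (p.2 / (`|p.1| + 1))); first by rewrite lt_min d0 divr_gt0.
set m := Num.min _ _; have m0 : 0 < m by rewrite lt_min d0 divr_gt0.
have md : m <= d by rewrite ge_min lexx.
have mp : m * (`|p.1| + 1) <= p.2 by rewrite -ler_pdivlMr// ge_min lexx orbT.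
move=> q; rewrite inE => /orP[/eqP ->|qs].
  have h : p.1 * m <= `|p.1| * m by rewrite ler_wpM2r ?ler_norm// ltW.
  by apply: le_trans h _; rewrite mulrDr mulr1 in mp; rewrite mulrC; lra.
have := hd q qs; have [q0|q0] := leP 0 q.1.
  by apply: le_trans; rewrite ler_wpM2l.
move=> _; apply: (@le_trans _ _ 0).
  by rewrite mulr_le0_ge0// ltW.
by apply: ltW; apply: hs; rewrite inE qs orbT.
Qed.

Lemma hsum_harnack L z w : circle_atoms L -> cabs z < 1 -> cabs w < 1 ->
  cabs (hsum L z - hsum L w) <=
  2 * pseudo w z / (1 - pseudo w z) * complex.Re (hsum L w).
Proof.
move=> hL z1 w1; rewrite /hsum; elim: L hL => [|p L IH] hL.
  by rewrite !big_nil subrr cabs0 mulr0.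
have [p0 p1] := hL p (mem_head _ _).
rewrite !big_cons ReD mulrDr opprD addrACA; apply: le_trans (cabsD _ _) _.
apply: lerD; last by apply: IH => q qL; apply: hL; rewrite inE qL orbT.
rewrite -mulrBr cabsM cabs_pos// ReZ mulrCA ler_wpM2l//.
exact: hkernel_harnack.
Qed.

Lemma hsum_cat L P z : hsum (L ++ P) z = hsum L z + hsum P z.
Proof. by rewrite /hsum big_cat. Qed.

Lemma circle_atoms_cat L P : circle_atoms L -> circle_atoms P -> circle_atoms (L ++ P).
Proof. by move=> hL hP p; rewrite mem_cat => /orP[/hL|/hP]. Qed.

Lemma harnack_factor (phi : C -> C) r z : holomorphic_self_map phi ->
  r < 1 -> cabs z <= r ->
  2 * pseudo (phi 0) (phi z) / (1 - pseudo (phi 0) (phi z)) <= 2 / (1 - r).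
Proof.
move=> hphi r1 zr; have [ph pd pl] := self_map_cderiv hphi.
have zd : disc z by apply/discE; exact: le_lt_trans r1.
have s := schwarz_pick ph pd pl zd; have p0 := pseudo_ge0 (phi 0) (phi z).
move: (pseudo _ _) s p0 => p s p0.
have pr : p <= r by exact: le_trans zr.
apply: ler_pM; first by rewrite mulr_ge0.
- by rewrite invr_ge0; lra.
- lra.
- by rewrite lef_pV2 ?posrE; lra.
Qed.

(** Harnack's inequality: an atomic sum whose real part is small at [phi 0] is almost
    constant along [phi]. *)
Lemma hsum_selfmap L (phi : C -> C) r z : circle_atoms L -> holomorphic_self_map phi ->
  r < 1 -> cabs z <= r ->
  cabs (hsum L (phi z) - hsum L (phi 0)) <=
  2 / (1 - r) * complex.Re (hsum L (phi 0)).
Proof.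
move=> hL hphi r1 zr; have [_ pd _] := self_map_cderiv hphi.
have zd : disc z by apply/discE; exact: le_lt_trans r1.
have z1 : cabs (phi z) < 1 by exact/discE/pd.
have a1 : cabs (phi 0) < 1 by apply/discE/pd/disc0.
apply: le_trans (hsum_harnack hL z1 a1) _.
by apply: ler_wpM2r; [exact: Re_hsum_ge0|exact: harnack_factor].
Qed.

Lemma hsum_selfmap_im L (phi : C -> C) r z : circle_atoms L -> holomorphic_self_map phi ->
  r < 1 -> cabs z <= r ->
  cabs (hsum L (phi z) - ('i)%C * (complex.Im (hsum L (phi 0)))%:C%C) <=
  (2 / (1 - r) + 1) * complex.Re (hsum L (phi 0)).
Proof.
move=> hL hphi r1 zr; have h := hsum_selfmap hL hphi r1 zr.
have [ph pd pl] := self_map_cderiv hphi.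
have R0 : 0 <= complex.Re (hsum L (phi 0)).
  by apply: Re_hsum_ge0 => //; apply/discE/pd/disc0.
have -> : hsum L (phi z) - ('i)%C * (complex.Im (hsum L (phi 0)))%:C%C =
  (hsum L (phi z) - hsum L (phi 0)) + (complex.Re (hsum L (phi 0)))%:C%C.
  by rewrite [hsum L (phi 0) in X in _ = X + _]complexReIm; ring.
apply: le_trans (cabsD _ _) _; rewrite cabs_pos// mulrDl mul1r.
by rewrite lerD2r.
Qed.

(** Rigidity in the Schwarz-Pick lemma: the linear part found there is a near rotation,
    which is normalized to be a rotation. *)
Lemma near_rotation (phi : C -> C) r : holomorphic_self_map phi -> r < 1 ->
  exists2 lam, cabs lam = 1 & forall z, cabs z <= r ->
    cabs (moebius (- phi 0) (phi z) - lam * z) <=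
    (2 / (1 - r) + 1) * (1 - pick_ratio phi).
Proof.
move=> hphi r1; have [ph pd pl] := self_map_cderiv hphi.
have s0 : 0 < 1 - cabs (phi 0) ^+ 2 by apply/cabs2_lt1/discE/pd/disc0.
set l := derive1 phi 0 / (1 - cabs (phi 0) ^+ 2)%:C%C.
have lE : cabs l = pick_ratio phi.
  by rewrite /l cabsM cabsV cabs_pos// ltW.
have D1 := pick_ratio_le1 hphi; have D0 := pick_ratio_ge0 hphi.
have [c c1 cl] := rotate_to_cabs l; have c0 : c != 0 by rewrite -cabs_gt0 c1.
exists c^-1; first by rewrite cabsV c1 invr1.
move=> z zr; have zd : disc z by apply/discE; exact: le_lt_trans r1.
have h := schwarz_pick_rigid ph pd pl zd; rewrite -/l -/(pick_ratio phi) in h.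
have -> : moebius (- phi 0) (phi z) - c^-1 * z =
  (moebius (- phi 0) (phi z) - l * z) + (l - c^-1) * z by ring.
apply: le_trans (cabsD _ _) _; rewrite [leRHS]mulrDl mul1r; apply: lerD.
  apply: le_trans h _; apply: ler_wpM2r; first by rewrite subr_ge0.
  rewrite ler_pM2l// lef_pV2 ?posrE ?subr_gt0//; last by apply/discE.
  by rewrite lerD2l lerN2.
have -> : l - c^-1 = c^-1 * - ((1 - pick_ratio phi)%:C%C).
  by rewrite -lE rmorphB rmorph1 /= -cl; field.
rewrite (cabsM _ z) (cabsM c^-1) cabsV c1 invr1 mul1r cabsN cabs_pos ?subr_ge0//.
rewrite ler_piMr ?subr_ge0//; have /discE := zd; exact: ltW.
Qed.

(** The real part of the kernel is the Poisson kernel, which tends to 0 at the points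
    of the circle other than the atom. *)
Lemma Re_hsum_far L w (d : R) : circle_atoms L -> 0 < d -> cabs w < 1 ->
  (forall p, p \in L -> d <= cabs (p.2 - w)) ->
  complex.Re (hsum L w) <= mass L * ((1 - cabs w ^+ 2) / d ^+ 2).
Proof.
move=> hL d0 w1; rewrite /hsum /mass; elim: L hL => [|p L IH] hL hd.
  by rewrite !big_nil mul0r.
have [p0 p1] := hL p (mem_head _ _).
rewrite !big_cons ReD mulrDl; apply: lerD; last first.
  by apply: IH => q qL; [apply: hL|apply: hd]; rewrite inE qL orbT.
rewrite ReZ ler_wpM2l// Re_hkernel p1 expr1n ler_wpM2l//; first by rewrite ltW// cabs2_lt1.
have h := hd p (mem_head _ _).
by rewrite lef_pV2 ?posrE ?exprn_gt0// ?(lt_le_trans d0)// ler_pXn2r// nnegrE ?cabs_ge0// ltW.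
Qed.

(** Atoms placed in the coordinates of the deeper point [b] contribute little at a
    hyperbolically distant point [moebius b V], phases included, because [V] is
    then close to the direction opposite to [b], where the transported kernel nearly
    vanishes. *)
Lemma hsum_push_far L b V (d sg : R) : cabs b < 1 -> cabs V < 1 -> circle_atoms L ->
  0 < d -> cabs (1 + (b^*)%C * V) <= sg -> sg <= d / 2 ->
  (forall p, p \in L -> d <= cabs (1 + (b^*)%C * p.2)) ->
  cabs (hsum (push b L) (moebius b V)) <=
  mass L * ((4 * sg + (1 - cabs b ^+ 2)) / d ^+ 2).
Proof.
move=> b1 V1 hL d0 hsg sgd; rewrite /hsum /push /mass big_map.
elim: L hL => [|p L IH] hL hd.
  by rewrite !big_nil mul0r cabs0.
have [p0 p1] := hL p (mem_head _ _).
rewrite !big_cons mulrDl; apply: le_trans (cabsD _ _) _; apply: lerD; last first.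
  by apply: IH => q qL; [apply: hL|apply: hd]; rewrite inE qL orbT.
rewrite hkernel_moebius// cabsM cabs_pos// ler_wpM2l// i_phase//.
have h := hd p (mem_head _ _); set xi := p.2 in p1 h *.
have x0 : xi != 0 by rewrite -cabs_gt0 p1.
have e0 : xi + b != 0.
  by rewrite -[b]opprK subr_eq0; apply: cabs_lt_neq; rewrite p1 cabsN.
have v0 : xi - V != 0 by rewrite subr_eq0; apply: cabs_lt_neq; rewrite p1.
set D := 1 + (b^*)%C * xi in h *.
have D0 : D != 0 by rewrite -cabs_gt0; exact: lt_le_trans h.
have xc : (xi^*)%C = xi^-1.
  by apply: (mulfI x0); rewrite mulcJ p1 expr1n divff.
have dc : (D^*)%C = (xi + b) / xi.
  by rewrite /D conj1D rmorphM /= conjcK xc; field; rewrite x0.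
have -> : hkernel V xi + (D^-1 - xi / (xi + b)) =
    2 * xi * (1 + (b^*)%C * V) / ((xi - V) * D) - (1 - b * (b^*)%C) / (D * (D^*)%C).
  have bE : (b^*)%C = (D - 1) / xi by rewrite /D addrC addKr mulfK.
  rewrite dc /hkernel bE; field.
  by rewrite x0 D0 e0 v0.
apply: le_trans (cabsD _ _) _; rewrite cabsN [leRHS]mulrDl.
have Vd : d / 2 <= cabs (xi - V).
  have : cabs D <= cabs (1 + (b^*)%C * V) + cabs (xi - V).
    have -> : D = (1 + (b^*)%C * V) + (b^*)%C * (xi - V) by rewrite /D; ring.
    apply: le_trans (cabsD _ _) _; rewrite lerD2l cabsM cabs_conj ler_piMl ?cabs_ge0//.
    exact: ltW.
  lra.
have sg0 : 0 <= sg := le_trans (cabs_ge0 _) hsg.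
apply: lerD.
  rewrite !cabsM cabsV cabsM cabs_nat p1 mulr1.
  have -> : 4 * sg / d ^+ 2 = 2 * sg * ((d / 2)^-1 * d^-1) by field; rewrite gt_eqF.
  apply: ler_pM.
  - by rewrite mulr_ge0 ?cabs_ge0.
  - by rewrite invr_ge0 mulr_ge0 ?cabs_ge0.
  - by rewrite ler_pM2l.
  have d20 : 0 < d / 2 by rewrite divr_gt0.
  rewrite -invfM lef_pV2 ?posrE; first by apply: ler_pM => //; exact: ltW.
    by rewrite mulr_gt0// ?(lt_le_trans d20 Vd) ?(lt_le_trans d0 h).
  by rewrite mulr_gt0.
rewrite !mulcJ -(rmorph1 (real_complex R)) -rmorphB cabsM cabsV !cabs_pos ?sqr_ge0//; last first.
  by rewrite ltW// cabs2_lt1.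
rewrite ler_wpM2l//; first by rewrite ltW// cabs2_lt1.
by rewrite lef_pV2 ?posrE ?exprn_gt0// ?(lt_le_trans d0)// ler_pXn2r// nnegrE ?cabs_ge0// ltW.
Qed.

(** For [w = moebius (- b) a] the factor [1 + b^* w] equals
    [(1 - |b| ^ 2) / (1 - b^* a)], whose square is the defect of the pseudo-hyperbolic
    distance up to replacing [1 - |a| ^ 2] by the smaller [1 - |b| ^ 2]. *)
Lemma deep_direction a b : cabs a <= cabs b -> cabs b < 1 ->
  cabs (1 + (b^*)%C * moebius (- b) a) ^+ 2 <= 1 - pseudo a b ^+ 2.
Proof.
move=> ab b1; have a1 : cabs a < 1 by exact: le_lt_trans b1.
have d0 : 1 - (b^*)%C * a != 0.
  have := @moebius_den R (- b) a; rewrite cabsN raddfN /= mulNr; apply => //.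
  exact: ltW.
have -> : 1 + (b^*)%C * moebius (- b) a = (1 - cabs b ^+ 2)%:C%C / (1 - (b^*)%C * a).
  rewrite rmorphB rmorph1 /= -mulcJ /moebius raddfN /=.
  have d0' : 1 + - (b^*)%C * a != 0 by rewrite mulNr.
  by field; rewrite d0.
rewrite pseudoC pseudo_sqr// cabsM cabsV cabs_pos; last by rewrite ltW// cabs2_lt1.
rewrite exprMn exprVn; apply: ler_wpM2r; first by rewrite invr_ge0 sqr_ge0.
rewrite expr2 ler_wpM2l//; first by rewrite ltW// cabs2_lt1.
by rewrite lerD2l lerN2 ler_pXn2r// nnegrE cabs_ge0.
Qed.

Lemma push_avoid L a (B : seq C) (d : R) (A : C) : cabs a < 1 -> circle_atoms L -> 0 < d ->
  keeps_away d a B L -> moebius (- a) A \in B ->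
  forall p, p \in push a L -> p.2 != A.
Proof.
move=> a1 hL d0 hB AB p /mapP[q qL ->] /=; apply/eqP => h.
have [_ q1] := hL q qL; have [_ /(_ _ AB)] := hB q qL.
by rewrite -h moebiusK ?q1// subrr cabs0 leNgt d0.
Qed.

End TwoPoints.

(** * One stage of the construction *)

Section Stage.
Variable R : realType.
Local Notation C := R[i].
Implicit Types (a b z w xi zeta lam A : C) (r theta : R) (L P S : seq (R * C)).

(** In the coordinates centred at [phi 0] the map is nearly a rotation, so that
    [local_atoms] applies along it. *)
Lemma one_point_stage L r (eps : R) : circle_atoms L -> 0 <= r -> r < 1 -> 0 < eps ->
  exists d M : R, [/\ 0 < d, d <= 1 / 2, 0 <= M &
    forall phi (B : seq C) theta, holomorphic_self_map phi ->
      1 - cabs (phi 0) <= d -> (2 / (1 - r) + 1) * (1 - pick_ratio phi) <= d ->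
      (size B <= 3)%N ->
    exists L' (beta : R), [/\ circle_atoms L', mass L' <= M, keeps_away d (phi 0) B L',
      cexp (('i)%C * beta%:C%C) = 1 &
      forall z, cabs z <= r ->
        cabs (hsum (push (phi 0) L') (phi z) + ('i)%C * theta%:C%C -
          (hsum L z + ('i)%C * beta%:C%C)) <= eps]].
Proof.
move=> hL r0 r1 eps0; have [d [M [d0 d12 hd]]] := local_atoms hL r0 r1 eps0.
exists d, (Num.max M 0); split=> //; first by rewrite le_max lexx orbT.
move=> phi B theta hphi da dD sB; have [lam l1 hl] := near_rotation hphi r1.
have [ph pd pl] := self_map_cderiv hphi.
have a1 : cabs (phi 0) < 1 by apply/discE/pd/disc0.
have [L' [beta [cL mL bL eb hz]]] := hd _ _ B theta a1 da l1 sB.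
exists L', beta; split=> //; first by rewrite le_max mL.
move=> z zr; have zd : disc z by apply/discE; exact: le_lt_trans r1.
have [w1 hw] := hz z (moebius (- phi 0) (phi z)) zr (le_trans (hl z zr) dD).
rewrite [phi z](self_map_moebius pd zd) hsum_push//.
have -> : forall x u v w : C, x + u + v - w = x + (u + v) - w by move=> *; ring.
by rewrite -mulrDr -rmorphD.
Qed.

Lemma cexp_i_period (y : C) (beta : R) : cexp (('i)%C * beta%:C%C) = 1 ->
  cexp (- (y + ('i)%C * beta%:C%C)) = cexp (- y).
Proof. by move=> h; rewrite opprD cexpD [X in _ * X]cexpN h invr1 mulr1. Qed.

(** How a stage meets its target: the newly placed atoms produce the target up to
    an imaginary constant, in which the offset [t - al] is included; the other atoms
    contribute almost the imaginary constant [t]. *)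
Lemma stage_error (X Y T E : C) (beta al t e1 e2 : R) (d : R) :
  (forall z w : C, 0 <= complex.Re z -> cabs (z - w) < d ->
    cabs (cexp (- z) - cexp (- w)) <= 2 * cabs (z - w)) ->
  cexp (('i)%C * beta%:C%C) = 1 -> 0 <= complex.Re E -> E = X + Y ->
  cabs (X + ('i)%C * (t - al)%:C%C - (T + ('i)%C * beta%:C%C)) <= e1 ->
  cabs (Y - ('i)%C * t%:C%C) <= e2 -> e1 + e2 < d ->
  cabs (cexp (- E) - cexp (- (T + ('i)%C * al%:C%C))) <= 2 * (e1 + e2).
Proof.
move=> hd eb E0 EE h1 h2 hdd.
rewrite -(cexp_i_period (T + ('i)%C * al%:C%C) eb).
have h : cabs (E - (T + ('i)%C * al%:C%C + ('i)%C * beta%:C%C)) <= e1 + e2.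
  have -> : E - (T + ('i)%C * al%:C%C + ('i)%C * beta%:C%C) =
    (X + ('i)%C * (t - al)%:C%C - (T + ('i)%C * beta%:C%C)) + (Y - ('i)%C * t%:C%C).
    by rewrite EE rmorphB; ring.
  by apply: le_trans (cabsD _ _) _; apply: lerD.
apply: le_trans (hd _ _ E0 (le_lt_trans h hdd)) _.
by rewrite ler_pM2l.
Qed.

Definition stage_ready (d : R) (phi1 phi2 : C -> C) P : Prop :=
  [/\ 1 - cabs (phi1 0) <= d, 1 - cabs (phi2 0) <= d,
      1 - pick_ratio phi1 <= d, 1 - pick_ratio phi2 <= d &
   [/\ 1 - pseudo (phi1 0) (phi2 0) <= d, complex.Re (hsum P (phi1 0)) <= d &
      complex.Re (hsum P (phi2 0)) <= d]].

Lemma one_sub_sqr (x d : R) : 0 <= x -> x < 1 -> 1 - x <= d -> 1 - x ^+ 2 <= 2 * d.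
Proof. by move=> x0 x1 h; nra. Qed.

(** Each point receives the atoms that its own target requires.  The first family has
    small real part at the other point, so that it contributes almost a constant
    phase there, which the choice of the second family compensates; the second family
    must be small at the first point in modulus, which holds since it sits at the
    deeper point. *)
Lemma two_point_stage_ordered L1 L2 (al1 al2 r eps : R) :
  circle_atoms L1 -> circle_atoms L2 -> 0 <= r -> r < 1 -> 0 < eps ->
  exists2 d : R, 0 < d & forall phi1 phi2 P A B,
    holomorphic_self_map phi1 -> holomorphic_self_map phi2 -> circle_atoms P ->
    stage_ready d phi1 phi2 P -> cabs (phi1 0) <= cabs (phi2 0) ->
    exists S, [/\ circle_atoms S, mass S <= eps,
      forall p, p \in S -> p.2 != A /\ p.2 != B &
      forall z, cabs z <= r ->
        cabs (cexp (- hsum (P ++ S) (phi1 z)) -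
              cexp (- (hsum L1 z + ('i)%C * al1%:C%C))) <= eps /\
        cabs (cexp (- hsum (P ++ S) (phi2 z)) -
              cexp (- (hsum L2 z + ('i)%C * al2%:C%C))) <= eps].
Proof.
move=> hL1 hL2 r0 r1 eps0; have [dl dl0 hdl] := @cexp_lip R.
pose e1 := Num.min (dl / 2) (eps / 2).
have e10 : 0 < e1 by rewrite lt_min !divr_gt0.
have e1d : e1 < dl by rewrite gt_min; apply/orP; left; lra.
have e1e : 2 * e1 <= eps.
  have : e1 <= eps / 2 by rewrite ge_min lexx orbT.
  lra.
have e40 : 0 < e1 / 4 by rewrite divr_gt0.
have [d1 [M1 [d10 d12 M10 st1]]] := one_point_stage hL1 r0 r1 e40.
have [d2 [M2 [d20 d22 M20 st2]]] := one_point_stage hL2 r0 r1 e40.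
set H := 2 / (1 - r) + 1 in st1 st2 *.
have H0 : 0 <= H by rewrite addr_ge0// divr_ge0// subr_ge0 ltW.
have d1s : 0 < d1 ^+ 2 by rewrite exprn_gt0.
have d2s : 0 < d2 ^+ 2 by rewrite exprn_gt0.
have [|sg sg0 hsg] := @exists_small R
  [:: (1, d2 / 2); (H * (M2 * 4 / d2 ^+ 2), e1 / 4)].
- by move=> p; rewrite !inE => /orP[/eqP->|/eqP->] /=; rewrite !divr_gt0.
have sgd : sg <= d2 / 2 by have := hsg (1, d2 / 2); rewrite /= mul1r; apply; rewrite !inE eqxx.
have sgM : H * (M2 * 4 / d2 ^+ 2) * sg <= e1 / 4.
  by have := hsg (H * (M2 * 4 / d2 ^+ 2), e1 / 4); apply; rewrite !inE eqxx orbT.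
pose cs := [:: (1, d1); (1, d2); (H, d1); (H, d2); (H, e1 / 4);
  (H * (M1 * 2 / d1 ^+ 2), e1 / 4); (M1 * 2 / d1 ^+ 2, eps / 2);
  (M2 * 2 / d2 ^+ 2, eps / 2); (H * (M2 * 2 / d2 ^+ 2), e1 / 4); (2, sg ^+ 2)].
have [d d0 hd] : exists2 d : R, 0 < d & forall p, p \in cs -> p.1 * d <= p.2.
  apply: exists_small => p; rewrite !inE.
  by do 9?[move=> /orP[/eqP->|]] => [|||||||||/eqP->] //=; rewrite ?divr_gt0// exprn_gt0.
have dd1 : d <= d1 by have := hd (1, d1); rewrite /= mul1r; apply; rewrite !inE eqxx.
have dd2 : d <= d2 by have := hd (1, d2); rewrite /= mul1r; apply; rewrite !inE eqxx ?orbT.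
have c3 : H * d <= d1 by have := hd (H, d1); apply; rewrite !inE eqxx ?orbT.
have c4 : H * d <= d2 by have := hd (H, d2); apply; rewrite !inE eqxx ?orbT.
have c5 : H * d <= e1 / 4 by have := hd (H, e1 / 4); apply; rewrite !inE eqxx ?orbT.
have c6 : H * (M1 * 2 / d1 ^+ 2) * d <= e1 / 4.
  by have := hd (H * (M1 * 2 / d1 ^+ 2), e1 / 4); apply; rewrite !inE eqxx ?orbT.
have c7 : M1 * 2 / d1 ^+ 2 * d <= eps / 2.
  by have := hd (M1 * 2 / d1 ^+ 2, eps / 2); apply; rewrite !inE eqxx ?orbT.
have c8 : M2 * 2 / d2 ^+ 2 * d <= eps / 2.
  by have := hd (M2 * 2 / d2 ^+ 2, eps / 2); apply; rewrite !inE eqxx ?orbT.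
have c9 : H * (M2 * 2 / d2 ^+ 2) * d <= e1 / 4.
  by have := hd (H * (M2 * 2 / d2 ^+ 2), e1 / 4); apply; rewrite !inE eqxx ?orbT.
have c10 : 2 * d <= sg ^+ 2 by have := hd (2, sg ^+ 2); apply; rewrite !inE eqxx ?orbT.
clear hd cs hsg.
exists d => // phi1 phi2 P A B h1 h2 hP [da db dD1 dD2 [dp dPa dPb]] ab.
have [ph1 pd1 pl1] := self_map_cderiv h1; have [ph2 pd2 pl2] := self_map_cderiv h2.
set a := phi1 0 in da dp dPa ab *; set b := phi2 0 in db dp dPb ab *.
have a1 : cabs a < 1 by apply/discE/pd1/disc0.
have b1 : cabs b < 1 by apply/discE/pd2/disc0.
have na1 : cabs (- a) < 1 by rewrite cabsN.
have nb1 : cabs (- b) < 1 by rewrite cabsN.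
have Ha : 1 - cabs a ^+ 2 <= 2 * d by apply: one_sub_sqr => //; exact: cabs_ge0.
have Hb : 1 - cabs b ^+ 2 <= 2 * d by apply: one_sub_sqr => //; exact: cabs_ge0.
pose W := moebius (- a) b.
have W1 : cabs W < 1 by apply: moebius_disc.
have HW : 1 - cabs W ^+ 2 <= 2 * d.
  by apply: one_sub_sqr => //; [exact: cabs_ge0|rewrite -pseudoE].
have dD (x : R) d' : 1 - x <= d -> H * d <= d' -> H * (1 - x) <= d'.
  by move=> hx; apply: le_trans; rewrite ler_wpM2l.
(* the shallower point is served first *)
have [L1' [be1 [cL1 mL1 bL1 eb1 hz1]]] := st1 phi1 [:: W; moebius (- a) A; moebius (- a) B]
  (complex.Im (hsum P a) - al1) h1 (le_trans da dd1) (dD _ _ dD1 c3) isT.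
pose S1 := push a L1'.
have cS1 : circle_atoms S1 by apply: push_circle.
have S1b : complex.Re (hsum S1 b) <= M1 * 2 / d1 ^+ 2 * d.
  have -> : b = moebius a W.
    by rewrite /W -[a in moebius a]opprK moebiusK// ltW.
  have -> : complex.Re (hsum S1 (moebius a W)) = complex.Re (hsum L1' W).
    by rewrite hsum_push// ReD ReM /=; ring.
  apply: le_trans (@Re_hsum_far _ _ _ d1 cL1 d10 W1 _) _.
    by move=> p /bL1[_]; apply; rewrite !inE eqxx.
  have -> : M1 * 2 / d1 ^+ 2 * d = M1 * ((2 * d) / d1 ^+ 2) by ring.
  apply: ler_pM => //; first exact: mass_ge0.
    by rewrite divr_ge0// ltW// cabs2_lt1.
  by rewrite ler_wpM2r// invr_ge0 ltW.
have mS1 : mass S1 <= eps / 2.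
  apply: le_trans (@mass_push _ _ _ d1 a1 cL1 d10 _) _; first by move=> p /bL1[].
  apply: le_trans c7; have -> : M1 * 2 / d1 ^+ 2 * d = M1 * ((2 * d) / d1 ^+ 2) by ring.
  apply: ler_pM => //; first exact: mass_ge0.
    by rewrite divr_ge0// ltW// cabs2_lt1.
  by rewrite ler_wpM2r// invr_ge0 ltW.
(* then the deeper one, taking the first family into account *)
have [L2' [be2 [cL2 mL2 bL2 eb2 hz2]]] := st2 phi2 [:: moebius (- b) A; moebius (- b) B]
  (complex.Im (hsum P b) + complex.Im (hsum S1 b) - al2) h2 (le_trans db dd2)
  (dD _ _ dD2 c4) isT.
pose S2 := push b L2'.
have cS2 : circle_atoms S2 by apply: push_circle.
have mS2 : mass S2 <= eps / 2.
  apply: le_trans (@mass_push _ _ _ d2 b1 cL2 d20 _) _; first by move=> p /bL2[].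
  apply: le_trans c8; have -> : M2 * 2 / d2 ^+ 2 * d = M2 * ((2 * d) / d2 ^+ 2) by ring.
  apply: ler_pM => //; first exact: mass_ge0.
    by rewrite divr_ge0// ltW// cabs2_lt1.
  by rewrite ler_wpM2r// invr_ge0 ltW.
pose V := moebius (- b) a.
have V1 : cabs V < 1 by apply: moebius_disc.
have Vsg : cabs (1 + (b^*)%C * V) <= sg.
  rewrite -(@ler_pXn2r _ 2)// ?nnegrE ?cabs_ge0 ?(ltW sg0)//.
  apply: le_trans (deep_direction ab b1) _; apply: le_trans c10.
  by apply: one_sub_sqr => //; [exact: pseudo_ge0|exact: pseudo_lt1].
have S2a : H * cabs (hsum S2 a) <= e1 / 2.
  have aE : a = moebius b V by rewrite /V -[b in moebius b]opprK moebiusK// ltW.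
  have : cabs (hsum S2 a) <= mass L2' * ((4 * sg + (1 - cabs b ^+ 2)) / d2 ^+ 2).
    by rewrite [in leLHS]aE; apply: hsum_push_far => // p /bL2[].
  have : mass L2' * ((4 * sg + (1 - cabs b ^+ 2)) / d2 ^+ 2) <=
      M2 * 4 / d2 ^+ 2 * sg + M2 * 2 / d2 ^+ 2 * d.
    have -> : M2 * 4 / d2 ^+ 2 * sg + M2 * 2 / d2 ^+ 2 * d =
      M2 * ((4 * sg + 2 * d) / d2 ^+ 2) by ring.
    apply: ler_pM => //; first exact: mass_ge0.
      apply: divr_ge0; last exact: ltW.
      by have := cabs2_lt1 b1; have := ltW sg0; clear; lra.
    by rewrite ler_wpM2r ?invr_ge0 ?(ltW d2s)// lerD2l.
  move=> u1 u2; have := ler_wpM2l H0 (le_trans u2 u1).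
  rewrite mulrDr [X in _ <= X + _]mulrA [X in _ <= _ + X]mulrA => u3.
  by apply: le_trans u3 _; move: sgM c9; clear; lra.
exists (S1 ++ S2); split.
- exact: circle_atoms_cat.
- by rewrite /mass big_cat /= -/(mass S1) -/(mass S2); move: mS1 mS2; clear; lra.
- move=> p; rewrite mem_cat => /orP[] pS.
    split; first by apply: (push_avoid a1 cL1 d10 bL1) pS; rewrite !inE eqxx ?orbT.
    by apply: (push_avoid a1 cL1 d10 bL1) pS; rewrite !inE eqxx ?orbT.
  split; first by apply: (push_avoid b1 cL2 d20 bL2) pS; rewrite !inE eqxx ?orbT.
  by apply: (push_avoid b1 cL2 d20 bL2) pS; rewrite !inE eqxx ?orbT.
move=> z zr; have zd : disc z by apply/discE; exact: le_lt_trans r1.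
have pz1 : cabs (phi1 z) < 1 by exact/discE/pd1.
have pz2 : cabs (phi2 z) < 1 by exact/discE/pd2.
have cE : circle_atoms (P ++ S1 ++ S2).
  by apply: circle_atoms_cat => //; exact: circle_atoms_cat.
have Pa := hsum_selfmap_im hP h1 r1 zr; have Pb := hsum_selfmap_im hP h2 r1 zr.
have S1z := hsum_selfmap_im cS1 h2 r1 zr; have S2z := hsum_selfmap_im cS2 h1 r1 zr.
have {}Pa : cabs (hsum P (phi1 z) - ('i)%C * (complex.Im (hsum P a))%:C%C) <= e1 / 4.
  by apply: le_trans Pa _; apply: le_trans c5; rewrite ler_wpM2l.
have {}Pb : cabs (hsum P (phi2 z) - ('i)%C * (complex.Im (hsum P b))%:C%C) <= e1 / 4.
  by apply: le_trans Pb _; apply: le_trans c5; rewrite ler_wpM2l.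
have {}S1z : cabs (hsum S1 (phi2 z) - ('i)%C * (complex.Im (hsum S1 b))%:C%C) <= e1 / 4.
  apply: le_trans S1z _; apply: le_trans c6.
  by rewrite -[leRHS]mulrA ler_wpM2l.
have {}S2z : cabs (hsum S2 (phi1 z)) <= e1 / 2.
  have h := hsum_selfmap cS2 h1 r1 zr; rewrite -/a in h.
  apply: le_trans S2a.
  have -> : hsum S2 (phi1 z) = (hsum S2 (phi1 z) - hsum S2 a) + hsum S2 a by ring.
  apply: le_trans (cabsD _ _) _; rewrite [leRHS]mulrDl mul1r lerD2r.
  apply: le_trans h _; rewrite ler_wpM2l//; first by rewrite divr_ge0// subr_ge0 ltW.
  by apply: le_trans (ler_norm _) _; exact: Re_le_cabs.
split.
  apply: le_trans (@stage_error _ (hsum P (phi1 z) + hsum S2 (phi1 z)) _ _ _ _ _ _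
    (3 * e1 / 4) _ hdl eb1 _ _ (hz1 z zr) _ _) _.
  - exact: Re_hsum_ge0.
  - by rewrite !hsum_cat; ring.
  - rewrite addrAC; apply: le_trans (cabsD _ _) _.
    have -> : 3 * e1 / 4 = e1 / 4 + e1 / 2 by field.
    exact: lerD.
  - by apply: le_lt_trans e1d; move: e10; clear; lra.
  - by apply: le_trans e1e; move: e10; clear; lra.
apply: le_trans (@stage_error _ (hsum P (phi2 z) + hsum S1 (phi2 z)) _ _ _ _ _ _
    (e1 / 2) _ hdl eb2 _ _ (hz2 z zr) _ _) _.
- exact: Re_hsum_ge0.
- by rewrite !hsum_cat; ring.
- rewrite rmorphD mulrDr opprD addrACA; apply: le_trans (cabsD _ _) _.
  have -> : e1 / 2 = e1 / 4 + e1 / 4 by field.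
  exact: lerD.
- by apply: le_lt_trans e1d; move: e10; clear; lra.
- by apply: le_trans e1e; move: e10; clear; lra.
Qed.

Lemma two_point_stage L1 L2 (al1 al2 r eps : R) :
  circle_atoms L1 -> circle_atoms L2 -> 0 <= r -> r < 1 -> 0 < eps ->
  exists2 d : R, 0 < d & forall phi1 phi2 P A B,
    holomorphic_self_map phi1 -> holomorphic_self_map phi2 -> circle_atoms P ->
    stage_ready d phi1 phi2 P ->
    exists S, [/\ circle_atoms S, mass S <= eps,
      forall p, p \in S -> p.2 != A /\ p.2 != B &
      forall z, cabs z <= r ->
        cabs (cexp (- hsum (P ++ S) (phi1 z)) -
              cexp (- (hsum L1 z + ('i)%C * al1%:C%C))) <= eps /\
        cabs (cexp (- hsum (P ++ S) (phi2 z)) -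
              cexp (- (hsum L2 z + ('i)%C * al2%:C%C))) <= eps].
Proof.
move=> hL1 hL2 r0 r1 eps0.
have [d d0 hd] := two_point_stage_ordered al1 al2 hL1 hL2 r0 r1 eps0.
have [d' d'0 hd'] := two_point_stage_ordered al2 al1 hL2 hL1 r0 r1 eps0.
exists (Num.min d d'); first by rewrite lt_min d0.
move=> phi1 phi2 P A B h1 h2 hP [].
rewrite !le_min => /andP[u1 v1] /andP[u2 v2] /andP[u3 v3] /andP[u4 v4].
move=> [/andP[u5 v5] /andP[u6 v6] /andP[u7 v7]].
have [ab|/ltW ba] := leP (cabs (phi1 0)) (cabs (phi2 0)).
  exact: hd.
have [|S [S1 S2 S3 S4]] := hd' phi2 phi1 P A B h2 h1 hP _ ba.
  by split=> //; rewrite pseudoC.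
by exists S; split=> // z zr; have [] := S4 z zr.
Qed.

End Stage.

(** * Singular measures from summable families of atoms *)

Section AtomicMeasure.
Variable R : realType.
Local Notation C := R[i].
Local Notation T := (measurableTypeR R).
Implicit Types (z w : C) (L P S : seq (R * C)) (m : {measure set T -> \bar R}).
Let D : set T := `[0, 2 * pi[%classic.

Let mD : measurable D. Proof. exact: measurable_itv. Qed.

(** Measures on the circle live on [0, 2 pi[, so that atoms are located by their angles. *)
Definition angle (xi : C) : R := xget 0 [set t | 0 <= t < 2 * pi /\ cis t = xi].

Lemma angleP xi : cabs xi = 1 -> 0 <= angle xi < 2 * pi /\ cis (angle xi) = xi.
Proof.
move=> x1; have [t t0 tx] := cis_surj x1.
by apply: (@xgetPex R 0 [set t | 0 <= t < 2 * pi /\ cis t = xi]); exists t.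
Qed.

Definition atom (p : R * C) : {measure set T -> \bar R} :=
  mscale (`|p.1|%:nng) (@dirac _ T (angle p.2) R).

Definition atoms L : {measure set T -> \bar R} :=
  msum (fun i => atom (nth (0, 1) L i)) (size L).

Lemma atomsE L A : atoms L A = (\sum_(p <- L) atom p A)%E.
Proof. by rewrite /= /msum (big_nth (0, 1)) big_mkord. Qed.

Lemma atomsT L : circle_atoms L -> atoms L setT = (mass L)%:E.
Proof.
move=> hL; rewrite atomsE /mass -sumEFin big_seq [RHS]big_seq.
apply: eq_bigr => p /hL[p0 _].
by rewrite /atom /= /mscale /= diracT mule1 ger0_norm.
Qed.

Lemma atoms_cons p L : atoms (p :: L) = measure_add (atom p) (atoms L) :> (set T -> \bar R).
Proof. by apply/funext => A; rewrite measure_addE !atomsE big_cons. Qed.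

Lemma cintegral_atom p (f : R -> C) : cabs p.2 = 1 -> 0 <= p.1 ->
  measurable_fun D (fun t => complex.Re (f t)) ->
  measurable_fun D (fun t => complex.Im (f t)) ->
  cintegral (atom p) D f = p.1%:C%C * f (angle p.2).
Proof.
move=> x1 p0 m1 m2; have [ht _] := angleP x1.
have h (g : T -> R) : measurable_fun D g ->
    Rintegral (atom p) D g = p.1 * g (angle p.2).
  move=> mg; rewrite /Rintegral integralE.
  have mg' : measurable_fun D (EFin \o g) by exact/measurable_EFinP.
  rewrite !ge0_integral_mscale//; [|exact: measurable_funeneg|exact: measurable_funepos].
  rewrite !integral_dirac//; [|exact: measurable_funeneg|exact: measurable_funepos].
  have aD : angle p.2 \in D by rewrite inE /D /= in_itv.
  rewrite !diracE aD !mul1e /= funeposE funenegE /=.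
  rewrite -!EFin_max -!EFinM -EFinB /= ger0_norm// -mulrBr; congr (_ * _).
  move: (g (angle p.2)) => y; have [h|h] := leP 0 y.
    by rewrite max_r ?subr0// oppr_le0.
  by rewrite max_l ?oppr_ge0 ?(ltW h)//; ring.
by apply: complex_ext; rewrite ?ReZ ?ImZ /cintegral /= h.
Qed.

Lemma eq_measure_cintegral m1 m2 (f : R -> C) : m1 = m2 :> (set T -> \bar R) ->
  cintegral m1 D f = cintegral m2 D f.
Proof. by move=> h; rewrite /cintegral /Rintegral h. Qed.

Lemma cintegral_measure_add m1 m2 (f : R -> C) : cintegrable m1 D f -> cintegrable m2 D f ->
  cintegral (measure_add m1 m2) D f = cintegral m1 D f + cintegral m2 D f.
Proof.
move=> [f1 g1] [f2 g2].
have h (g : T -> R) : m1.-integrable D (EFin \o g) -> m2.-integrable D (EFin \o g) ->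
    Rintegral (measure_add m1 m2) D g = Rintegral m1 D g + Rintegral m2 D g.
  move=> i1 i2; rewrite /Rintegral integral_measure_add//.
  by rewrite fineD// integrable_fin_num.
by apply: complex_ext; rewrite ?ReD ?ImD /cintegral /= h.
Qed.

Lemma hkernel_measurable z : cabs z < 1 ->
  measurable_fun D (fun t => complex.Re (hkernel z (cis t))) /\
  measurable_fun D (fun t => complex.Im (hkernel z (cis t))).
Proof.
move=> z1; apply: (@continuous_measurable _ (fun t => hkernel z (cis t)) D) => // a b.
apply: (@seg_continuous_cis _ (hkernel z)) => w w1.
by apply: tends_hkernel; apply: cabs_lt_neq; rewrite w1.
Qed.

Lemma hkernel_integrable m z : (m D < +oo)%E -> cabs z < 1 ->
  cintegrable m D (fun t => hkernel z (cis t)).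
Proof.
move=> h z1; have [m1 m2] := hkernel_measurable z1.
apply: (@cintegrable_bounded _ _ _ m D mD h _ (2 / (1 - cabs z)) m1 m2) => t _.
by apply: cabs_hkernel => //; exact: cabs_cis.
Qed.

Lemma atom_fin p : (atom p D < +oo)%E.
Proof. by rewrite /atom /= /mscale /= diracE lte_mul_pinfty// ltry. Qed.

Lemma atoms_fin L : (atoms L D < +oo)%E.
Proof. by rewrite atomsE; apply: lte_sum_pinfty => p _; exact: atom_fin. Qed.

Lemma cintegral_atoms L z : circle_atoms L -> cabs z < 1 ->
  cintegral (atoms L) D (fun t => hkernel z (cis t)) = hsum L z.
Proof.
move=> hL z1; have [m1 m2] := hkernel_measurable z1.
rewrite /hsum; elim: L hL => [|p L IH] hL.
  rewrite big_nil /cintegral /Rintegral.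
  have -> : atoms [::] = mzero :> (set T -> \bar R) by exact: msum_mzero.
  by rewrite !integral_measure_zero.
have [p0 p1] := hL p (mem_head _ _).
rewrite big_cons (eq_measure_cintegral _ (atoms_cons p L)) cintegral_measure_add; last 2 first.
- by apply: hkernel_integrable => //; exact: atom_fin.
- by apply: hkernel_integrable => //; exact: atoms_fin.
rewrite IH; last by move=> q qL; apply: hL; rewrite inE qL orbT.
by rewrite cintegral_atom//; have [_ ->] := angleP p1.
Qed.

Section Series.
Variables (S : nat -> seq (R * C)) (eta : nat -> R).
Hypothesis S_circle : forall k, circle_atoms (S k).
Hypothesis eta_ge0 : forall k, 0 <= eta k.
Hypothesis S_mass : forall k, mass (S k) + eta k.+1 <= eta k.

Definition tail n : set T -> \bar R := mseries (fun k => atoms (S k)) n.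

HB.instance Definition _ n := Measure.on (tail n).

Lemma tailT n : (tail n setT <= (eta n)%:E)%E.
Proof.
rewrite /tail /mseries.
apply: lime_le; first by apply: is_cvg_nneseries => k _ _; exact: measure_ge0.
apply: nearW => N; have [Nn|nN] := leqP N n.
  by rewrite big_geq// lee_fin.
rewrite -(subnKC (ltnW nN)).
suff h d : (\sum_(n <= i < n + d) atoms (S i) setT <= (eta n - eta (n + d))%:E)%E.
  by apply: le_trans (h _) _; rewrite lee_fin gerBl.
elim: d => [|d IH]; first by rewrite addn0 big_geq// subrr.
rewrite addnS big_nat_recr ?leq_addr//=; apply: le_trans (leeD IH (lexx _)) _.
rewrite -/(atoms _) atomsT// -EFinD lee_fin.
by have := S_mass (n + d); lra.
Qed.

Lemma tail_fin n : fin_num_fun (tail n).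
Proof.
move=> U mU; rewrite ge0_fin_numE ?measure_ge0//.
apply: le_lt_trans (le_measure _ _ _ (@subsetT _ U)) _; rewrite ?inE//.
by apply: le_lt_trans (tailT n) _; rewrite ltry.
Qed.

HB.instance Definition _ n := @Measure_isFinite.Build _ _ _ (tail n) (@tail_fin n).

Lemma tail_add n : tail n = measure_add (atoms (S n)) (tail n.+1) :> (set T -> \bar R).
Proof.
apply/funext => A; rewrite measure_addE /tail /mseries (@nneseries_split _ _ n 1)//.
by rewrite addn1 big_nat1.
Qed.

Lemma herglotz_tail n z : cabs z < 1 ->
  herglotz_integral (tail n) z = hsum (S n) z + herglotz_integral (tail n.+1) z.
Proof.
move=> z1; rewrite !herglotz_integralE (eq_measure_cintegral _ (tail_add n)).
rewrite cintegral_measure_add; last 2 first.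
- by apply: hkernel_integrable => //; exact: atoms_fin.
- by apply: hkernel_integrable => //; rewrite ltey_eq fin_num_measure.
by rewrite cintegral_atoms.
Qed.

Lemma fine_tail n : fine (tail n D) <= eta n.
Proof.
rewrite -lee_fin fineK ?fin_num_measure//; apply: le_trans (tailT n).
by apply: le_measure; rewrite ?inE//; exact: subsetT.
Qed.

Lemma tail_singular n : mutually_singular (tail n) (@lebesgue_measure R).
Proof.
pose A : set T := \bigcup_k [set angle p.2 | p in [set` S k]].
have cA : countable A.
  apply: bigcup_countable => // k _; apply: finite_set_countable.
  exact: finite_image (finite_seq (S k)).
have mA : measurable A.
  by apply: countable_measurable => // t; exact: measurable_set1.
exists (~` A); split; first exact: measurableC.
  rewrite /tail /mseries eseries0// => k _ _; rewrite atomsE big_seq big1// => p pS.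
  rewrite /atom /= /mscale /= diracE memNset ?mule0//.
  by move=> []; exists k => //; exists p.
by rewrite setCK; exact: countable_lebesgue_measure0.
Qed.

(** The measures carried by the tails of the family are kept as well: their Herglotz
    integrals are the errors made when only the first stages are considered. *)
Lemma atomic_measure : exists nu : nat -> {finite_measure set T -> \bar R},
  [/\ forall n, mutually_singular (nu n) (@lebesgue_measure R),
      forall n, fine (nu n D) <= eta n &
      forall n z, cabs z < 1 ->
        herglotz_integral (nu n) z = hsum (S n) z + herglotz_integral (nu n.+1) z].
Proof.
exists (fun n => tail n : {finite_measure set T -> \bar R}); split.
- exact: tail_singular.
- exact: fine_tail.
- exact: herglotz_tail.
Qed.

End Series.

End AtomicMeasure.

(** * The universal measure *)

Section Construction.
Variable R : realType.
Local Notation C := R[i].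
Local Notation T := (measurableTypeR R).
Local Notation finite_measure := ({finite_measure set T -> \bar R}).
Implicit Types (z w : C) (L P S : seq (R * C)) (nu : finite_measure).
Let D : set T := `[0, 2 * pi[%classic.

(** The mass controls the Herglotz integral at [phi 0], and Harnack's inequality carries
    the bound over to the whole image of the disc of radius [r]. *)
Lemma small_mass_perturb (phi : C -> C) (r eps : R) : holomorphic_self_map phi ->
  r < 1 -> 0 < eps -> exists2 eta : R, 0 < eta & forall nu L z,
    fine (nu D) <= eta -> circle_atoms L -> cabs z <= r ->
    cabs (cexp (- (hsum L (phi z) + herglotz_integral nu (phi z))) -
          cexp (- hsum L (phi z))) <= eps.
Proof.
move=> hphi r1 eps0; have [dl dl0 hdl] := @cexp_lip R.
have [_ pd _] := self_map_cderiv hphi.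
have a1 : cabs (phi 0) < 1 by apply/discE/pd/disc0.
have r0 : 0 < 1 - r by rewrite subr_gt0.
have q0 : 0 < 1 - cabs (phi 0) by rewrite subr_gt0.
pose K := (2 / (1 - r) + 1) * (2 / (1 - cabs (phi 0))).
have K0 : 0 < K by rewrite mulr_gt0 ?addr_gt0 ?divr_gt0.
pose e := Num.min (dl / 2) (eps / 2).
have e0 : 0 < e by rewrite lt_min !divr_gt0.
have [ed ee] : e <= dl / 2 /\ e <= eps / 2 by rewrite !ge_min !lexx orbT.
exists (e / K); first by rewrite divr_gt0.
move=> nu L z hnu hL zr.
have z1 : cabs (phi z) < 1 by apply/discE/pd/discE; exact: le_lt_trans r1.
set H := herglotz_integral nu.
have hH : cabs (H (phi z)) <= e.
  have -> : H (phi z) = (H (phi z) - H (phi 0)) + H (phi 0) by ring.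
  apply: le_trans (cabsD _ _) _.
  have -> : e = K * (e / K) by field; rewrite gt_eqF.
  have H0 : cabs (H (phi 0)) <= 2 / (1 - cabs (phi 0)) * (e / K).
    apply: le_trans (cabs_herglotz nu a1) _; rewrite ler_wpM2l//.
    by rewrite divr_ge0// ltW.
  have h : cabs (H (phi z) - H (phi 0)) <= 2 / (1 - r) * cabs (H (phi 0)).
    apply: le_trans (herglotz_harnack nu z1 a1) _; apply: ler_pM.
    - have p1 := pseudo_lt1 a1 z1; have p0 := pseudo_ge0 (phi 0) (phi z).
      by rewrite divr_ge0 ?mulr_ge0// subr_ge0 ltW.
    - exact: Re_herglotz_ge0.
    - exact: harnack_factor.
    - by apply: le_trans (ler_norm _) _; exact: Re_le_cabs.
  rewrite -mulrA; apply: (@le_trans _ _ ((2 / (1 - r) + 1) * cabs (H (phi 0)))).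
    by rewrite [leRHS]mulrDl mul1r lerD2r.
  by rewrite ler_wpM2l// addr_ge0// divr_ge0// ltW.
have h : cabs (hsum L (phi z) + H (phi z) - hsum L (phi z)) <= e by rewrite addrC addKr.
apply: le_trans (hdl _ _ _ _) _.
- by rewrite ReD addr_ge0 ?Re_hsum_ge0 ?Re_herglotz_ge0.
- by apply: le_lt_trans h _; apply: le_lt_trans ed _; rewrite ltr_pdivrMr// mulr2n mulrDr mulr1 ltrDl.
- apply: (@le_trans _ _ (2 * e)); first by rewrite ler_pM2l.
  by rewrite mulrC -ler_pdivlMr.
Qed.

Variables (phi1 phi2 : nat -> C -> C) (A B : C).
Hypothesis phi1_self : forall n, holomorphic_self_map (phi1 n).
Hypothesis phi2_self : forall n, holomorphic_self_map (phi2 n).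

Definition avoids P : Prop := forall p, p \in P -> p.2 != A /\ p.2 != B.

Hypothesis ready : forall P (d : R), circle_atoms P -> avoids P -> 0 < d ->
  exists n, stage_ready d (phi1 n) (phi2 n) P.

Definition close_at (c1 c2 : code) (r eps : R) n (f : C -> C) : Prop :=
  forall z, cabs z <= r -> cabs (f (phi1 n z) - code_fun c1 z) <= eps /\
    cabs (f (phi2 n z) - code_fun c2 z) <= eps.

Lemma stage_step (c1 c2 : code) (r eps eta : R) P :
  0 <= r -> r < 1 -> 0 < eps -> 0 < eta -> circle_atoms P -> avoids P ->
  exists n S eta', [/\ circle_atoms S, avoids S, 0 < eta', mass S + eta' <= eta &
    forall nu, fine (nu D) <= eta' -> close_at c1 c2 r eps n
      (fun w => cexp (- (hsum (P ++ S) w + herglotz_integral nu w)))].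
Proof.
move=> r0 r1 eps0 eta0 hP aP.
pose e := Num.min (eps / 2) (eta / 2).
have e0 : 0 < e by rewrite lt_min !divr_gt0.
have [d d0 hd] := two_point_stage (code_phase R c1) (code_phase R c2)
  (@code_atoms_circle R c1) (@code_atoms_circle R c2) r0 r1 e0.
have [n hn] := ready hP aP d0.
have [S [hS mS aS hz]] := hd _ _ P A B (phi1_self n) (phi2_self n) hP hn.
have eps20 : 0 < eps / 2 by rewrite divr_gt0.
have [t1 t10 ht1] := small_mass_perturb (phi1_self n) r1 eps20.
have [t2 t20 ht2] := small_mass_perturb (phi2_self n) r1 eps20.
pose eta' := Num.min (eta / 2) (Num.min t1 t2).
have [u0 u1 u2] : [/\ eta' <= eta / 2, eta' <= t1 & eta' <= t2].
  by rewrite /eta' !ge_min !lexx !orbT.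
have cPS : circle_atoms (P ++ S) by exact: circle_atoms_cat.
have [eE eT] : e <= eps / 2 /\ e <= eta / 2 by rewrite !ge_min !lexx orbT.
exists n, S, eta'; split=> //.
- by rewrite !lt_min t10 t20 divr_gt0.
- by rewrite [leRHS]splitr; apply: lerD u0; exact: le_trans eT.
move=> nu hnu z zr; have [z1 z2] := hz z zr.
have v1 := ht1 nu _ z (le_trans hnu u1) cPS zr.
have v2 := ht2 nu _ z (le_trans hnu u2) cPS zr.
have tri (x y t : C) : cabs (x - y) <= eps / 2 -> cabs (y - t) <= e -> cabs (x - t) <= eps.
  move=> xy yt; have -> : x - t = (x - y) + (y - t) by ring.
  by apply: le_trans (cabsD _ _) _; rewrite [leRHS]splitr; apply: lerD => //; exact: le_trans eE.
by split; [exact: tri v1 z1|exact: tri v2 z2].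
Qed.

(** The construction of the inner function: each stage adds finitely many atoms
    and fixes how little mass all the later stages together may add. *)
Lemma universal_measure : exists nu : finite_measure,
  mutually_singular nu (@lebesgue_measure R) /\
  forall (c1 c2 : code) (m : nat), exists n,
    close_at c1 c2 (1 - m.+1%:R^-1) (m.+1%:R^-1) n
      (fun w => cexp (- herglotz_integral nu w)).
Proof.
pose task : Type := (code * code * nat)%type.
pose target k : task := odflt ((0, 0, [::], 0), (0, 0, [::], 0), 0)%N (unpickle k).
pose state : Type := (nat * seq (R * C) * R)%type.
pose good (x : seq (R * C) * R) := [/\ circle_atoms x.1, avoids x.1 & 0 < x.2].
pose step (k : nat) (x : seq (R * C) * R) (y : state) :=
  [/\ circle_atoms y.1.2, avoids y.1.2, 0 < y.2, mass y.1.2 + y.2 <= x.2 &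
    forall nu, fine (nu D) <= y.2 ->
      close_at (target k).1.1 (target k).1.2 (1 - (target k).2.+1%:R^-1)
        ((target k).2.+1%:R^-1) y.1.1
        (fun w => cexp (- (hsum (x.1 ++ y.1.2) w + herglotz_integral nu w)))].
have ex (kx : nat * (seq (R * C) * R)) : exists y, good kx.2 -> step kx.1 kx.2 y.
  have [[g1 g2 g3]|no] := pselect (good kx.2); last by exists (0%N, [::], 0).
  have m0 : 0 < (target kx.1).2.+1%:R^-1 :> R by rewrite invr_gt0.
  have m1 : (target kx.1).2.+1%:R^-1 <= 1 :> R by rewrite invf_le1// ler1n.
  have [|||n [S [eta' hs]]] := @stage_step (target kx.1).1.1 (target kx.1).1.2
    (1 - (target kx.1).2.+1%:R^-1) ((target kx.1).2.+1%:R^-1) kx.2.2 kx.2.1 _ _ _ g3 g1 g2.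
  - by rewrite subr_ge0.
  - by rewrite ltrBlDr ltrDl.
  - by [].
  by exists (n, S, eta').
have [F hF] := choice ex.
pose next k (x : seq (R * C) * R) := (x.1 ++ (F (k, x)).1.2, (F (k, x)).2).
pose st := fix st k := if k is j.+1 then next j (st j) else ([::], 1 : R).
have stS k : st k.+1 = next k (st k) by [].
have gst k : good (st k).
  elim: k => [|k IH]; first by split.
  have [s1 s2 s3 _ _] := hF (k, st k) IH; have [g1 g2 _] := IH.
  rewrite stS; split=> //=; first exact: circle_atoms_cat.
  by move=> p; rewrite mem_cat => /orP[/g2|/s2].
pose S k := (F (k, st k)).1.2; pose eta k := (st k).2.
have hS k : circle_atoms (S k) by have [] := hF (k, st k) (gst k).
have eta0 k : 0 <= eta k by have [_ _ /ltW] := gst k.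
have mS k : mass (S k) + eta k.+1 <= eta k by have [] := hF (k, st k) (gst k).
have [nu [nus num nuH]] := atomic_measure hS eta0 mS.
exists (nu 0%N); split=> // c1 c2 m.
have HE k z : cabs z < 1 ->
    herglotz_integral (nu 0%N) z = hsum (st k).1 z + herglotz_integral (nu k) z.
  move=> z1; elim: k => [|k IH]; first by rewrite /= /hsum big_nil add0r.
  by rewrite IH nuH// stS /= hsum_cat addrA.
have [k tk] : exists k, target k = (c1, c2, m).
  by exists (pickle (c1, c2, m)); rewrite /target pickleK.
have [_ _ _ _ hk] := hF (k, st k) (gst k).
exists (F (k, st k)).1.1 => z zr.
have := hk (nu k.+1) (num k.+1); rewrite tk => /(_ z zr).
have z1 : cabs z < 1 by apply: le_lt_trans zr _; rewrite ltrBlDr ltrDl invr_gt0.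
have pd1 n : cabs (phi1 n z) < 1.
  by apply/discE; have [_ h] := phi1_self n; apply: h; exact/discE.
have pd2 n : cabs (phi2 n z) < 1.
  by apply/discE; have [_ h] := phi2_self n; apply: h; exact/discE.
by rewrite !(HE k.+1)// stS.
Qed.

End Construction.

(** * Density of the orbit and the equivalence *)

Section Density.
Variable R : realType.
Local Notation C := R[i].
Local Notation CD := {family @disc_compact R, C -> C}.
Local Notation T := (measurableTypeR R).
Local Notation finite_measure := ({finite_measure set T -> \bar R}).
Implicit Types (z w : C) (r e : R).

Lemma entourage_cabsP (E : set (C * C)) : entourage E ->
  exists2 e, 0 < e & forall x y, cabs (x - y) < e -> E (x, y).
Proof.
rewrite -entourage_ballE => -[e /= e0 h].
exists (complex.Re e); first by move: e0; rewrite ltcE => /andP[].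
move=> x y xy; apply: h => /=; rewrite /ball /= normCE.
move: e0 xy; rewrite ltcE /= => /andP[/eqP ei _] xy.
by rewrite ltcE /= -ei eqxx.
Qed.

Lemma disc_compact_radius (K : set C) : disc_compact K ->
  exists2 r, r < 1 & forall z, K z -> cabs z <= r.
Proof.
move=> [cK Kd]; have [->|/set0P K0] := eqVneq K set0; first by exists 0.
have [|c cK' hc] := @compact_EVT_max C R (@cabs R) K K0 cK.
  apply: continuous_subspaceT => z; exact: (@cvg_cabs _ _ (nbhs z) (nbhs_filter z) id z (@cvg_id _ _)).
exists (cabs c); first by apply/discE/Kd; exact: set_mem.
by move=> z Kz; apply: hc; exact: mem_set.
Qed.

(** The discs of radius less than 1 exhaust the disc, so that they suffice for
    the topology of uniform convergence on compact subsets. *)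
Lemma cvg_disc_compact (u : nat -> C -> C) (g : C -> C) :
  (forall r e, r < 1 -> 0 < e -> exists N, forall n, (N <= n)%N ->
    forall z, cabs z <= r -> cabs (g z - u n z) < e) ->
  (u n : CD) @[n --> \oo] --> (g : CD).
Proof.
move=> h; rewrite -fam_cvgE; apply/fam_cvgP => K /disc_compact_radius[r r1 hr].
move=> P /uniform_nbhs[E [/entourage_cabsP[e e0 he] hE]].
have [N hN] := h r e r1 e0; exists N => // n /= Nn; apply: hE => z Kz.
by apply: he; apply: hN => //; exact: hr.
Qed.

Lemma inv_small e : 0 < e -> exists N : nat, forall n, (N <= n)%N -> n.+1%:R^-1 < e.
Proof.
move=> e0; exists (Num.bound e^-1) => n Nn.
have h : e^-1 < n.+1%:R.
  apply: lt_le_trans (_ : (Num.bound e^-1)%:R <= _); last by rewrite ler_nat leqW.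
  by apply: archi_boundP; rewrite invr_ge0 ltW.
by rewrite -[e]invrK ltf_pV2 ?posrE ?invr_gt0.
Qed.

Variables (phi1 phi2 : nat -> C -> C).

(** For each [m] the codes are chosen within [1 / (m + 1)] of the given pair, so that the
    orbit elements that realize them converge to the pair. *)
Lemma universal_closure (f : C -> C) :
  (forall (c1 c2 : code) (m : nat), exists n,
    close_at phi1 phi2 c1 c2 (1 - m.+1%:R^-1) (m.+1%:R^-1) n f) ->
  @classS R `*` @classS R `<=`
    closure [set g : CD * CD |
      exists n, g = (comp_op (phi1 n) f, comp_op (phi2 n) f)].
Proof.
move=> hf [g1 g2] [/= hg1 hg2].
have ex (m : nat) : exists n, forall z, cabs z <= 1 - m.+1%:R^-1 ->
    cabs (g1 z - f (phi1 n z)) <= 2 * m.+1%:R^-1 /\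
    cabs (g2 z - f (phi2 n z)) <= 2 * m.+1%:R^-1.
  have m0 : 0 < m.+1%:R^-1 :> R by rewrite invr_gt0.
  have m1 : m.+1%:R^-1 <= 1 :> R by rewrite invf_le1// ler1n.
  have r0 : 0 <= 1 - m.+1%:R^-1 :> R by rewrite subr_ge0.
  have r1 : 1 - m.+1%:R^-1 < 1 :> R by rewrite ltrBlDr ltrDl.
  have [c1 h1] := code_dense hg1 r0 r1 m0.
  have [c2 h2] := code_dense hg2 r0 r1 m0.
  have [n hn] := hf c1 c2 m; exists n => z zr; have [k1 k2] := hn z zr.
  have tri (x y t : C) (s : R) : cabs (x - t) <= s -> cabs (y - t) <= s -> cabs (x - y) <= 2 * s.
    move=> xt yt; have -> : x - y = (x - t) - (y - t) by ring.
    apply: le_trans (cabsD _ _) _; rewrite cabsN mulr2n mulrDl mul1r.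
    exact: lerD.
  by split; [exact: tri (h1 z zr) k1|exact: tri (h2 z zr) k2].
have [n hn] := choice ex.
have conv (g : C -> C) (phi : nat -> C -> C) :
    (forall m z, cabs z <= 1 - m.+1%:R^-1 -> cabs (g z - f (phi (n m) z)) <= 2 * m.+1%:R^-1) ->
    (comp_op (phi (n m)) f : CD) @[m --> \oo] --> (g : CD).
  move=> h; apply: cvg_disc_compact => r e r1 e0.
  have q0 : 0 < Num.min (1 - r) (e / 2) by rewrite lt_min subr_gt0 r1 divr_gt0.
  have [N hN] := inv_small q0; exists N => m /hN; rewrite lt_min => /andP[u v] z zr.
  apply: le_lt_trans (h m z _) _.
    by apply: le_trans zr _; rewrite lerBrDr addrC -lerBrDr ltW.
  by rewrite mulrC -ltr_pdivlMr.
have c1 := conv g1 phi1 (fun m z zr => (hn m z zr).1).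
have c2 := conv g2 phi2 (fun m z zr => (hn m z zr).2).
move=> B [[Q1 Q2] /= [n1 n2] sub].
have [N1 _ hN1] := c1 Q1 n1; have [N2 _ hN2] := c2 Q2 n2.
pose N := maxn N1 N2.
exists (comp_op (phi1 (n N)) f, comp_op (phi2 (n N)) f); split; first by exists (n N).
apply: sub; split=> /=.
  by apply: hN1; rewrite /= leq_maxl.
by apply: hN2; rewrite /= leq_maxr.
Qed.

Lemma singular_inner_classS (nu : finite_measure) :
  @classS R (fun z => cexp (- herglotz_integral nu z)).
Proof.
split.
  move=> z /discE z1; have [l hl _] := cderiv_herglotz nu z1.
  by have [] := cderiv_derivable (cderiv_comp (cderivN hl) (cderiv_cexp _)).
left=> z /discE z1; rewrite normCE.
have h := Re_herglotz_ge0 nu z1.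
rewrite cabs_cexp ReN -[X in X < _]/((0 : R)%:C%C) -[X in _ <= X]/((1 : R)%:C%C).
by rewrite ltcR lecR expR_gt0 -expR0 ler_expR oppr_le0.
Qed.

End Density.

Section Readiness.
Variable R : realType.
Local Notation C := R[i].
Implicit Types (z w a : C) (r e d : R) (P : seq (R * C)).

(** A finite atomic sum has vanishing real part on the circle off its atoms; avoiding
    [a] is therefore what keeps the earlier stages harmless near [a]. *)
Lemma hsum_vanish_circle P a e : circle_atoms P -> cabs a = 1 ->
  (forall p, p \in P -> p.2 != a) -> 0 < e ->
  exists2 d : R, 0 < d & forall w, cabs w < 1 -> cabs (w - a) <= d ->
    1 - cabs w <= e /\ complex.Re (hsum P w) <= e.
Proof.
move=> hP a1 aP e0.
have [|s s0 hs] := @exists_small R [seq (2 : R, cabs (p.2 - a)) | p <- P].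
  by move=> q /mapP[p /aP pa ->] /=; rewrite cabs_gt0 subr_eq0.
have ss : 0 < s ^+ 2 by rewrite exprn_gt0.
have [|d d0 hd] := @exists_small R [:: (1, s); (1, e); (mass P * (2 / s ^+ 2), e)].
  by move=> p; rewrite !inE => /orP[/eqP->|/orP[/eqP->|/eqP->]].
have ds : d <= s by have := hd (1, s); rewrite /= mul1r; apply; rewrite !inE eqxx.
have de : d <= e by have := hd (1, e); rewrite /= mul1r; apply; rewrite !inE eqxx orbT.
have dm : mass P * (2 / s ^+ 2) * d <= e.
  by have := hd (mass P * (2 / s ^+ 2), e); apply; rewrite !inE eqxx !orbT.
exists d => // w w1 wa.
have h1 : 1 - cabs w <= d by rewrite -a1; apply: le_trans (cabs_triB _ _) _; rewrite cabsC.
split; first exact: le_trans de.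
apply: le_trans (Re_hsum_far hP s0 w1 _) _.
  move=> p pP; have := hs (2, cabs (p.2 - a)) (map_f _ pP) => /= h.
  have : cabs (p.2 - a) <= cabs (p.2 - w) + cabs (w - a).
    by have := cabsD (p.2 - w) (w - a); rewrite addrA subrK.
  lra.
apply: le_trans dm; rewrite -[leRHS]mulrA ler_wpM2l ?mass_ge0//.
rewrite mulrAC ler_wpM2r ?invr_ge0 ?(ltW ss)//.
by apply: one_sub_sqr => //; exact: cabs_ge0.
Qed.

Lemma cvg_cabsP (u : nat -> C) a : u n @[n --> \oo] --> a ->
  forall d : R, 0 < d -> exists N, forall n, (N <= n)%N -> cabs (u n - a) <= d.
Proof.
move=> /(@cvgCP _ _ _ (@eventually_filter)) h d /h [N _ hN].
by exists N => n /hN /ltW.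
Qed.

Lemma ready_of_limits (phi1 phi2 : nat -> C -> C) a b (nk : nat -> nat) :
  (forall n, holomorphic_self_map (phi1 n)) -> (forall n, holomorphic_self_map (phi2 n)) ->
  cabs a = 1 -> cabs b = 1 ->
  phi1 n 0 @[n --> \oo] --> a -> phi2 n 0 @[n --> \oo] --> b ->
  {homo nk : i j / (i < j)%N} ->
  `|derive1 (phi1 (nk k)) 0| / (1 - `|phi1 (nk k) 0| ^+ 2) @[k --> \oo] --> (1 : C) ->
  `|derive1 (phi2 (nk k)) 0| / (1 - `|phi2 (nk k) 0| ^+ 2) @[k --> \oo] --> (1 : C) ->
  pseudo_hyperbolic (phi1 (nk k) 0) (phi2 (nk k) 0) @[k --> \oo] --> (1 : C) ->
  forall P d, circle_atoms P -> avoids a b P -> 0 < d ->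
    exists n, stage_ready d (phi1 n) (phi2 n) P.
Proof.
move=> h1 h2 a1 b1 ca cb nkh c1 c2 c3 P d hP aP d0.
have nkn k : (k <= nk k)%N.
  elim: k => // k IH; apply: leq_ltn_trans IH _; exact: nkh.
have [da da0 ha] := hsum_vanish_circle hP a1 (fun p pP => (aP p pP).1) d0.
have [db db0 hb] := hsum_vanish_circle hP b1 (fun p pP => (aP p pP).2) d0.
have [Na hNa] := cvg_cabsP ca da0; have [Nb hNb] := cvg_cabsP cb db0.
have toR (x : nat -> R) (u : nat -> C) : (forall k, u k = (x k)%:C%C) ->
    u k @[k --> \oo] --> (1 : C) -> exists N, forall k, (N <= k)%N -> 1 - x k <= d.
  move=> ux; rewrite (funext ux) => /cvg_to1P /(_ d d0)[N hN].
  by exists N => k /hN; rewrite distrC => /ltW; apply: le_trans; exact: ler_norm.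
have [N1 hN1] := toR (fun k => pick_ratio (phi1 (nk k))) _ (fun k => pick_ratioE _) c1.
have [N2 hN2] := toR (fun k => pick_ratio (phi2 (nk k))) _ (fun k => pick_ratioE _) c2.
have [N3 hN3] := toR (fun k => pseudo (phi1 (nk k) 0) (phi2 (nk k) 0)) _
  (fun k => pseudo_hyperbolicE _ _) c3.
pose k := maxn Na (maxn Nb (maxn N1 (maxn N2 N3))).
have k1 : cabs (phi1 (nk k) 0) < 1 by apply/discE; have [_ h] := h1 (nk k); exact/h/disc0.
have k2 : cabs (phi2 (nk k) 0) < 1 by apply/discE; have [_ h] := h2 (nk k); exact/h/disc0.
have [|u1 u2] := ha _ k1 (hNa (nk k) _).
  by apply: leq_trans (nkn k); rewrite /k !leq_max leqnn.
have [|v1 v2] := hb _ k2 (hNb (nk k) _).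
  by apply: leq_trans (nkn k); rewrite /k !leq_max leqnn orbT.
exists (nk k); split=> //.
- by apply: hN1; rewrite /k !leq_max leqnn ?orbT.
- by apply: hN2; rewrite /k !leq_max leqnn ?orbT.
by split=> //; apply: hN3; rewrite /k !leq_max leqnn ?orbT.
Qed.

End Readiness.

Theorem theorem4p1 (R : realType) (phi1 phi2 : nat -> R[i] -> R[i]) (a b : R[i])
    (hphi1 : forall n, holomorphic_self_map (phi1 n))
    (hphi2 : forall n, holomorphic_self_map (phi2 n))
    (ha : circle a) (hb : circle b)
    (hphi1a : phi1 n 0 @[n --> \oo] --> a)
    (hphi2b : phi2 n 0 @[n --> \oo] --> b) :
  (exists f : R[i] -> R[i],
     singular_inner f /\ disjointly_universal phi1 phi2 f)
  <->
  (exists nk : nat -> nat,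
     [/\ {homo nk : i j / (i < j)%N},
         `|derive1 (phi1 (nk k)) 0| / (1 - `|phi1 (nk k) 0| ^+ 2) @[k --> \oo]
           --> (1 : R[i]),
         `|derive1 (phi2 (nk k)) 0| / (1 - `|phi2 (nk k) 0| ^+ 2) @[k --> \oo]
           --> (1 : R[i])
       & pseudo_hyperbolic (phi1 (nk k) 0) (phi2 (nk k) 0) @[k --> \oo]
           --> (1 : R[i])]).
Proof.
split; first by move=> [f [fi fu]]; exact: (universal_necessary hphi1 hphi2 fi fu).
move=> [nk [nkh c1 c2 c3]].
have ready := ready_of_limits hphi1 hphi2 ((circleE a).1 ha) ((circleE b).1 hb)
  hphi1a hphi2b nkh c1 c2 c3.
have [nu [nus hnu]] := universal_measure hphi1 hphi2 ready.
exists (fun z => cexp (- herglotz_integral nu z)); split.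
  by exists nu.
by split; [exact: singular_inner_classS|exact: universal_closure].
Qed.
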